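(* The operator $\mathbf A^0_\Phi$ generates a positive semigroup on $\mathbf L_1(I)$ if and only if both of the following hold: (i) all off-diagonal entries of the matrices $-\mathbb K^{00}$ and $\mathbb K^{11}$ are nonnegative; (ii) all entries of the matrices $-\mathbb K^{01}$ and $\mathbb K^{10}$ are nonnegative.
   Context: Let $I=[0,1]$ and $m\in\mathbb N$. $\mathbf L_1(I)$ and $\mathbf W^2_1(I)$ denote the $m$-fold products of $L_1(I)$ and of the Sobolev space $W^2_1(I)$ (functions with derivatives up to order $2$ in $L_1(I)$), i.e. spaces of vector functions $\mathbf u=(u_1,\dots,u_m)$. Let $\mathbb D=\mathrm{diag}\{\sigma_i\}_{1\le i\le m}$ with constants $\sigma_i>0$, and let $\mathbb K^{00},\mathbb K^{01},\mathbb K^{10},\mathbb K^{11}$ be arbitrary real $m\times m$ matrices. The operator $\mathbf A^0_\Phi$ in $\mathbf L_1(I)$ is $\mathbf u\mapsto\mathbb D\,\partial_{xx}\mathbf u$ on the domain of all $\mathbf u\in\mathbf W^2_1(I)$ satisfying $$\partial_x\mathbf u(0)=\mathbb K^{00}\mathbf u(0)+\mathbb K^{01}\mathbf u(1),\qquad \partial_x\mathbf u(1)=\mathbb K^{10}\mathbf u(0)+\mathbb K^{11}\mathbf u(1).$$ A semigroup on $\mathbf L_1(I)$ is positive if each of its operators maps vector functions with (a.e.) nonnegative components to vector functions with nonnegative components. *)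

(* Defs.v *)
From HB Require Import structures.
From mathcomp Require Import all_boot all_order all_algebra.
From mathcomp Require Import all_classical all_reals all_analysis.
From mathcomp Require Import measurable_realfun.
Set Implicit Arguments.
Unset Strict Implicit.
Unset Printing Implicit Defensive.
Import Order.TTheory GRing.Theory Num.Theory numFieldNormedType.Exports.
Local Open Scope classical_set_scope.
Local Open Scope ring_scope.
Local Open Scope quotient_scope.

(* The library provides LspaceType1 mu as a bare type of classes of a.e. equal
   functions; here it is given its vector space structure and L^1 norm. *)
Section Lspace1.
Context d (T : measurableType d) (R : realType) (mu : {measure set T -> \bar R}).

Let L := LfunType mu (@lexx _ _ 1%E).
Let Q := {mfun_ mu, T >-> measurableTypeR R}.

Lemma Lspace1P (u v : LspaceType1 mu) :
  (u : T -> R) = v %[ae mu] -> u = v.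
Proof.
move: u v => [u [[ufin]]] [v [[vfin]]] /= uv.
have euv : u = v by rewrite -[u]reprK -[v]reprK; apply/eqquotP/asboolP.
by subst v; rewrite (Prop_irrelevance ufin vfin).
Qed.

Let mfun_of (f : L) : {mfun T >-> measurableTypeR R} :=
  @mfun_Sub _ _ T (measurableTypeR R) f (mem_set (measurable_funPT f)).

Let cls (f : L) : {mfun_ mu, T >-> measurableTypeR R} := \pi_Q (mfun_of f).

Let pi_ae (f : L) : (cls f : T -> R) = f %[ae mu].
Proof.
have : \pi_Q (repr (\pi_Q (mfun_of f))) = \pi_Q (mfun_of f) by rewrite reprK.
by move/eqquotP => /asboolP.
Qed.

Let measurableQ (f : {mfun_ mu, T >-> measurableTypeR R}) :
  measurable_fun [set: T] (f : T -> R).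
Proof.
have h : measurable_fun [set: T] ((f : T -> R) : T -> measurableTypeR R).
  exact: (@measurable_funPT _ _ _ _ (repr f)).
exact: h.
Qed.

Lemma Lspace1_measurable (u : LspaceType1 mu) :
  measurable_fun [set: T] (u : T -> R).
Proof. exact: measurableQ. Qed.

Let pi_fin (f : L) : finite_norm mu 1 (cls f).
Proof.
have := Lfunction_finite _ f; rewrite /finite_norm !Lnorm1.
rewrite (@ae_eq_integral _ _ _ mu _ (fun x => `|(cls f : T -> R) x|%:E))//.
- by apply/measurable_EFinP/measurableT_comp => //; exact: measurable_funPT.
- exact/measurable_EFinP/measurableT_comp.
- by near=> x => _; rewrite /= (near (pi_ae f) x).
Unshelve. all: by end_near. Qed.

Definition Lspace1_of (f : L) : LspaceType1 mu :=
  @LebesgueSpace.Pack _ _ _ _ _ _ (cls f)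
    (LebesgueSpace.Class (isFinLebesgue.Build _ _ _ _ _ _ _ (pi_fin f))).

Lemma Lspace1_ofE (f : L) : (Lspace1_of f : T -> R) = f %[ae mu].
Proof. exact: pi_ae. Qed.

Let fun_Lfun (u : LspaceType1 mu) : (u : T -> R) \in Lfun mu 1.
Proof.
apply/andP; split; apply: mem_set; first exact: Lspace1_measurable.
exact: (@Lebesgue_finite _ _ _ _ _ _ u).
Qed.

Definition Lspace1_repr (u : LspaceType1 mu) : L := Lfun_Sub _ (fun_Lfun u).

Lemma Lspace1_reprE (u : LspaceType1 mu) : Lspace1_repr u = u :> (T -> R).
Proof. by []. Qed.

Local Notation rep := Lspace1_repr.

Definition Lspace1_add u v := Lspace1_of (rep u + rep v).
Definition Lspace1_opp u := Lspace1_of (- rep u).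
Definition Lspace1_zero := Lspace1_of 0.
Definition Lspace1_scale (a : R) u := Lspace1_of (a *: rep u).

Let addE u v :
  (Lspace1_add u v : T -> R) = (fun x => u x + v x) %[ae mu].
Proof. exact: Lspace1_ofE. Qed.
Let oppE u : (Lspace1_opp u : T -> R) = (fun x => - u x) %[ae mu].
Proof. exact: Lspace1_ofE. Qed.
Let zeroE : (Lspace1_zero : T -> R) = (fun => 0) %[ae mu].
Proof. exact: Lspace1_ofE. Qed.
Let scaleE a u : (Lspace1_scale a u : T -> R) = (fun x => a * u x) %[ae mu].
Proof. exact: Lspace1_ofE. Qed.

HB.instance Definition _ := gen_eqMixin (LspaceType1 mu).
HB.instance Definition _ := gen_choiceMixin (LspaceType1 mu).

Let addA : associative Lspace1_add.
Proof.
move=> u v w; apply: Lspace1P.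
near=> x => _; rewrite (near (addE u (Lspace1_add v w)) x)//
  (near (addE v w) x)// (near (addE (Lspace1_add u v) w) x)//
  (near (addE u v) x)//.
by rewrite addrA.
Unshelve. all: by end_near. Qed.

Let addC : commutative Lspace1_add.
Proof.
move=> u v; apply: Lspace1P.
by near=> x => _; rewrite (near (addE u v) x)// (near (addE v u) x)//;
  rewrite addrC.
Unshelve. all: by end_near. Qed.

Let add0 : left_id Lspace1_zero Lspace1_add.
Proof.
move=> u; apply: Lspace1P.
by near=> x => _; rewrite (near (addE Lspace1_zero u) x)//
  (near (zeroE) x)//; rewrite add0r.
Unshelve. all: by end_near. Qed.

Let addN : left_inverse Lspace1_zero Lspace1_opp Lspace1_add.
Proof.
move=> u; apply: Lspace1P.
near=> x => _; rewrite (near (addE (Lspace1_opp u) u) x)//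
  (near (zeroE) x)// (near (oppE u) x)//.
by rewrite addNr.
Unshelve. all: by end_near. Qed.

HB.instance Definition _ :=
  GRing.isZmodule.Build (LspaceType1 mu) addA addC add0 addN.

Lemma Lspace1D u v :
  ((u + v : LspaceType1 mu) : T -> R) = (fun x => u x + v x) %[ae mu].
Proof. exact: addE. Qed.

Let scaleA a b u :
  Lspace1_scale a (Lspace1_scale b u) = Lspace1_scale (a * b) u.
Proof.
apply: Lspace1P.
near=> x => _; rewrite (near (scaleE a (Lspace1_scale b u)) x)//
  (near (scaleE b u) x)// (near (scaleE (a * b) u) x)//; by rewrite mulrA.
Unshelve. all: by end_near. Qed.

Let scale1 : left_id 1 Lspace1_scale.
Proof.
move=> u; apply: Lspace1P.
by near=> x => _; rewrite (near (scaleE 1 u) x)//; rewrite mul1r.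
Unshelve. all: by end_near. Qed.

Let scaleDr : right_distributive Lspace1_scale +%R.
Proof.
move=> a u v; apply: Lspace1P.
near=> x => _; rewrite (near (scaleE a (u + v)) x)//
  (near (Lspace1D u v) x)//
  (near (Lspace1D (Lspace1_scale a u) (Lspace1_scale a v)) x)//
  (near (scaleE a u) x)// (near (scaleE a v) x)//; by rewrite mulrDr.
Unshelve. all: by end_near. Qed.

Let scaleDl u : {morph Lspace1_scale^~ u : a b / a + b}.
Proof.
move=> a b; apply: Lspace1P.
near=> x => _; rewrite (near (scaleE (a + b) u) x)//
  (near (Lspace1D (Lspace1_scale a u) (Lspace1_scale b u)) x)//
  (near (scaleE a u) x)// (near (scaleE b u) x)//; by rewrite mulrDl.
Unshelve. all: by end_near. Qed.

HB.instance Definition _ := GRing.Zmodule_isLmodule.Build R (LspaceType1 mu)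
  scaleA scale1 scaleDr scaleDl.

Lemma Lspace1Z a u :
  ((a *: u : LspaceType1 mu) : T -> R) = (fun x => a * u x) %[ae mu].
Proof. exact: scaleE. Qed.

Lemma Lspace1_0 : ((0 : LspaceType1 mu) : T -> R) = (fun => 0) %[ae mu].
Proof. exact: zeroE. Qed.

Lemma Lspace1_integrable (u : LspaceType1 mu) :
  mu.-integrable [set: T] (EFin \o u).
Proof. exact/Lfun1_integrable/fun_Lfun. Qed.

Definition Lspace1_norm (u : LspaceType1 mu) : R := \int[mu]_x `|u x|.

Let norm_ae (u : LspaceType1 mu) (g : T -> R) :
  measurable_fun setT g -> (u : T -> R) = g %[ae mu] ->
  Lspace1_norm u = \int[mu]_x `|g x|.
Proof.
move=> mg ug; rewrite /Lspace1_norm /Rintegral; congr fine.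
apply: ae_eq_integral => //.
- by apply/measurable_EFinP/measurableT_comp => //; exact: Lspace1_measurable.
- exact/measurable_EFinP/measurableT_comp.
- by near=> x => _; rewrite /= (near (ug) x).
Unshelve. all: by end_near. Qed.

Let int_norm (u : LspaceType1 mu) :
  mu.-integrable [set: T] (EFin \o (fun x => `|u x|)).
Proof. exact: (integrable_norm (Lspace1_integrable u)). Qed.

Let normD u v : Lspace1_norm (u + v) <= Lspace1_norm u + Lspace1_norm v.
Proof.
rewrite (norm_ae _ (Lspace1D u v)); last first.
  by apply: measurable_funD; exact: Lspace1_measurable.
rewrite -RintegralD//; apply: le_Rintegral => //.
- apply: (integrable_norm).
  exact: (integrableD _ (Lspace1_integrable u) (Lspace1_integrable v)).
- exact: (integrableD _ (int_norm u) (int_norm v)).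
- by move=> x _; exact: ler_normD.
Qed.

Let normZ a u : Lspace1_norm (a *: u) = `|a| * Lspace1_norm u.
Proof.
rewrite (norm_ae _ (Lspace1Z a u)); last first.
  by apply: measurable_funM => //; exact: Lspace1_measurable.
by under eq_Rintegral do rewrite normrM; rewrite RintegralZl.
Qed.

Let norm0_eq0 u : Lspace1_norm u = 0 -> u = 0.
Proof.
move=> u0; apply: Lspace1P; have := @fine_Lnormr_eq0 _ _ _ mu _ (lexx _) (rep u).
rewrite Lnorm1 => /(_ u0).
by move=> h; near=> x => _; rewrite (near Lspace1_0 x)//; exact: (near h x).
Unshelve. all: by end_near. Qed.

HB.instance Definition _ := Lmodule_isNormed.Build R (LspaceType1 mu)
  normD normZ norm0_eq0.

Lemma Lspace1_normE (u : LspaceType1 mu) : `|u| = \int[mu]_x `|u x|.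
Proof. by []. Qed.

End Lspace1.

(* The m-fold product of a normed space, with the norm \sum_i `|u i|. *)
Definition mfold (R : realType) (m : nat) (V : normedModType R) : Type :=
  {ffun 'I_m -> V}.

Section mfold.
Context (R : realType) (m : nat) (V : normedModType R).
Local Notation W := (mfold m V).

HB.instance Definition _ := GRing.Lmodule.copy W {ffun 'I_m -> V}.

Definition mfold_app (u : W) : 'I_m -> V := fun i => (u : {ffun 'I_m -> V}) i.

Definition mfold_norm (u : W) : R := \sum_(i < m) `|mfold_app u i|.

Let normD u v : mfold_norm (u + v) <= mfold_norm u + mfold_norm v.
Proof.
rewrite /mfold_norm -big_split/=; apply: ler_sum => i _.
by rewrite /mfold_app ffunE ler_normD.
Qed.

Let normZ a u : mfold_norm (a *: u) = `|a| * mfold_norm u.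
Proof.
rewrite /mfold_norm mulr_sumr; apply: eq_bigr => i _.
by rewrite /mfold_app ffunE normrZ.
Qed.

Let norm0_eq0 u : mfold_norm u = 0 -> u = 0.
Proof.
move=> /eqP; rewrite psumr_eq0// => /allP u0; apply/ffunP => i.
rewrite ffunE; apply/eqP; rewrite -normr_eq0.
exact: (u0 i (mem_index_enum _)).
Qed.

HB.instance Definition _ := Lmodule_isNormed.Build R W normD normZ norm0_eq0.

Lemma mfold_normE (u : W) : `|u| = \sum_(i < m) `|mfold_app u i|.
Proof. by []. Qed.

End mfold.
Coercion mfold_app : mfold >-> Funclass.

Section semigroup.
Context (R : realType) (V : normedModType R).
Implicit Types (T : R -> V -> V) (A : V -> V -> Prop).

(* Only the values T t with 0 <= t matter. *)
Definition C0_semigroup T : Prop :=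
  [/\ forall t, 0 <= t -> linear (T t),
      forall t, 0 <= t -> continuous (T t),
      forall u, T 0 u = u,
      forall s t u, 0 <= s -> 0 <= t -> T (s + t) u = T s (T t u)
    & forall u, T t u @[t --> 0^'+] --> u].

(* An unbounded operator is represented by its graph A: A u f means that u is
   in the domain and is sent to f. The equivalence below makes the domain of
   the generator exactly the set of u for which the limit exists. *)
Definition is_generator T A : Prop :=
  forall u f, A u f <-> h^-1 *: (T h u - u) @[h --> 0^'+] --> f.

End semigroup.

Section interval.
Context (R : realType).

Definition muI : {measure set (measurableTypeR R) -> \bar R} :=
  mrestr (@lebesgue_measure R) (measurable_itv `[(0 : R), 1]).

Definition L1I : normedModType R := LspaceType1 muI.

(* C^1 functions with compact support in the open interval ]0, 1[, which is
   Brezis' choice of test functions for Sobolev spaces on an interval *)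
Definition test_fun (phi : R -> R) : Prop :=
  [/\ forall x, derivable phi x 1,
      continuous (derive1 phi)
    & exists a b, [/\ 0 < a, b < 1 & forall x, phi x != 0 -> a <= x <= b]].

Definition weak_derivative (u v : LspaceType1 muI) : Prop :=
  forall phi, test_fun phi ->
    \int[muI]_x (u x * derive1 phi x) = - \int[muI]_x (v x * phi x).

(* Boundary values of elements of W^1_1(I) are those of the continuous
   representative. *)
Definition continuous_rep (u : LspaceType1 muI) (c : R -> R) : Prop :=
  {within `[0, 1], continuous c} /\ (u : R -> R) = c %[ae muI].

Section vector.
Context (m : nat).
Local Notation L1 := (mfold m L1I).

Definition weak_derivativev (u v : L1) : Prop :=
  forall i, weak_derivative (u i) (v i).

Definition continuous_repv (u : L1) (c : R -> 'cV[R]_m) : Prop :=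
  forall i, continuous_rep (u i) (fun x => c x i 0).

Definition W21 (u : L1) : Prop :=
  exists du ddu, weak_derivativev u du /\ weak_derivativev du ddu.

Definition boundary_condition (K00 K01 K10 K11 : 'M[R]_m) (u : L1) : Prop :=
  exists du c dc,
    [/\ weak_derivativev u du, continuous_repv u c, continuous_repv du dc,
        dc 0 = K00 *m c 0 + K01 *m c 1
      & dc 1 = K10 *m c 0 + K11 *m c 1].

Definition A_Phi (sigma : 'I_m -> R) (K00 K01 K10 K11 : 'M[R]_m)
    (u f : L1) : Prop :=
  [/\ W21 u, boundary_condition K00 K01 K10 K11 u
    & exists du ddu,
        [/\ weak_derivativev u du, weak_derivativev du ddu
          & forall i, f i = sigma i *: ddu i]].

Definition nonneg (u : L1) : Prop :=
  forall i, {ae muI, forall x, 0 <= (u i : LspaceType1 muI) x}.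

Definition positive_semigroup (T : R -> L1 -> L1) : Prop :=
  forall t, 0 <= t -> forall u, nonneg u -> nonneg (T t u).

Definition generates_positive_semigroup (A : L1 -> L1 -> Prop) : Prop :=
  exists T, [/\ C0_semigroup T, is_generator T A & positive_semigroup T].

End vector.
End interval.

(* Main.v *)
Require Import Defs.
From HB Require Import structures.
From mathcomp Require Import all_boot all_order all_algebra.
From mathcomp Require Import all_classical all_reals all_analysis.
From mathcomp Require Import measurable_realfun.
From mathcomp Require Import ring lra.
Set Implicit Arguments.
Unset Strict Implicit.
Unset Printing Implicit Defensive.
Import Order.TTheory GRing.Theory Num.Theory numFieldNormedType.Exports.
Local Open Scope classical_set_scope.
Local Open Scope ring_scope.

(* Sufficiency. Let w(x) = e^(C x) + e^(C (1 - x)) with C large, and test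
   u - h A u = g against w 1_{u_i > 0} / sigma_i. After integration by parts the
   slope of w at the end points absorbs the boundary terms, where the sign
   conditions allow u to be replaced by its positive part; so the weighted norm
   N satisfies (1 - h omega) N(u^+) <= N(g^+). Applied to u and -u this makes A
   quasi-dissipative for an equivalent norm and its resolvents positive; it also
   makes the linear system for the 2m integration constants of the explicit
   solutions injective, hence solvable. The semigroup is then the limit of
   backward Euler iterates, which preserve the closed positive cone.

   Necessity. For a positive semigroup T, u in the domain of A and lam >= 0 with
   lam u - A u >= 0, one has exp (- lam t) T(t) u <= u. If the boundary
   coefficient from a site q to another site p (a component at an end point) has
   the wrong sign, there are polynomials u_N in the domain, bounded in N, with
   lam_N u_N - A u_N >= 0 for some lam_N ~ N^2, and u_N <= - c / N in the
   component of p on an interval of length c / N next to p. Hence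
   c^2 / N^2 <= exp (- lam_N t) |T(t) u_N|, which fails for N large. *)

(** The domain is given by weak derivatives, with separate witnesses in its clauses, whereas the
    estimates need point values at 0 and 1. [A_PhiP] therefore turns membership into a pair of
    absolutely continuous functions, on which all later arguments run. The plain $L_1$ norm does not
    suffice: testing with the indicator of $u_i>0$ leaves point values of $u$ at the end points,
    which no $L_1$ norm controls. The weight solves $w''=C^2w$, so its interior cost is only a
    growth rate, while its outward slope at the end points, relative to its value there, grows like
    $C$ and so beats any boundary matrices. The factor $1/\sigma_i$ cancels the diffusion constants,
    so the fluxes of all components enter with the same factor. Conversely, of $T$ only positivity,
    its generator and strong continuity are given. A local bound comes from the uniform boundedness
    principle, and the contradiction is reached at one fixed time: the discount decays faster than
    any power of $N$, while the negative spike has mass of order $N^{-2}$. *)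

Section ModuleExpressions.
Context (R : comPzRingType) (V : lmodType R).

(** Syntax of linear combinations, so that an identity between vectors reduces to finitely many
    scalar identities, which [ring] and [field] can close. *)
Inductive mexpr : Type :=
  | MVar of nat
  | MZero
  | MAdd of mexpr & mexpr
  | MOpp of mexpr
  | MScale of R & mexpr.

Fixpoint meval (env : seq V) e : V := match e with
  | MVar i => nth 0 env i
  | MZero => 0
  | MAdd e1 e2 => meval env e1 + meval env e2
  | MOpp e1 => - meval env e1
  | MScale a e1 => a *: meval env e1
  end.

Fixpoint mcoef (i : nat) e : R := match e with
  | MVar j => if PeanoNat.Nat.eqb i j then 1 else 0
  | MZero => 0
  | MAdd e1 e2 => mcoef i e1 + mcoef i e2
  | MOpp e1 => - mcoef i e1
  | MScale a e1 => a * mcoef i e1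
  end.

Fixpoint mforall (P : nat -> Prop) (n : nat) : Prop :=
  if n is n'.+1 then P n' /\ mforall P n' else True.

Lemma mevalE env e :
  meval env e = \sum_(i < size env) mcoef i e *: nth 0 env i.
Proof.
elim: e => [j||e1 IH1 e2 IH2|e IH|a e IH] /=.
- have [jn|jn] := ltnP j (size env); last first.
    rewrite nth_default// big1// => i _.
    case: PeanoNat.Nat.eqb_spec => [ij|]; last by rewrite scale0r.
    by have := ltn_ord i; rewrite ij ltnNge jn.
  rewrite (bigD1 (Ordinal jn))//= PeanoNat.Nat.eqb_refl scale1r big1 ?addr0// => i.
  case: PeanoNat.Nat.eqb_spec => [ij /eqP[]|]; last by rewrite scale0r.
  exact: val_inj.
- by rewrite big1// => i _; rewrite scale0r.
- by rewrite IH1 IH2 -big_split; apply: eq_bigr => i _; rewrite scalerDl.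
- by rewrite IH -sumrN; apply: eq_bigr => i _; rewrite scaleNr.
- by rewrite IH scaler_sumr; apply: eq_bigr => i _; rewrite scalerA.
Qed.

Lemma mexpr_eq env e1 e2 :
  mforall (fun i => mcoef i e1 = mcoef i e2) (size env) ->
  meval env e1 = meval env e2.
Proof.
move=> H; rewrite !mevalE; apply: eq_bigr => i _; congr (_ *: _).
elim: (size env) H i => [_ []//|n IH /= [Hn H] i].
have := ltn_ord i; rewrite ltnS leq_eqVlt => /predU1P[->//|ltin].
exact: (IH H (Ordinal ltin)).
Qed.

End ModuleExpressions.

Ltac mod_index x env :=
  lazymatch env with
  | x :: _ => constr:(O)
  | _ :: ?env' => let n := mod_index x env' in constr:(S n)
  end.

Ltac mod_in x env :=
  lazymatch env with
  | nil => constr:(false)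
  | x :: _ => constr:(true)
  | _ :: ?env' => mod_in x env'
  end.

Ltac mod_env t env :=
  lazymatch t with
  | (?a + ?b)%R => let e := mod_env a env in mod_env b e
  | (- ?a)%R => mod_env a env
  | (_ *: ?a)%R => mod_env a env
  | 0%R => env
  | _ => lazymatch mod_in t env with
         | true => env
         | false => constr:(t :: env)
         end
  end.

Ltac mod_reify R t env :=
  lazymatch t with
  | (?a + ?b)%R => let x := mod_reify R a env in let y := mod_reify R b env in
      constr:(@MAdd R x y)
  | (- ?a)%R => let x := mod_reify R a env in constr:(@MOpp R x)
  | (?k *: ?a)%R => let x := mod_reify R a env in constr:(@MScale R k x)
  | 0%R => constr:(@MZero R)
  | _ => let n := mod_index t env in constr:(@MVar R n)
  end.

(* Proves an equality of linear combinations by comparing coefficients. *)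
Ltac module_eq R V :=
  lazymatch goal with
  | |- ?a = ?b =>
    let e0 := mod_env a (@nil V) in
    let env := mod_env b e0 in
    let x := mod_reify R a env in
    let y := mod_reify R b env in
    refine (@mexpr_eq R V env x y _); cbn [mforall mcoef size PeanoNat.Nat.eqb]; repeat split
  end.

(** * Generation of semigroups of quasi-contractions *)

Section HilleYosida.
Context (R : realType) (V : normedModType R).
Variables (N : V -> R) (c C : R).
Hypothesis c_gt0 : 0 < c.
Hypothesis C_ge0 : 0 <= C.
Hypothesis ND : forall u v, N (u + v) <= N u + N v.
Hypothesis NZ : forall a u, N (a *: u) = `|a| * N u.
Hypothesis N_ge : forall u, c * `|u| <= N u.
Hypothesis N_le : forall u, N u <= C * `|u|.
Variable B : V -> V -> Prop.
Hypothesis B_lin : forall a u f v g,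
  B u f -> B v g -> B (a *: u + v) (a *: f + g).
Variable h0 : R.
Hypothesis h0_gt0 : 0 < h0.
Hypothesis B_diss : forall h u f : _, 0 < h <= h0 -> B u f -> N u <= N (u - h *: f).
Hypothesis B_range : forall h g, 0 < h <= h0 ->
  exists u, B u (h^-1 *: (u - g)).
Hypothesis B_dense : forall u (e : R), 0 < e -> exists v f, B v f /\ N (u - v) <= e.
Hypothesis V_complete : forall x : nat -> V,
  (forall e : R, 0 < e -> exists K, forall j k, (K <= j)%N -> (K <= k)%N ->
     `|x j - x k| <= e) ->
  exists l : V, x n @[n --> \oo] --> l.
Let N0 : N 0 = 0.
Proof. by have := NZ 0 0; rewrite scale0r normr0 mul0r. Qed.

Let NN u : N (- u) = N u.
Proof. by rewrite -scaleN1r NZ normrN1 mul1r. Qed.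

Let NBC u v : N (u - v) = N (v - u).
Proof. by rewrite -NN opprB. Qed.

Let N_ge0 u : 0 <= N u.
Proof. by apply: le_trans (N_ge u); rewrite mulr_ge0// ltW. Qed.

Let NB u v : N (u - v) <= N u + N v.
Proof. by rewrite -(NN v); exact: ND. Qed.

Let N_triangle v u w : N (u - w) <= N (u - v) + N (v - w).
Proof. by apply: le_trans (ND _ _); rewrite addrA subrK. Qed.

Let N_add2 u v x y : N u <= x -> N v <= y -> N (u + v) <= x + y.
Proof. by move=> ux vy; apply: le_trans (ND _ _) (lerD ux vy). Qed.

Let N_le0 u : N u <= 0 -> u = 0.
Proof.
move=> Nu; apply/eqP; rewrite -normr_le0 -(pmulr_rle0 _ c_gt0).
exact: le_trans Nu.
Qed.

Let B0 : B 0 0.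
Proof.
have [|v [f [Bf _]]] := @B_dense 0 1; first by [].
by have := B_lin (-1) Bf Bf; rewrite !scaleN1r !addNr.
Qed.

Let BB u f v g : B u f -> B v g -> B (u - v) (f - g).
Proof. by move=> Bu Bv; have := B_lin (-1) Bv Bu; rewrite !scaleN1r ![- _ + _]addrC. Qed.

(** The resolvent $(1-hB)^{-1}$; for [0 < h <= h0] the default 0 is never reached, by [B_range]. *)
Let J h g : V := xget 0 [set u | B u (h^-1 *: (u - g))].

Let JP h g : 0 < h <= h0 -> B (J h g) (h^-1 *: (J h g - g)).
Proof.
by move=> hh; have [u Bu] := B_range g hh; apply: (@xgetPex _ 0 [set u | B u _]); exists u.
Qed.

Let resolvent_uniq h u f : 0 < h <= h0 -> B u f -> J h (u - h *: f) = u.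
Proof.
move=> hh Bu; apply/eqP; rewrite -subr_eq0; apply/eqP/N_le0.
have h_neq0 : h != 0 by case/andP: hh => /gt_eqF->.
apply: le_trans (B_diss hh (BB (JP (u - h *: f) hh) Bu)) _.
set x := J _ _; rewrite (_ : _ - _ = 0) ?N0//.
by module_eq R V; field.
Qed.

Let J_contr h g : 0 < h <= h0 -> N (J h g) <= N g.
Proof.
move=> hh; have h_neq0 : h != 0 by case/andP: hh => /gt_eqF->.
apply: le_trans (B_diss hh (JP g hh)) _.
by rewrite scalerA mulfV// scale1r subKr.
Qed.

Let J_lin h a u v : 0 < h <= h0 -> J h (a *: u + v) = a *: J h u + J h v.
Proof.
move=> hh; have h_neq0 : h != 0 by case/andP: hh => /gt_eqF->.
rewrite -[RHS](resolvent_uniq hh (B_lin a (JP u hh) (JP v hh))); congr (J h _).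
by module_eq R V; field.
Qed.

Let JB h u v : 0 < h <= h0 -> J h (u - v) = J h u - J h v.
Proof.
by move=> hh; rewrite -scaleN1r addrC J_lin// scaleN1r addrC.
Qed.

Let JE h u f : 0 < h <= h0 -> B u f -> J h u = u + h *: J h f.
Proof.
move=> hh Bu; rewrite -[X in X + _](resolvent_uniq hh Bu) -scaleNr [u + _]addrC J_lin//.
by module_eq R V; ring.
Qed.

Let BJ h u f : 0 < h <= h0 -> B u f -> B (J h u) (J h f).
Proof.
move=> hh Bu; have := JP u hh; rewrite {2}(JE hh Bu) addrC addKr scalerA mulVf ?scale1r//.
by case/andP: hh => /gt_eqF->.
Qed.

Let Jn h n u := iter n (J h) u.

Let JnS h n u : Jn h n.+1 u = Jn h n (J h u). Proof. exact: iterSr. Qed.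

Let Jn_contr h n u : 0 < h <= h0 -> N (Jn h n u) <= N u.
Proof.
by move=> hh; elim: n => //= n IH; apply: le_trans (J_contr _ hh) IH.
Qed.

Let Jn_lin h n a u v : 0 < h <= h0 -> Jn h n (a *: u + v) = a *: Jn h n u + Jn h n v.
Proof. by move=> hh; elim: n => //= n IH; rewrite /Jn/= -!/(Jn _ _ _) IH J_lin. Qed.

Let JnB h n u v : 0 < h <= h0 -> Jn h n (u - v) = Jn h n u - Jn h n v.
Proof. by move=> hh; rewrite -scaleN1r addrC Jn_lin// scaleN1r addrC. Qed.

Let BJn h n u f : 0 < h <= h0 -> B u f -> B (Jn h n u) (Jn h n f).
Proof. by move=> hh Bu; elim: n => //= n IH; exact: BJ. Qed.

Let J_near h u f : 0 < h <= h0 -> B u f -> N (J h u - u) <= h * N f.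
Proof.
move=> hh Bu; rewrite (JE hh Bu) addrC addKr NZ gtr0_norm ?(andP hh).1//.
by rewrite ler_pM2l ?(andP hh).1// J_contr.
Qed.

(* Backward Euler: halving the step h changes one iterate by h^2/4 |B^2 u| at
   most, so the iterates with dyadic steps form a Cauchy sequence. *)
Let J_half h u f g : 0 < h <= h0 -> B u f -> B f g ->
  N (J h u - Jn (h / 2) 2 u) <= h ^+ 2 / 4 * N g.
Proof.
move=> hh Bu Bf; have h_gt0 := (andP hh).1.
have hh2 : 0 < h / 2 <= h0 by case/andP: hh => ? ?; apply/andP; split; lra.
set K := J (h / 2).
have Ku := JE hh2 Bu; have Kf := JE hh2 Bf; rewrite -/K in Ku Kf.
have KKf := JE hh2 (BJ hh2 Bf); rewrite -/K in KKf.
have KKu := JE hh2 (BJ hh2 Bu); rewrite -/K in KKu.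
have B1 := BJ hh2 (BJ hh2 Bu); have B2 := BJ hh2 (BJ hh2 Bf).
rewrite -/K in B1 B2.
set v := K (K g) in B2 KKf.
(* Apply $(1-\frac h2B)^2=(1-hB)+\frac{h^2}4B^2$ to $K^2u$, then apply $J_h$ to both sides. *)
have E : J h u = K (K u) + (h ^+ 2 / 4) *: J h v.
  rewrite -[X in X + _](resolvent_uniq hh B1).
  rewrite addrC -J_lin//; congr (J h _).
  rewrite KKu KKf Ku.
  by module_eq R V; field.
rewrite E addrC addKr NZ ger0_norm; last by rewrite divr_ge0// sqr_ge0.
rewrite ler_wpM2l//; first by rewrite divr_ge0// sqr_ge0.
apply: le_trans (J_contr _ hh) _.
by apply: le_trans (J_contr _ hh2) _; exact: J_contr.
Qed.

(** The one-step errors of [J_half] merely add up, because every later step is a contraction. *)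
Let Jn_half h n u f g : 0 < h <= h0 -> B u f -> B f g ->
  N (Jn h n u - Jn (h / 2) (n + n) u) <= n%:R * (h ^+ 2 / 4 * N g).
Proof.
move=> hh Bu Bf.
have hh2 : 0 < h / 2 <= h0 by case/andP: hh => ? ?; apply/andP; split; lra.
elim: n => [|n IH]; first by rewrite /Jn/= subrr N0 mul0r.
rewrite addSn addnS; set w := Jn (h / 2) (n + n) u in IH.
have -> : Jn h n.+1 u - Jn (h / 2) (n + n).+2 u =
   J h (Jn h n u - w) + (J h w - Jn (h / 2) 2 w).
  by rewrite JB// addrA subrK.
apply: le_trans (ND _ _) _; rewrite -[n.+1%:R]natr1 mulrDl mul1r lerD//.
  exact: le_trans (J_contr _ hh) IH.
apply: le_trans (J_half hh (BJn _ hh2 Bu) (BJn _ hh2 Bf)) _.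
by rewrite ler_wpM2l ?Jn_contr// divr_ge0// sqr_ge0.
Qed.

Let Jn_near h n u f : 0 < h <= h0 -> B u f -> N (Jn h n u - u) <= n%:R * h * N f.
Proof.
move=> hh Bu; elim: n => [|n IH]; first by rewrite /Jn/= subrr N0 !mul0r.
have -> : Jn h n.+1 u - u = J h (Jn h n u - u) + (J h u - u).
  by rewrite JB// addrA subrK.
apply: le_trans (ND _ _) _; rewrite -[n.+1%:R]natr1 !mulrDl mul1r lerD ?J_near//.
exact: le_trans (J_contr _ hh) IH.
Qed.

(** The error is $h\sum_{k\le n}(J^kf-f)$, and [Jn_near] bounds the $k$-th difference by
    $kh\,N(g)$. *)
Let Jn_taylor h n u f g : 0 < h <= h0 -> B u f -> B f g ->
  N (Jn h n u - u - (n%:R * h) *: f) <= (n%:R * h) ^+ 2 * N g.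
Proof.
move=> hh Bu Bf; elim: n => [|n IH].
  by rewrite /Jn/= mul0r scale0r subrr subr0 N0 expr0n/= mul0r.
have -> : Jn h n.+1 u - u - (n.+1%:R * h) *: f =
   Jn h n u - u - (n%:R * h) *: f + h *: (Jn h n.+1 f - f).
  rewrite {1}JnS (JE hh Bu) [u + _]addrC Jn_lin// -JnS -[n.+1%:R]natr1.
  by module_eq R V; ring.
apply: le_trans (ND _ _) (le_trans (lerD IH (_ : _ <= h * (n.+1%:R * h * N g))) _).
  by rewrite NZ gtr0_norm ?(andP hh).1// ler_pM2l ?(andP hh).1//; exact: Jn_near.
rewrite -[n.+1%:R]natr1; have := N_ge0 g; have := (andP hh).1; have : 0 <= n%:R :> R by [].
move: (n%:R : R) (N g) => x y x0 h_gt0 y0.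
rewrite -subr_ge0 (_ : _ - _ = x * h ^+ 2 * y); last by ring.
by apply: mulr_ge0 => //; apply: mulr_ge0 => //; exact: sqr_ge0.
Qed.

Let step k : R := h0 / 2 ^+ k.

Let step_le k : 0 < step k <= h0.
Proof.
rewrite divr_gt0 ?exprn_gt0//= ler_pdivrMr ?exprn_gt0// ler_peMr ?(ltW h0_gt0)//.
by rewrite exprn_ege1// ler1n.
Qed.

Let step_gt0 k : 0 < step k. Proof. by case/andP: (step_le k). Qed.

Let stepS k : step k.+1 = step k / 2.
Proof. by rewrite /step exprSr invfM mulrA. Qed.

Let step_small e : 0 < e -> exists K, forall k, (K <= k)%N -> step k <= e.
Proof.
move=> e0; exists (Num.truncn (h0 / e)).+1 => k Kk.
rewrite ler_pdivrMr ?exprn_gt0// mulrC -ler_pdivrMr//.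
apply: le_trans (ltW (truncnS_gt _)) _.
rewrite -natrX ler_nat (leq_trans Kk)//; exact/ltnW/ltn_expl.
Qed.

Let nstep k (t : R) := Num.truncn (t / step k).

Let nstep_le k t : 0 <= t -> (nstep k t)%:R * step k <= t.
Proof. by move=> t0; rewrite -ler_pdivlMr// truncn_le divr_ge0// ltW. Qed.

Let nstep_gt k t : t - step k < (nstep k t)%:R * step k.
Proof.
rewrite ltrBlDr -[X in _ + X]mul1r -mulrDl natr1 -ltr_pdivrMr//.
exact: truncnS_gt.
Qed.

(** Rounding a time to the grid is additive only up to one step; [b] is that spare step. *)
Let truncnD01 (x y : R) : 0 <= x -> 0 <= y -> exists b : bool,
  Num.truncn (x + y) = (Num.truncn x + Num.truncn y + b)%N.
Proof.
move=> x0 y0; have /andP[x1 x2] := truncn_itv x0; have /andP[y1 y2] := truncn_itv y0.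
move: x1 x2 y1 y2; rewrite -![_.+1%:R]natr1 => x1 x2 y1 y2.
have [le_xy|lt_xy] := leP (Num.truncn x + Num.truncn y).+1%:R (x + y).
  exists true; apply: truncn_def; rewrite addn1 le_xy/=.
  by rewrite -[_.+2%:R]natr1 -[_.+1%:R]natr1 natrD; lra.
exists false; apply: truncn_def; rewrite addn0 lt_xy andbT natrD; lra.
Qed.

Let Jstep_add k n (b : bool) u f : B u f ->
  N (Jn (step k) (n + b)%N u - Jn (step k) n u) <= step k * N f.
Proof.
move=> Bu; case: b; last by rewrite addn0 subrr N0 mulr_ge0// ltW.
rewrite addn1 JnS -JnB// (le_trans (Jn_contr _ _ (step_le k)))//.
exact: (J_near (step_le k)).
Qed.

Let Sk k t u := Jn (step k) (nstep k t) u.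

Let Sk_contr k t u : N (Sk k t u) <= N u. Proof. exact: Jn_contr. Qed.

Let SkB k t u v : Sk k t (u - v) = Sk k t u - Sk k t v. Proof. exact: JnB. Qed.

(** Two costs: the Euler error of [Jn_half], and at most one extra half step caused by rounding [t]
    to the finer grid. *)
Let SkS k t u f g : 0 <= t -> B u f -> B f g ->
  N (Sk k.+1 t u - Sk k t u) <= step k * (t * N g + N f).
Proof.
move=> t0 Bu Bf.
have -> : Sk k.+1 t u = Jn (step k / 2) (nstep k.+1 t) u by rewrite /Sk stepS.
have tk0 : 0 <= t / step k by rewrite divr_ge0// ltW.
have [b nE] := truncnD01 tk0 tk0.
have -> : nstep k.+1 t = (nstep k t + nstep k t + b)%N.
  by rewrite -nE /nstep stepS; congr Num.truncn; field; rewrite gt_eqF.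
apply: le_trans (N_triangle (Jn (step k / 2) (nstep k t + nstep k t) u) _ _) _.
rewrite mulrDr addrC lerD//.
  rewrite NBC; apply: le_trans (Jn_half _ (step_le k) Bu Bf) _.
  move: (nstep_le k t0) (N_ge0 g) (step_gt0 k).
  move: (nstep k t)%:R (step k) (N g) => n h y nh y0 hp.
  have -> : n * (h ^+ 2 / 4 * y) = (n * h) * (h * y / 4) by field.
  apply: (@le_trans _ _ (t * (h * y / 4))).
    by rewrite ler_wpM2r// !mulr_ge0// ltW.
  have -> : t * (h * y / 4) = h * (t * y) / 4 by field.
  by rewrite ler_pdivrMr// ler_peMr ?ler1n// !mulr_ge0// ltW.
have := Jstep_add k.+1 (nstep k t + nstep k t) b Bu; rewrite stepS => /le_trans; apply.
by rewrite ler_wpM2r// ler_pdivrMr// ler_peMr ?(ltW (step_gt0 _))// ler1n.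
Qed.

(** The factor $2(\mathrm{step}_k-\mathrm{step}_{k+j})$ is the geometric sum of the bounds of
    [SkS]. *)
Let Sk_cauchy2 k j t u f g : 0 <= t -> B u f -> B f g ->
  N (Sk (k + j)%N t u - Sk k t u) <= 2 * (step k - step (k + j)) * (t * N g + N f).
Proof.
move=> t0 Bu Bf; set M := t * N g + N f; elim: j => [|j IH].
  by rewrite addn0 !subrr N0 mulr0 mul0r.
rewrite addnS; apply: le_trans (N_triangle (Sk (k + j) t u) _ _) _.
apply: le_trans (lerD (SkS _ t0 Bu Bf) IH) _.
rewrite -/M; clear IH; clearbody M; rewrite stepS; move: (step k) (step (k + j)) M => x y z.
by rewrite le_eqVlt; apply/orP; left; apply/eqP; field.
Qed.

(** One resolvent with a small step moves an element of the domain of $B$ into that of $B^2$ and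
    changes it little. *)
Let B2_dense u e : 0 < e -> exists v f g, [/\ B v f, B f g & N (u - v) <= e].
Proof.
move=> e0; have [//|v [f [Bv uv]]] := @B_dense u (e / 2); first by rewrite divr_gt0.
have [|K hK] := @step_small (e / 2 / (N f + 1)).
  by rewrite !divr_gt0// ltr_wpDl.
have hh := step_le K.
exists (J (step K) v), (J (step K) f), ((step K)^-1 *: (J (step K) f - f)).
split; [exact: BJ|exact: JP|].
apply: le_trans (N_triangle v _ _) _; rewrite (splitr e) lerD//.
rewrite NBC; apply: le_trans (J_near hh Bv) _.
apply: le_trans (_ : step K * (N f + 1) <= _); first by rewrite ler_pM2l// lerDl.
by rewrite -ler_pdivlMr ?hK// ltr_wpDl.
Qed.

Let Sk_cauchy t u e : 0 <= t -> 0 < e ->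
  exists K, forall j k, (K <= j)%N -> (K <= k)%N -> N (Sk j t u - Sk k t u) <= e.
Proof.
move=> t0 e0; have [|v [f [g [Bv Bf uv]]]] := @B2_dense u (e / 8).
  by rewrite divr_gt0.
set M := t * N g + N f; have M0 : 0 <= M by rewrite addr_ge0// mulr_ge0.
have [|K hK] := @step_small (e / 8 / (M + 1)).
  by rewrite !divr_gt0// ltr_wpDl.
exists K; suff H k : (K <= k)%N -> N (Sk k t u - Sk K t u) <= e / 2.
  move=> j k Kj Kk; apply: le_trans (N_triangle (Sk K t u) _ _) _.
  by rewrite (splitr e) lerD// ?H// NBC H.
move=> /subnKC <-; set j := (k - K)%N.
have -> : Sk (K + j) t u - Sk K t u =
  Sk (K + j) t (u - v) + (Sk (K + j) t v - Sk K t v) - Sk K t (u - v).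
  by rewrite !SkB; module_eq R V; ring.
apply: le_trans (NB _ _) _; apply: le_trans (lerD (ND _ _) (Sk_contr _ _ _)) _.
have H1 := Sk_contr (K + j) t (u - v).
have H2 := Sk_cauchy2 K j t0 Bv Bf; rewrite -/M in H2.
have H3 : step K * (M + 1) <= e / 8 by rewrite -ler_pdivlMr ?hK// ltr_wpDl.
have H4 : 0 <= step (K + j) * M by rewrite mulr_ge0// ltW.
have := step_gt0 K; lra.
Qed.

Let Sk_cvg t u : 0 <= t -> exists l : V, Sk n t u @[n --> \oo] --> l.
Proof.
move=> t0; apply: V_complete => e e0.
have [|K hK] := @Sk_cauchy t u (c * e) t0; first by rewrite mulr_gt0.
exists K => j k Kj Kk; have := hK j k Kj Kk.
by move/(le_trans (N_ge _)); rewrite ler_pM2l.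
Qed.

Let S (t : R) u : V := lim (Sk n t u @[n --> \oo]).

Let S_near t u e : 0 <= t -> 0 < e ->
  exists K, forall k, (K <= k)%N -> N (Sk k t u - S t u) <= e.
Proof.
move=> t0 e0; have /cvgrPdist_le : Sk n t u @[n --> \oo] --> S t u.
  exact/cvg_ex/Sk_cvg.
have e1 : 0 < e / (C + 1) by rewrite divr_gt0// ltr_wpDl.
move=> /(_ _ e1)[K _ hK]; exists K => k Kk.
rewrite NBC; apply: le_trans (N_le _) _.
apply: (@le_trans _ _ ((C + 1) * (e / (C + 1)))).
  by rewrite ler_pM// ?lerDl// hK.
by rewrite mulrC divfK// gt_eqF// ltr_wpDl.
Qed.

Let le_limN u b : (forall e, 0 < e -> N u <= b + e) -> N u <= b.
Proof. by move=> H; apply/ler_addgt0Pr. Qed.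

Let eq_limN u v : (forall e, 0 < e -> N (u - v) <= e) -> u = v.
Proof.
move=> H; apply/eqP; rewrite -subr_eq0; apply/eqP/N_le0/le_limN => e e0.
by rewrite add0r H.
Qed.

Let S_contr t u : 0 <= t -> N (S t u) <= N u.
Proof.
move=> t0; apply: le_limN => e e0; have [K /(_ _ (leqnn _)) hK] := S_near u t0 e0.
have := ND (Sk K t u) (S t u - Sk K t u); rewrite addrC subrK NBC => /le_trans; apply.
by rewrite lerD// Sk_contr.
Qed.

Let S_lin t a u v : 0 <= t -> S t (a *: u + v) = a *: S t u + S t v.
Proof.
move=> t0; apply: eq_limN => e e0.
have e3 : 0 < e / 3 by rewrite divr_gt0.
have e4 : 0 < e / 3 / (`|a| + 1) by rewrite divr_gt0// ltr_wpDl.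
have [K1 h1] := S_near (a *: u + v) t0 e3; have [K2 h2] := S_near u t0 e4.
have [K3 h3] := S_near v t0 e3.
set K := maxn K1 (maxn K2 K3).
have {}h1 := h1 K (leq_maxl _ _).
have {}h2 := h2 K (leq_trans (leq_maxl _ _) (leq_maxr _ _)).
have {}h3 := h3 K (leq_trans (leq_maxr _ _) (leq_maxr _ _)).
have -> : S t (a *: u + v) - (a *: S t u + S t v) =
  a *: (Sk K t u - S t u) + (Sk K t v - S t v) - (Sk K t (a *: u + v) - S t (a *: u + v)).
  by rewrite [Sk K t (a *: u + v)]Jn_lin// -!/(Sk _ _ _); module_eq R V; ring.
apply: le_trans (NB _ _) _; apply: le_trans (lerD (ND _ _) h1) _.
have : `|a| * N (Sk K t u - S t u) <= e / 3.
  rewrite -[e / 3](@mulfVK _ (`|a| + 1)) ?gt_eqF ?ltr_wpDl// mulrC.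
  by rewrite ler_pM// lerDl.
rewrite NZ; lra.
Qed.

Let SB t u v : 0 <= t -> S t (u - v) = S t u - S t v.
Proof. by move=> t0; rewrite -scaleN1r addrC S_lin// scaleN1r addrC. Qed.

Let S0 u : S 0 u = u.
Proof.
apply: eq_limN => e e0; have [K /(_ _ (leqnn _)) hK] := S_near u (lexx 0) e0.
by rewrite NBC; move: hK; rewrite /Sk /nstep mul0r truncn0.
Qed.

(** At a common level both sides are powers of one resolvent, with exponents differing by at most
    one. The spare step is harmless only on the domain, hence the detour through [v]. *)
Let S_add s t u : 0 <= s -> 0 <= t -> S (s + t) u = S s (S t u).
Proof.
move=> s0 t0; have st0 : 0 <= s + t by rewrite addr_ge0.
apply: eq_limN => e e0.
have e6 : 0 < e / 6 by rewrite divr_gt0.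
have [v [f [Bv uv]]] := B_dense u e6.
have [K1 h1] := S_near u st0 e6; have [K2 h2] := S_near u t0 e6.
have [K3 h3] := S_near (S t u) s0 e6.
have [|K4 h4] := @step_small (e / 6 / (N f + 1)).
  by rewrite divr_gt0// ltr_wpDl.
set K := maxn (maxn K1 K2) (maxn K3 K4).
have {}h1 := h1 K (leq_trans (leq_maxl _ _) (leq_maxl _ _)).
have {}h2 := h2 K (leq_trans (leq_maxr _ _) (leq_maxl _ _)).
have {}h3 := h3 K (leq_trans (leq_maxl _ _) (leq_maxr _ _)).
have {}h4 := h4 K (leq_trans (leq_maxr _ _) (leq_maxr _ _)).
have {}h4 : step K * N f <= e / 6.
  apply: le_trans (_ : step K * (N f + 1) <= _); first by rewrite ler_pM2l// lerDl.
  by rewrite -ler_pdivlMr// ltr_wpDl.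
have H w : Sk K s (Sk K t w) = Jn (step K) (nstep K s + nstep K t) w.
  by rewrite /Sk /Jn iterD.
have sK0 : 0 <= s / step K by rewrite divr_ge0// ltW.
have tK0 : 0 <= t / step K by rewrite divr_ge0// ltW.
have [b nE] := truncnD01 sK0 tK0.
have {}nE : nstep K (s + t) = (nstep K s + nstep K t + b)%N by rewrite -nE -mulrDl.
have h5 : N (Sk K (s + t) v - Sk K s (Sk K t v)) <= e / 6.
  by rewrite H /Sk nE; apply: le_trans (Jstep_add _ _ _ Bv) _.
have -> : S (s + t) u - S s (S t u) =
  - (Sk K (s + t) u - S (s + t) u) + Sk K (s + t) (u - v)
  + (Sk K (s + t) v - Sk K s (Sk K t v)) - Sk K s (Sk K t (u - v))
  + Sk K s (Sk K t u - S t u) + (Sk K s (S t u) - S s (S t u)).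
  by rewrite !SkB; module_eq R V; ring.
have -> : e = e / 6 + e / 6 + e / 6 + e / 6 + e / 6 + e / 6 by field.
do 5 (try apply: N_add2); rewrite ?NN//.
- exact: le_trans (Sk_contr _ _ _) uv.
- by apply: le_trans (Sk_contr _ _ _) _; apply: le_trans (Sk_contr _ _ _) uv.
- exact: le_trans (Sk_contr _ _ _) h2.
Qed.

Let S_near_id t u f : 0 <= t -> B u f -> N (S t u - u) <= t * N f.
Proof.
move=> t0 Bu; apply: le_limN => e e0; have [K /(_ _ (leqnn _)) hK] := S_near u t0 e0.
rewrite [t * _ + e]addrC; apply: le_trans (N_triangle (Sk K t u) _ _) _; rewrite NBC lerD//.
apply: le_trans (Jn_near _ (step_le K) Bu) _.
by rewrite ler_wpM2r// nstep_le.
Qed.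

Let S_taylor t u f g : 0 <= t -> B u f -> B f g ->
  N (S t u - u - t *: f) <= t ^+ 2 * N g.
Proof.
move=> t0 Bu Bf; apply: le_limN => e e0.
have e2 : 0 < e / 2 by rewrite divr_gt0.
have [K1 h1] := S_near u t0 e2.
have [|K2 h2] := @step_small (e / 2 / (N f + 1)).
  by rewrite divr_gt0// ltr_wpDl.
set K := maxn K1 K2.
have {}h1 := h1 K (leq_maxl _ _); have {}h2 := h2 K (leq_maxr _ _).
have -> : S t u - u - t *: f = - (Sk K t u - S t u) +
  (Sk K t u - u - ((nstep K t)%:R * step K) *: f)
  - (t - (nstep K t)%:R * step K) *: f.
  by module_eq R V; ring.
have H : N ((t - (nstep K t)%:R * step K) *: f) <= e / 2.
  rewrite NZ ger0_norm ?subr_ge0 ?nstep_le//.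
  apply: (@le_trans _ _ (step K * (N f + 1))); last by rewrite -ler_pdivlMr// ltr_wpDl.
  rewrite ler_pM ?subr_ge0 ?nstep_le ?lerDl//.
  by have := nstep_gt K t; lra.
have -> : t ^+ 2 * N g + e = e / 2 + t ^+ 2 * N g + e / 2 by field.
apply: N_add2; rewrite ?NN//; apply: N_add2; rewrite ?NN//.
apply: le_trans (Jn_taylor _ (step_le K) Bu Bf) _.
rewrite ler_wpM2r// lerXn2r ?nnegrE// ?nstep_le//.
by rewrite mulr_ge0// ltW.
Qed.

Let cvg_N (T : Type) (F : set_system T) {FF : Filter F} (x : T -> V) l :
  (forall e, 0 < e -> \forall t \near F, N (x t - l) <= e) -> x t @[t --> F] --> l.
Proof.
move=> H; apply/cvgrPdist_le => e e0.
have ce : 0 < c * e by rewrite mulr_gt0.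
near=> t; rewrite -(ler_pM2l c_gt0) (le_trans (N_ge _))// NBC.
by near: t; exact: H.
Unshelve. all: by end_near. Qed.

Let near_N (T : Type) (F : set_system T) {FF : Filter F} (x : T -> V) l :
  x t @[t --> F] --> l -> forall e, 0 < e -> \forall t \near F, N (x t - l) <= e.
Proof.
move=> /cvgrPdist_le H e e0.
have e1 : 0 < e / (C + 1) by rewrite divr_gt0// ltr_wpDl.
near=> t; rewrite NBC; apply: le_trans (N_le _) _.
rewrite -[e](@divfK _ (C + 1)) ?gt_eqF ?ltr_wpDl// [leRHS]mulrC.
rewrite ler_pM ?lerDl//.
by near: t; exact: H.
Unshelve. all: by end_near. Qed.

(** [S_taylor] requires the domain of $B^2$, so [u] is replaced by $v=J_ku$, with $Bv=J_kf$ close to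
    $f$. The rest $u-v$ is handled by [S_near_id], whose bound is linear in time and proportional to
    the small $N(f-J_kf)$. *)
Let S_generates u f : B u f -> h^-1 *: (S h u - u) @[h --> 0^'+] --> f.
Proof.
move=> Bu; apply: cvg_N => e e0.
have e4 : 0 < e / 4 by rewrite divr_gt0.
have hh0 : 0 < h0 <= h0 by rewrite h0_gt0/=.
set q := u - f.
have [K1 hK1] : exists K, forall k, (K <= k)%N -> N (J (step k) f - f) <= e / 4.
  have [v [g [Bv fv]]] := B_dense f (e := e / 12) ltac:(by rewrite divr_gt0).
  have [|K hK] := @step_small (e / 12 / (N g + 1)).
    by rewrite !divr_gt0// ltr_wpDl.
  exists K => k Kk.
  have -> : J (step k) f - f = J (step k) (f - v) + (J (step k) v - v) - (f - v).
    by rewrite JB ?step_le//; module_eq R V; ring.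
  have -> : e / 4 = e / 12 + e / 12 + e / 12 by field.
  apply: N_add2; rewrite ?NN//; apply: N_add2.
    exact: le_trans (J_contr _ (step_le k)) fv.
  apply: le_trans (J_near (step_le k) Bv) _.
  rewrite (@le_trans _ _ (step k * (N g + 1)))//; first by rewrite ler_pM2l// lerDl.
  by rewrite -ler_pdivlMr ?hK// ltr_wpDl.
have {hK1} := hK1 K1 (leqnn _); set k := step K1 => hk.
have kk : 0 < k <= h0 by exact: step_le.
have Bv := BJ kk Bu; have Bf := JP f kk; rewrite -/k in Bv Bf.
set v := J k u in Bv; set fv := J k f in Bv Bf hk; set g := k^-1 *: _ in Bf.
near=> h.
have h0' : 0 < h by near: h; exact: nbhs_right_gt.
have -> : h^-1 *: (S h u - u) - f =
   h^-1 *: (S h (u - v) - (u - v)) + h^-1 *: (S h v - v - h *: fv) + (fv - f).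
  by rewrite SB ?ltW//; module_eq R V; field; rewrite gt_eqF.
have -> : e = e / 4 + e / 2 + e / 4 by field.
apply: N_add2 => //; apply: N_add2; rewrite NZ gtr0_norm ?invr_gt0// ler_pdivrMl//.
  apply: le_trans (S_near_id (ltW h0') (BB Bu Bv)) _.
  by rewrite ler_pM2l// NBC.
apply: le_trans (S_taylor (ltW h0') Bv Bf) _.
rewrite expr2 -mulrA ler_pM2l//.
apply: (@le_trans _ _ (h * (N g + 1))); first by rewrite ler_pM2l// lerDl.
rewrite -ler_pdivlMr ?ltr_wpDl//.
by near: h; apply: nbhs_right_le; rewrite !divr_gt0// ltr_wpDl.
Unshelve. all: by end_near. Qed.

(** For the converse, [w], the difference of [u] and $J_{h_0}(u-h_0f)$, has right derivative
    $h_0^{-1}w$ at time 0. Such growth contradicts [S_contr] unless [w] is 0. *)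
Let S_generator : is_generator S B.
Proof.
move=> u f; split => [|Su]; first exact: S_generates.
have hh0 : 0 < h0 <= h0 by rewrite h0_gt0/=.
have Bv := JP (u - h0 *: f) hh0.
set v := J h0 _ in Bv; set fv := h0^-1 *: _ in Bv.
have Sv := S_generates Bv.
have h0_neq0 : h0 != 0 by rewrite gt_eqF.
have fE : f - fv = h0^-1 *: (u - v) by rewrite /fv; module_eq R V; field.
suff w0 : u - v = 0.
  have <- : v = u by apply/eqP; rewrite eq_sym -subr_eq0 w0.
  suff -> : f = fv by [].
  by apply/eqP; rewrite -subr_eq0 fE w0 scaler0.
set w := u - v in fE *.
have Sw : h^-1 *: (S h w - w) @[h --> 0^'+] --> h0^-1 *: w.
  rewrite -fE; apply: cvg_trans (cvgB Su Sv); apply: near_eq_cvg.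
  have : \forall h \near (0 : R)^'+, 0 < h by exact: nbhs_right_gt.
  apply: filterS => h h_gt0.
  by rewrite /w SB ?ltW// ?fctE; module_eq R V; ring.
apply/N_le0; rewrite leNgt; apply/negP => Nw.
have e0 : 0 < N w / h0 / 2 by rewrite !divr_gt0.
have [h [h1 h2]] : exists h, 0 < h /\ N (h^-1 *: (S h w - w) - h0^-1 *: w) <= N w / h0 / 2.
  have : \forall h \near 0^'+, 0 < h /\ N (h^-1 *: (S h w - w) - h0^-1 *: w) <= N w / h0 / 2.
    near=> h; split; first by near: h; exact: nbhs_right_gt.
    by near: h; apply: near_N Sw _ e0.
  by move=> /filter_ex.
have : N ((1 + h / h0) *: w) <= N (S h w) + h * (N w / h0 / 2).
  have -> : (1 + h / h0) *: w = S h w - h *: (h^-1 *: (S h w - w) - h0^-1 *: w).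
    by module_eq R V; field; rewrite ?gt_eqF.
  by apply: N_add2 => //; rewrite NN NZ gtr0_norm// ler_pM2l.
have := S_contr w (ltW h1).
rewrite NZ ger0_norm; last by rewrite addr_ge0// divr_ge0// ltW.
rewrite mulrDl mul1r => H1 H2.
have : 0 < h * (N w / h0) by rewrite mulr_gt0// divr_gt0.
have E : h / h0 * N w = h * (N w / h0) by ring.
rewrite E in H2; have E2 : h * (N w / h0 / 2) = h * (N w / h0) / 2 by ring.
rewrite E2 in H2; lra.
Unshelve. all: by end_near. Qed.

Let S_right u : S t u @[t --> 0^'+] --> u.
Proof.
apply: cvg_N => e e0; have e3 : 0 < e / 3 by rewrite divr_gt0.
have [v [f [Bv uv]]] := B_dense u e3.
near=> t; have t0 : 0 < t by near: t; exact: nbhs_right_gt.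
have -> : S t u - u = S t (u - v) + (S t v - v) - (u - v).
  by rewrite SB ?ltW//; module_eq R V; ring.
have -> : e = e / 3 + e / 3 + e / 3 by field.
apply: N_add2; rewrite ?NN//; apply: N_add2.
  exact: le_trans (S_contr _ (ltW t0)) uv.
apply: le_trans (S_near_id (ltW t0) Bv) _.
apply: (@le_trans _ _ (t * (N f + 1))); first by rewrite ler_pM2l// lerDl.
rewrite -ler_pdivlMr ?ltr_wpDl//.
by near: t; apply: nbhs_right_le; rewrite !divr_gt0// ltr_wpDl.
Unshelve. all: by end_near. Qed.

Let S_continuous t : 0 <= t -> continuous (S t).
Proof.
move=> t0 u; apply: cvg_N => e e0.
near=> v; rewrite -SB//; apply: le_trans (S_contr _ t0) _.
by near: v; apply: near_N e0; exact: cvg_id.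
Unshelve. all: by end_near. Qed.

Lemma contraction_generation (P : set V) : closed P ->
  (forall h u f, 0 < h <= h0 -> B u f -> P (u - h *: f) -> P u) ->
  exists T, [/\ C0_semigroup T, is_generator T B &
    forall t, 0 <= t -> forall u, P u -> P (T t u)].
Proof.
move=> clP JP'; exists S; split => //; first by split => //; move=> t t0 a u v; exact: S_lin.
move=> t t0 u Pu.
have Sc : Sk n t u @[n --> \oo] --> S t u by exact/cvg_ex/Sk_cvg.
apply: (closed_cvg P clP _ _ Sc).
apply: nearW => k; rewrite /Sk; elim: (nstep k t) => //= n IH.
apply: (JP' _ _ _ (step_le k) (JP _ (step_le k))).
by rewrite scalerA mulfV ?scale1r ?subKr// gt_eqF.
Qed.

End HilleYosida.

Lemma is_derive_expRZ (R : realType) (a x : R) :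
  is_derive x 1 (fun y => expR (a * y)) (a * expR (a * x)).
Proof.
have D : is_derive x 1 (expR \o (a \*: (id : R -> R^o))) (expR ((a \*: (id : R -> R^o)) x) * (a *: 1)).
  exact: is_derive1_comp.
by apply: is_derive_eq D _; rewrite /GRing.scale/= mulr1 mulrC.
Qed.

Lemma continuous_expRZ (R : realType) (a : R) : continuous (fun y => expR (a * y)).
Proof.
move=> x; apply/differentiable_continuous/derivable1_diffP.
by have [] := is_derive_expRZ a x.
Qed.

Lemma cvg_expR_slope (R : realType) (a : R) : h^-1 * (expR (a * h) - 1) @[h --> 0^'+] --> a.
Proof.
have [/cvg_ex[l dl] dE] := is_derive_expRZ a 0.
rewrite mulr0 expR0 mulr1 in dE.
have la : l = a by rewrite -dE; apply/esym/cvg_lim.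
rewrite la in dl.
have := cvg_dnbhs_at_right dl; apply: cvg_trans; apply: near_eq_cvg; apply: nearW => h /=.
by rewrite addr0 mulr0 expR0 /GRing.scale/= mulr1.
Qed.

Section QuasiContraction.
Context (R : realType) (V : normedModType R).
Lemma cvg_expR_twist (a : R) (S : R -> V) (u f : V) :
  h^-1 *: (S h - u) @[h --> 0^'+] --> f ->
  h^-1 *: (expR (a * h) *: S h - u) @[h --> 0^'+] --> f + a *: u.
Proof.
move=> Sf.
have ca : expR (a * h) @[h --> 0^'+] --> (1 : R).
  by apply: cvg_at_right_filter; have := continuous_expRZ (a := a) (x := 0); rewrite /continuous_at mulr0 expR0.
have -> : (fun h => h^-1 *: (expR (a * h) *: S h - u)) =
    (fun h => expR (a * h) *: (h^-1 *: (S h - u)) + (h^-1 * (expR (a * h) - 1)) *: u).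
  by apply/funext => h; module_eq R V; ring.
rewrite -[X in _ --> X + _]scale1r; apply: cvgD; apply: cvgZ => //.
  exact: cvg_expR_slope.
exact: cvg_cst.
Qed.

(* Applied to exp (- w t) T(t). *)
Lemma quasi_contraction_generation (N : V -> R) (c C : R) (A : V -> V -> Prop)
    (w h0 : R) (P : set V) :
  0 < c -> 0 <= C ->
  (forall u v, N (u + v) <= N u + N v) ->
  (forall a u, N (a *: u) = `|a| * N u) ->
  (forall u, c * `|u| <= N u) ->
  (forall u, N u <= C * `|u|) ->
  (forall a u f v g, A u f -> A v g -> A (a *: u + v) (a *: f + g)) ->
  0 <= w -> 0 < h0 ->
  (forall h u f, 0 < h <= h0 -> A u f -> (1 - h * w) * N u <= N (u - h *: f)) ->
  (forall h g, 0 < h <= h0 -> exists u, A u (h^-1 *: (u - g))) ->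
  (forall u e, 0 < e -> exists v f, A v f /\ N (u - v) <= e) ->
  (forall x : nat -> V,
    (forall e : R, 0 < e -> exists K, forall j k, (K <= j)%N -> (K <= k)%N ->
       `|x j - x k| <= e) ->
    exists l : V, x n @[n --> \oo] --> l) ->
  closed P -> (forall a u, 0 <= a -> P u -> P (a *: u)) ->
  (forall h u f, 0 < h <= h0 -> A u f -> P (u - h *: f) -> P u) ->
  exists T, [/\ C0_semigroup T, is_generator T A &
    forall t, 0 <= t -> forall u, P u -> P (T t u)].
Proof.
move=> c0 C0 ND NZ Ngt Nlt Alin w0 h00 Adiss Arange Adense Vc clP PZ AP.
(* $B=A-w$ is dissipative because $1-hB=(1+hw)(1-rA)$ with $r=h/(1+hw)$, and $(1+hw)(1-rw)=1$. *)
pose B u f := A u (f + w *: u).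
pose r h := h / (1 + h * w).
have hw (h : R) : 0 < h <= h0 -> 0 < 1 + h * w.
  by case/andP => h1 _; rewrite ltr_pwDl// mulr_ge0// ltW.
have rh (h : R) : 0 < h <= h0 -> 0 < r h <= h0.
  move=> hh; have := hw _ hh; case/andP: hh => h1 h2 h3.
  rewrite divr_gt0//= ler_pdivrMr//; apply: le_trans h2 _.
  by rewrite ler_peMr ?(ltW h00)// lerDl mulr_ge0// ltW.
have rE (h : R) (u f : V) : 0 < h <= h0 -> u - h *: f = (1 + h * w) *: (u - r h *: (f + w *: u)).
  by move=> hh; rewrite /r; module_eq R V; field; rewrite gt_eqF ?hw.
have Blin a u f v g : B u f -> B v g -> B (a *: u + v) (a *: f + g).
  move=> Bu Bv; rewrite /B.
  have -> : a *: f + g + w *: (a *: u + v) = a *: (f + w *: u) + (g + w *: v).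
    by module_eq R V; ring.
  exact: Alin.
have Bdiss (h : R) u f : 0 < h <= h0 -> B u f -> N u <= N (u - h *: f).
  move=> hh Bu; rewrite (rE _ _ _ hh) NZ gtr0_norm ?hw//.
  rewrite mulrC -ler_pdivrMr ?hw//; apply: le_trans (Adiss _ _ _ (rh _ hh) Bu).
  rewrite mulrC le_eqVlt; apply/orP; left; apply/eqP; congr (_ * _).
  by rewrite /r; field; rewrite gt_eqF ?hw.
have Brange (h : R) g : 0 < h <= h0 -> exists u, B u (h^-1 *: (u - g)).
  move=> hh; have [u Au] := Arange _ ((1 + h * w)^-1 *: g) (rh _ hh).
  exists u; rewrite /B (_ : _ + _ = (r h)^-1 *: (u - (1 + h * w)^-1 *: g))//.
  by rewrite /r; module_eq R V; field; rewrite ?gt_eqF ?hw//; case/andP: hh.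
have Bdense u (e : R) : 0 < e -> exists v f, B v f /\ N (u - v) <= e.
  move=> e0; have [v [f [Av uv]]] := Adense u e e0.
  by exists v, (f - w *: v); rewrite /B subrK.
have BP (h : R) u f : 0 < h <= h0 -> B u f -> P (u - h *: f) -> P u.
  move=> hh Bu; rewrite (rE _ _ _ hh) => Pu.
  apply: (AP _ _ _ (rh _ hh) Bu).
  rewrite -[_ - _](@scalerK _ _ (1 + h * w)) ?unitfE ?gt_eqF ?hw//.
  by apply: PZ => //; rewrite invr_ge0 ltW// hw.
have [S [SC Sgen SP]] :=
  contraction_generation c0 C0 ND NZ Ngt Nlt Blin h00 Bdiss Brange Bdense Vc clP BP.
have [Slin Scont S0 Sadd Sright] := SC.
have SZ s a u : 0 <= s -> S s (a *: u) = a *: S s u.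
  move=> s0; have Ss0 : S s 0 = 0.
    have := Slin s s0 1 0 0; rewrite !scale1r addr0 => /eqP.
    by rewrite -subr_eq0 opprD addrA subrr sub0r oppr_eq0 => /eqP.
  by rewrite -[a *: u]addr0 Slin// Ss0 addr0.
exists (fun t u => expR (w * t) *: S t u); split.
- split.
  + move=> t t0 a u v; rewrite Slin//; module_eq R V; ring.
  + by move=> t t0 u; apply: cvgZ; [exact: cvg_cst|exact: Scont].
  + by move=> u; rewrite mulr0 expR0 scale1r S0.
  + by move=> s t u s0 t0; rewrite mulrDr expRD Sadd// -scalerA SZ.
  + move=> u; rewrite -[X in _ --> X]scale1r; apply: cvgZ; last exact: Sright.
    by apply: cvg_at_right_filter; have := continuous_expRZ (a := w) (x := 0); rewrite /continuous_at mulr0 expR0.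
- move=> u F; split => [Au|TF].
  + have : B u (F - w *: u) by rewrite /B subrK.
    by move/Sgen => H; have := @cvg_expR_twist w (S^~ u) _ _ H; rewrite subrK.
  + have := @cvg_expR_twist (- w) (fun h => expR (w * h) *: S h u) _ _ TF => H.
    have : B u (F - w *: u); last by rewrite /B subrK.
    apply/Sgen; rewrite -scaleNr.
    rewrite (_ : (fun h => _) = (fun h => h^-1 *: (expR (- w * h) *: (expR (w * h) *: S h u) - u)))//.
    by apply/funext => h; rewrite scalerA -expRD mulNr addNr expR0 scale1r.
- by move=> t t0 u Pu; apply: PZ; [exact: expR_ge0|exact: SP].
Qed.
End QuasiContraction.

(** * Integrable and absolutely continuous functions on [0, 1] *)

Section L1.
Context (R : realType).
Notation mu := (@lebesgue_measure R).
Notation muI := (muI R).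
Implicit Types (f g c d : R -> R).

Let mI : measurable (`[0, 1] : set (measurableTypeR R)).
Proof. exact: measurable_itv. Qed.

#[local] Instance ae_muI_filter : Filter (nbhs (almost_everywhere muI)).
Proof. exact: (ae_filter_ringOfSetsType muI). Qed.

#[local] Instance ae_mu_filter : Filter (nbhs (almost_everywhere mu)).
Proof. exact: (ae_filter_ringOfSetsType mu). Qed.

Lemma ae_muI (P : R -> Prop) :
  {ae muI, forall x, P x} <-> {ae mu, forall x, x \in `[0, 1] -> P x}.
Proof.
split => -[N [mN N0 PN]].
  exists (N `&` `[0, 1]); split => //; first exact: measurableI.
  move=> x /= /not_implyP[x01 nP]; split => //; exact: PN.
exists (N `|` ~` `[0, 1]); split => //.
- by apply: measurableU => //; exact: measurableC.
- rewrite /muI/= /mrestr setIUl setICl setU0.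
  apply/eqP; rewrite eq_le measure_ge0 andbT -N0.
  by apply: le_measure => //; rewrite inE//; exact: measurableI.
- move=> x /= nP; have [x01|] := boolP (x \in `[0, 1]); last first.
    by move=> /negP ?; right.
  by left; apply: PN => /= /(_ x01).
Qed.

Lemma integral_muI (f : R -> \bar R) : measurable_fun [set: measurableTypeR R] f ->
  (\int[muI]_x f x = \int[mu]_(x in `[0%R, 1%R]) f x)%E.
Proof.
move=> mf; rewrite (@ae_eq_integral _ _ _ muI _ (f \_ (`[0%R, 1%R]%classic : set (measurableTypeR R))))//.
- rewrite -integral_mkcond; apply: eq_measure_integral => A mA AI.
  by rewrite /muI/= /mrestr setIidl.
- by apply/(measurable_restrictT _ _).1 => //; exact: measurable_funS mf.
- have : {ae muI, forall x, x \in `[0, 1]}.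
    by apply/ae_muI; exact: (@aeW _ _ _ mu).
  by apply: filterS => x x01 _; rewrite patchE mem_set.
Qed.

Definition L1 f := mu.-integrable `[0, 1] (EFin \o f).
Definition I f := \int[mu]_(x in `[0, 1]) f x.

Lemma L1_measurable f : L1 f -> measurable_fun (`[0, 1] : set (measurableTypeR R)) f.
Proof. by move/measurable_int => /measurable_EFinP. Qed.

Lemma L1D f g : L1 f -> L1 g -> L1 (fun x => f x + g x).
Proof. exact: integrableD. Qed.

Lemma L1B f g : L1 f -> L1 g -> L1 (fun x => f x - g x).
Proof. by move=> L1f L1g; have := @integrableB _ _ _ mu _ mI _ _ L1f L1g. Qed.

Lemma L1Z a f : L1 f -> L1 (fun x => a * f x).
Proof. by move=> L1f; have := @integrableZl _ _ _ mu _ mI a _ L1f. Qed.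

Lemma L1N f : L1 f -> L1 (fun x => - f x).
Proof. by move=> /(@L1Z (-1)); rewrite /L1 (_ : (fun _ => _) = (fun x => - f x))//; apply/funext => x; rewrite mulN1r. Qed.

Lemma L1_abs f : L1 f -> L1 (fun x => `|f x|).
Proof. by move=> ?; apply: (@integrable_norm _ _ _ mu). Qed.

Lemma L1_cont f : {within `[0, 1], continuous f} -> L1 f.
Proof. by move=> ?; apply: continuous_compact_integrable => //; exact: segment_compact. Qed.

Lemma L1_cst a : L1 (fun=> a).
Proof. by apply: L1_cont; apply: continuous_subspaceT => x; exact: cvg_cst. Qed.

Lemma within_bounded f : {within `[0, 1], continuous f} ->
  exists2 M, 0 < M & forall x, x \in `[0, 1] -> `|f x| <= M.
Proof.
move=> cf; have cI : compact (`[0, 1] : set R) by exact: segment_compact.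
have /compact_bounded[M [_ HM]] := continuous_compact cf cI.
exists (`|M| + 1); first by rewrite ltr_wpDl.
move=> x x01; apply: HM; last by exists x.
by rewrite ltr_pwDr// ler_norm.
Qed.

Lemma L1M f g : {within `[0, 1], continuous f} -> L1 g -> L1 (fun x => f x * g x).
Proof.
move=> cf L1g; have [M M0 HM] := within_bounded cf.
have bf : [bounded f x | x in (`[0, 1] : set (measurableTypeR R))].
  exists M; split; first exact: gtr0_real.
  by move=> y My x x01; apply: le_trans (HM _ x01) (ltW _).
by have := @integrableMr _ _ _ mu _ mI f (EFin \o g) (L1_measurable (L1_cont cf)) bf L1g.
Qed.

Lemma ID f g : L1 f -> L1 g -> I (fun x => f x + g x) = I f + I g.
Proof. exact: RintegralD. Qed.

Lemma IB f g : L1 f -> L1 g -> I (fun x => f x - g x) = I f - I g.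
Proof. exact: RintegralB. Qed.

Lemma IZ a f : L1 f -> I (fun x => a * f x) = a * I f.
Proof. exact: RintegralZl. Qed.

Lemma eq_I f g : {in `[0, 1], f =1 g} -> I f = I g.
Proof. by move=> fg; apply: eq_Rintegral => x; rewrite inE/= => x01; exact: fg. Qed.

Lemma le_I f g : L1 f -> L1 g -> {in `[0, 1], forall x, f x <= g x} -> I f <= I g.
Proof. by move=> L1f L1g fg; apply: le_Rintegral => // x x01; exact: fg. Qed.

Lemma I_ge0 f : {in `[0, 1], forall x, 0 <= f x} -> 0 <= I f.
Proof. by move=> f0; apply: Rintegral_ge0 => x x01; exact: f0. Qed.

Lemma norm_I f : L1 f -> `|I f| <= I (fun x => `|f x|).
Proof. by move=> L1f; apply: le_normr_Rintegral. Qed.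

Lemma I_cst a : I (fun=> a) = a.
Proof. by rewrite /I Rintegral_cst//= lebesgue_measure_itv/= lte_fin ltr01 oppr0 adde0 mulr1. Qed.

Lemma ae_eq_I f g : L1 f -> L1 g -> {ae mu, forall x, x \in `[0, 1] -> f x = g x} -> I f = I g.
Proof.
move=> L1f L1g fg; congr fine; apply: ae_eq_integral => //.
- by apply/measurable_EFinP; apply: L1_measurable.
- by apply/measurable_EFinP; apply: L1_measurable.
- by apply: filterS fg => x fg x01; rewrite fg.
Qed.

Lemma I_eq0_ae f : L1 f -> I (fun x => `|f x|) = 0 ->
  {ae mu, forall x, x \in `[0, 1] -> f x = 0}.
Proof.
move=> L1f If0.
have : (\int[mu]_(x in `[0%R, 1%R]) `|(EFin \o f) x| = 0)%E.
  rewrite -[LHS]fineK; first by congr EFin.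
  by have /integrable_abse/integrable_fin_num := L1f; apply.
move/ae_eq_integral_abs => /(_ mI (measurable_int mu L1f)).
by apply: filterS => x H x01; have /= [] := H x01.
Qed.

Lemma le_I_ae f g : L1 f -> L1 g ->
  {ae mu, forall x, x \in `[0, 1] -> f x <= g x} -> I f <= I g.
Proof.
move=> L1f L1g fg; rewrite -subr_ge0 -IB//.
have L := L1B L1g L1f.
rewrite (@ae_eq_I _ (fun x => `|g x - f x|))//.
- by apply: I_ge0.
- exact: L1_abs.
- by apply: filterS fg => x fg x01; rewrite ger0_norm// subr_ge0 fg.
Qed.

Local Notation Lsp := (LspaceType1 muI).

Lemma Lspace1_L1 (u : Lsp) : L1 u.
Proof.
have /integrableP[mu1 iu] := Lspace1_integrable u.
apply/integrableP; split; first exact: measurable_funS mu1.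
by rewrite -integral_muI//; apply: measurableT_comp.
Qed.

Lemma Rintegral_muI f : measurable_fun [set: measurableTypeR R] f ->
  \int[muI]_x f x = I f.
Proof. by move=> mf; congr fine; rewrite integral_muI//; exact/measurable_EFinP. Qed.

Lemma Lspace1_normI (u : Lsp) : `|u| = I (fun x => `|u x|).
Proof.
rewrite Lspace1_normE Rintegral_muI//.
by apply: measurableT_comp => //; exact: Lspace1_measurable.
Qed.

Lemma L1_Lfun f : L1 f -> f \_ `[0, 1] \in Lfun muI 1.
Proof.
move=> L1f; have mf : measurable_fun [set: measurableTypeR R] (f \_ `[0, 1]).
  by apply/(measurable_restrictT _ _).1 => //; exact: L1_measurable.
apply/andP; split; apply: mem_set => //.
rewrite /= /finite_norm Lnorm1 integral_muI; last first.
  by apply/measurable_EFinP; exact: measurableT_comp.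
have /integrableP[_] := L1f; congr (_ < _)%E; apply: eq_integral => x xI.
by rewrite /= patchE xI.
Qed.

(* Junk value 0 when f is not integrable. *)
Definition cls f : Lsp := match pselect (L1 f) with
  | left L1f => Lspace1_of (Lfun_Sub _ (L1_Lfun L1f))
  | right _ => 0 end.

Lemma clsE f : L1 f -> {ae mu, forall x, x \in `[0, 1] -> cls f x = f x}.
Proof.
rewrite /cls; case: pselect => // L1f _.
have /= E := Lspace1_ofE (Lfun_Sub _ (L1_Lfun L1f)).
have {}E : {ae muI, forall x, Lspace1_of (Lfun_Sub _ (L1_Lfun L1f)) x = (f \_ `[0, 1]) x}.
  by apply: filterS E => x; apply.
move/ae_muI : E; apply: filterS => x H x01; rewrite H// patchE mem_set//.
Qed.

Lemma Lspace1D_ae (u v : Lsp) :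
  {ae mu, forall x, x \in `[0, 1] -> (u + v) x = u x + v x}.
Proof. by have H := Lspace1D u v; apply/ae_muI; apply: filterS H => x; apply. Qed.

Lemma Lspace1Z_ae a (u : Lsp) :
  {ae mu, forall x, x \in `[0, 1] -> (a *: u) x = a * u x}.
Proof. by have H := Lspace1Z a u; apply/ae_muI; apply: filterS H => x; apply. Qed.

Lemma Lspace1_0_ae : {ae mu, forall x, x \in `[0, 1] -> (0 : Lsp) x = 0}.
Proof. by have H := @Lspace1_0 _ _ _ muI; apply/ae_muI; apply: filterS H => x; apply. Qed.

Lemma Lspace1B_ae (u v : Lsp) :
  {ae mu, forall x, x \in `[0, 1] -> (u - v) x = u x - v x}.
Proof.
have h1 := Lspace1D_ae u (-1 *: v); have h2 := Lspace1Z_ae (-1) v.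
by apply: filterS2 h1 h2 => x h1 h2 x01; rewrite -scaleN1r h1// h2// mulN1r.
Qed.

End L1.

(** * Completeness of $L_1(I)$ *)

Section Completeness.
Context (R : realType).
Notation mu := (@lebesgue_measure R).
Notation muI := (muI R).
Local Notation Lsp := (LspaceType1 muI).
#[local] Existing Instance ae_mu_filter.

Let mI : measurable (`[0, 1] : set (measurableTypeR R)).
Proof. exact: measurable_itv. Qed.

Let norm_int (u : Lsp) : (\int[mu]_(x in `[0%R, 1%R]) `|u x|%:E)%E = `|u|%:E.
Proof.
rewrite Lspace1_normI /I /Rintegral fineK//.
by have /integrable_fin_num := L1_abs (Lspace1_L1 u); apply.
Qed.

Let normB_int (u v : Lsp) :
  (\int[mu]_(x in `[0%R, 1%R]) `|u x - v x|%:E)%E = `|u - v|%:E.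
Proof.
rewrite -norm_int; apply: ae_eq_integral => //.
- by apply/measurable_EFinP; apply: L1_measurable; apply/L1_abs/L1B; exact: Lspace1_L1.
- by apply/measurable_EFinP; apply: L1_measurable; apply/L1_abs; exact: Lspace1_L1.
- by have := Lspace1B_ae u v; apply: filterS => x H x01; rewrite H.
Qed.

(** Riesz-Fischer: $\sum_k|x_{k+1}-x_k|$ is integrable, hence finite almost everywhere, so $x_n$
    converges almost everywhere under the integrable bound [G]. *)
Let fast_cvg (x : nat -> Lsp) : (forall k, `|x k.+1 - x k| <= (2 ^+ k)^-1) ->
  exists l : Lsp, x n @[n --> \oo] --> l.
Proof.
move=> xS.
pose d k (t : R) := `|x k.+1 t - x k t|%:E.
have md k : measurable_fun (`[0%R, 1%R]%classic : set (measurableTypeR R)) (d k).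
  by apply/measurable_EFinP; apply: L1_measurable; apply/L1_abs/L1B; exact: Lspace1_L1.
have d0 k t : (0 <= d k t)%E by rewrite lee_fin.
pose G t := (`|x 0 t|%:E + \sum_(0 <= k <oo) d k t)%E.
have mS : measurable_fun (`[0%R, 1%R]%classic : set (measurableTypeR R)) (fun t => \sum_(0 <= k <oo) d k t)%E.
  have := @ge0_emeasurable_sum _ _ _ (`[0%R, 1%R]%classic : set (measurableTypeR R)) d predT.
  by apply => // k _; exact: md.
have iS : mu.-integrable (`[0%R, 1%R]%classic : set (measurableTypeR R)) (fun t => \sum_(0 <= k <oo) d k t)%E.
  apply/integrableP; split => //.
  under eq_integral do rewrite gee0_abs ?nneseries_ge0//.
  rewrite integral_nneseries//.
  apply: (@le_lt_trans _ _ 2%:E); last exact: ltry.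
  apply: lime_le.
    by apply: is_cvg_nneseries => n _ _; apply: integral_ge0 => t _.
  apply: nearW => n.
  (* The exact partial sum of the geometric bounds, so that the induction closes. *)
  apply: (@le_trans _ _ (2 - 2 / 2 ^+ n)%:E); last first.
    by rewrite lee_fin lerBlDr lerDl divr_ge0.
  elim: n => [|n IH]; first by rewrite big_geq// expr0 divr1 subrr.
  rewrite big_nat_recr//= normB_int.
  apply: le_trans (leeD IH (_ : _ <= (2^+n)^-1%:E)%E) _; first by rewrite lee_fin.
  rewrite -EFinD lee_fin exprSr invfM; lra.
have iG : mu.-integrable (`[0%R, 1%R]%classic : set (measurableTypeR R)) G.
  apply: integrableD => //.
  exact: (L1_abs (Lspace1_L1 (x 0))).
(* An upper limit exists at every point and is measurable; it is the limit wherever there is one. *)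
pose F t := limn_esup (fun k => (x k t)%:E).
have mF : measurable_fun (`[0%R, 1%R]%classic : set (measurableTypeR R)) F.
  apply: measurable_fun_limn_esup => n.
  by apply/measurable_EFinP; apply: L1_measurable; exact: Lspace1_L1.
have xF : {ae mu, forall t, (`[0%R, 1%R]%classic : set (measurableTypeR R)) t ->
   ((x n t)%:E @[n --> \oo] --> F t)%E}.
  have := integrable_ae mI iS; apply: filterS => t H t01.
  have {}H := H t01; set s := (\sum_(0 <= k <oo) d k t)%E in H.
  suff /cvg_ex[l xl] : cvgn (fun n => x n t).
    have El : ((x n t)%:E @[n --> \oo] --> l%:E)%E by apply: cvg_EFin => //; exact: nearW.
    by rewrite /F (cvg_limn_einf_sup El).2.
  have E : (fun n => x n t) = (fun n => x 0 t + series (telescope (fun n => x n t)) n).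
    by apply/funext => n; exact: eq_sum_telescope.
  rewrite E; apply: is_cvgD; first exact: is_cvg_cst.
  apply: normed_cvg; apply: nondecreasing_is_cvgn.
    by apply/nondecreasing_seqP => n; rewrite /= -!/(series _ _) seriesSr lerDl.
  exists (fine s) => _ [n _ <-]; rewrite -lee_fin fineK// /series/=.
  rewrite -sumEFin.
  exact: (@nneseries_lim_ge _ (fun k => d k t) predT 0 n).
have xG : {ae mu, forall t, forall n, (`[0%R, 1%R]%classic : set (measurableTypeR R)) t ->
   (`|(x n t)%:E| <= G t)%E}.
  apply: aeW => t n t01; rewrite /G.
  apply: le_trans (leeD (lexx _) (@nneseries_lim_ge _ (fun k => d k t) predT 0 n _)) => //.
  rewrite sumEFin -EFinD lee_fin.
  rewrite (eq_sum_telescope (fun n => x n t) n).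
  by apply: le_trans (ler_normD _ _) _; rewrite lerD// ler_norm_sum.
have mx n : measurable_fun (`[0%R, 1%R]%classic : set (measurableTypeR R)) (fun t => (x n t)%:E).
  by apply/measurable_EFinP; apply: L1_measurable; exact: Lspace1_L1.
have [iF F0 _] := dominated_convergence mI mx mF xF iG xG.
pose f t := fine (F t).
have fF : {ae mu, forall t, (`[0%R, 1%R]%classic : set (measurableTypeR R)) t -> (f t)%:E = F t}.
  by have := integrable_ae mI iF; apply: filterS => t H t01; rewrite /f fineK// H.
have L1f : L1 f.
  have mf : measurable_fun (`[0%R, 1%R]%classic : set (measurableTypeR R)) (EFin \o f).
    by apply/measurable_EFinP; apply: measurableT_comp => //; exact: measurable_fine.
  apply/integrableP; split => //.
  have /integrableP[_] := iF; congr (_ < _)%E; apply: ae_eq_integral => //.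
  - exact: measurableT_comp.
  - exact: measurableT_comp.
  - by apply: filterS fF => t H t01; rewrite /= -H.
have E n : fine (\int[mu]_(t in `[0%R, 1%R]) `|(x n t)%:E - F t|)%E = `|x n - cls f|.
  have -> : `|x n - cls f| = fine (\int[mu]_(t in `[0%R, 1%R]) `|x n t - cls f t|%:E)%E.
    by rewrite normB_int.
  congr fine; apply: ae_eq_integral => //.
  - by apply: measurableT_comp => //; exact: emeasurable_funB.
  - by apply/measurable_EFinP; apply: L1_measurable; apply/L1_abs/L1B; exact: Lspace1_L1.
  - have H1 := fF; have H2 := clsE L1f; apply: filterS2 H1 H2 => t H1 H2 t01.
    by rewrite -H1// H2.
exists (cls f); apply/cvgrPdist_le => e e0.
have /cvgrPdist_le /(_ e e0) := fine_cvg (FF := eventually_filter) F0.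
by apply: filterS => n; rewrite sub0r normrN/= E normr_id distrC.
Qed.

Lemma Lspace1_complete (x : nat -> Lsp) :
  (forall e : R, 0 < e -> exists K, forall j k, (K <= j)%N -> (K <= k)%N ->
     `|x j - x k| <= e) ->
  exists l : Lsp, x n @[n --> \oo] --> l.
Proof.
move=> xC.
have /choice[K HK] : forall k, exists K, forall i j, (K <= i)%N -> (K <= j)%N ->
   `|x i - x j| <= (2 ^+ k)^-1.
  by move=> k; apply: xC; rewrite invr_gt0 exprn_gt0.
(* The successor keeps the subsequence strictly increasing; [K k] keeps consecutive differences
   below $2^{-k}$. *)
pose p := fix p k := if k is k'.+1 then maxn (p k').+1 (K k) else K 0%N.
have pK k : (K k <= p k)%N by case: k => //= k; exact: leq_maxr.
have pS k : (p k < p k.+1)%N by exact: leq_maxl.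
have p_ge k : (k <= p k)%N by elim: k => // k IH; exact: leq_ltn_trans (pS k).
have [l xl] : exists l : Lsp, x (p n) @[n --> \oo] --> l.
  apply: fast_cvg => k; apply: HK; last exact: pK.
  exact: leq_trans (pK k) (ltnW (pS k)).
exists l; apply/cvgrPdist_le => e e0.
have e2 : 0 < e / 2 by rewrite divr_gt0.
have [M HM] := xC _ e2.
move/cvgrPdist_le : xl => /(_ _ e2)[M' _ HM'].
exists M => // n /= Mn; set k := maxn M M'.
have -> : l - x n = (l - x (p k)) + (x (p k) - x n) by rewrite addrA subrK.
apply: le_trans (ler_normD _ _) _; rewrite [e]splitr lerD//.
  by apply: HM'; exact: leq_maxr.
by apply: HM => //; apply: leq_trans (p_ge k); exact: leq_maxl.
Qed.
End Completeness.

(** * Absolutely continuous functions and integration by parts *)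

Section AbsolutelyContinuous.
Context (R : realType).
Notation mu := (@lebesgue_measure R).
#[local] Existing Instance ae_mu_filter.
Implicit Types (f g c d : R -> R).

Let mI : measurable (`[0, 1] : set (measurableTypeR R)).
Proof. exact: measurable_itv. Qed.

Definition prim f x := \int[mu]_(t in `[0, x]) f t.

Let sub01 (x : R) : x \in `[0, 1] -> (`[0, x]%classic : set (measurableTypeR R)) `<=` `[0, 1].
Proof. by move=> x01; apply: subset_itvl; rewrite bnd_simp (itvP x01). Qed.

Lemma prim0 f : prim f 0 = 0.
Proof. by rewrite /prim set_itv1 Rintegral_set1. Qed.

Lemma prim1 f : prim f 1 = I f. Proof. by []. Qed.

Let L1_sub f x : L1 f -> x \in `[0, 1] -> mu.-integrable `[0, x] (EFin \o f).
Proof. by move=> L1f x01; apply: integrableS L1f => //; exact: sub01. Qed.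

Lemma primD f g x : L1 f -> L1 g -> x \in `[0, 1] ->
  prim (fun t => f t + g t) x = prim f x + prim g x.
Proof. by move=> L1f L1g x01; apply: RintegralD => //; exact: L1_sub. Qed.

Lemma primB f g x : L1 f -> L1 g -> x \in `[0, 1] ->
  prim (fun t => f t - g t) x = prim f x - prim g x.
Proof. by move=> L1f L1g x01; apply: RintegralB => //; exact: L1_sub. Qed.

Lemma primZ a f x : L1 f -> x \in `[0, 1] ->
  prim (fun t => a * f t) x = a * prim f x.
Proof. by move=> L1f x01; apply: RintegralZl => //; exact: L1_sub. Qed.

Lemma eq_prim f g x : x \in `[0, 1] -> {in `[0, 1], f =1 g} -> prim f x = prim g x.
Proof.
move=> x01 fg; apply: eq_Rintegral => t; rewrite inE => t0x; apply: fg.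
exact: (sub01 x01).
Qed.

Lemma norm_prim f x : L1 f -> x \in `[0, 1] -> `|prim f x| <= I (fun t => `|f t|).
Proof.
move=> L1f x01; apply: le_trans (le_normr_Rintegral _ (L1_sub L1f x01)) _ => //.
have iA : mu.-integrable `[0, 1] (EFin \o (fun t => `|f t|)) := L1_abs L1f.
apply: fine_le.
- by apply: integrable_fin_num => //; apply: integrableS iA => //; exact: sub01.
- exact: integrable_fin_num.
- apply: ge0_subset_integral => //; last exact: sub01.
  by apply/measurable_EFinP; apply: L1_measurable (L1_abs L1f).
Qed.

Lemma prim_continuous f : L1 f -> {within `[0, 1], continuous (prim f)}.
Proof. by move=> L1f; apply: parameterized_integral_continuous. Qed.

Lemma L1_prim f : L1 f -> L1 (prim f).
Proof. by move=> /prim_continuous/L1_cont. Qed.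

Lemma L1_approx f (e : R) : L1 f -> 0 < e ->
  exists2 g, continuous g & I (fun t => `|f t - g t|) <= e.
Proof.
move=> L1f e0.
have fI : (mu `[0%R, 1%R] < +oo)%E.
  by rewrite lebesgue_measure_itv/= lte_fin ltr01 oppr0 adde0 ltry.
have [g [cg ig g0]] := @approximation_continuous_integrable R `[0, 1] f mI fI L1f.
have /cvgrPdist_le /(_ _ e0)[n _ /(_ n (leqnn _))] := fine_cvg (FF := eventually_filter) g0.
rewrite sub0r normrN => H; exists (g n) => //.
exact: le_trans (ler_norm _) H.
Qed.

(** Used once for each argument of the defect [Phi], to pass from continuous to integrable
    functions. *)
Let dense0 (T : (R -> R) -> R) (K : R) : 0 <= K ->
  (forall f g, L1 f -> L1 g -> T (fun t => f t - g t) = T f - T g) ->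
  (forall f, L1 f -> `|T f| <= K * I (fun t => `|f t|)) ->
  (forall f, continuous f -> T f = 0) ->
  forall f, L1 f -> T f = 0.
Proof.
move=> K0 TB TK T0 f L1f; apply/eqP; rewrite -normr_le0; apply/ler_addgt0Pr => e e0.
have eK : 0 < e / (K + 1) by rewrite divr_gt0// ltr_wpDl.
have [g cg fg] := L1_approx L1f eK.
have L1g : L1 g by apply: L1_cont; exact: continuous_subspaceT.
have := TK _ (L1B L1f L1g); rewrite TB// (T0 _ cg) subr0 add0r => /le_trans; apply.
rewrite -[leRHS](@divfK _ (K + 1)) ?gt_eqF ?ltr_wpDl// [leRHS]mulrC ler_pM ?lerDl//.
exact: I_ge0.
Qed.

Let cont_LR f x : 0 < x -> continuous f ->
  derivable_oo_LRcontinuous (prim f) 0 x /\ {in `]0, x[, derive1 (prim f) =1 f}.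
Proof.
move=> x0 cf.
have iu u : mu.-integrable `[0, u] (EFin \o f).
  apply: continuous_compact_integrable; first exact: segment_compact.
  exact: continuous_subspaceT.
have D t : t \in `]0, x[ -> derivable (prim f) t 1 /\ derive1 (prim f) t = f t.
  move=> t0x; apply: (@continuous_FTC1_closed R f 0 t x) => //.
  - by rewrite (itvP t0x).
  - by rewrite (itvP t0x).
  - exact: cf.
have := @parameterized_integral_continuous R 0 x f (ltW x0) (iu x).
move/(continuous_within_itvP _ x0) => [_ c0 cx].
split; last by move=> t t0x; have [] := D t t0x.
by split => // t t0x; have [] := D t t0x.
Qed.

(* The defect in the integration by parts formula: it is continuous in f and g
   for the L^1 norm and vanishes when both are continuous. *)
Let Phi x f g := prim (fun t => prim f t * g t) x + prim (fun t => f t * prim g t) x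
  - prim f x * prim g x.

Let PhiC x f g : Phi x f g = Phi x g f.
Proof.
have E h k : (fun t => prim h t * k t) = (fun t => k t * prim h t).
  by apply/funext => t; rewrite mulrC.
by rewrite /Phi (E f g) (E g f); ring.
Qed.

Let L1Mr f g : L1 f -> {within `[0, 1], continuous g} -> L1 (fun t => f t * g t).
Proof.
move=> L1f cg; have := L1M cg L1f.
by rewrite (_ : (fun _ => _) = (fun x => f x * g x))//; apply/funext => t; rewrite mulrC.
Qed.

Let PhiB x f1 f2 g : x \in `[0, 1] -> L1 f1 -> L1 f2 -> L1 g ->
  Phi x (fun t => f1 t - f2 t) g = Phi x f1 g - Phi x f2 g.
Proof.
move=> x01 L1f1 L1f2 L1g; rewrite /Phi primB//.
have cf1 := prim_continuous L1f1; have cf2 := prim_continuous L1f2.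
have cg := prim_continuous L1g.
rewrite (@eq_prim _ (fun t => prim f1 t * g t - prim f2 t * g t))//; last first.
  by move=> t t01; rewrite primB// mulrBl.
rewrite primB//; [|exact: L1M..].
rewrite (@eq_prim (fun t => (f1 t - f2 t) * prim g t) (fun t => f1 t * prim g t - f2 t * prim g t))//; last first.
  by move=> t t01; rewrite mulrBl.
rewrite primB//; [|exact: L1Mr..].
by ring.
Qed.

Let le_IM K f g : 0 <= K -> L1 f -> L1 (fun t => g t * f t) ->
  {in `[0, 1], forall t, `|g t| <= K} -> I (fun t => `|g t * f t|) <= K * I (fun t => `|f t|).
Proof.
move=> K0 L1f L1gf gK; rewrite -IZ; last exact: L1_abs.
apply: le_I; [exact: L1_abs|exact/L1Z/L1_abs|] => t t01.
by rewrite normrM ler_wpM2r// gK.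
Qed.

Let PhiK x f g : x \in `[0, 1] -> L1 f -> L1 g ->
  `|Phi x f g| <= 3 * I (fun t => `|g t|) * I (fun t => `|f t|).
Proof.
move=> x01 L1f L1g; set X := I (fun t => `|f t|); set Y := I (fun t => `|g t|).
have cf := prim_continuous L1f; have cg := prim_continuous L1g.
have X0 : 0 <= X by exact: I_ge0.
have Y0 : 0 <= Y by exact: I_ge0.
have H1 : `|prim (fun t => prim f t * g t) x| <= X * Y.
  apply: le_trans (norm_prim _ x01) _; first exact: L1M.
  by apply: le_IM => //; [exact: L1M|move=> t t01; exact: norm_prim].
have H2 : `|prim (fun t => f t * prim g t) x| <= Y * X.
  apply: le_trans (norm_prim _ x01) _; first exact: L1Mr.
  rewrite (_ : (fun t => `|_|) = (fun t => `|prim g t * f t|)); last first.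
    by apply/funext => t; rewrite mulrC.
  by apply: le_IM => //; [exact: L1M|move=> t t01; exact: norm_prim].
have H3 : `|prim f x * prim g x| <= X * Y.
  by rewrite normrM ler_pM// norm_prim.
apply: le_trans (ler_normB _ _) _; apply: le_trans (lerD (ler_normD _ _) (lexx _)) _.
lra.
Qed.

Lemma prim_mul f g x : L1 f -> L1 g -> x \in `[0, 1] ->
  prim (fun t => prim f t * g t + f t * prim g t) x = prim f x * prim g x.
Proof.
move=> L1f L1g x01.
have cf := prim_continuous L1f; have cg := prim_continuous L1g.
rewrite primD//; [|exact: L1M|exact: L1Mr].
apply/eqP; rewrite -subr_eq0; apply/eqP; rewrite -/(Phi x f g).
have [x0|x0] := ltP 0 x; last first.
  have -> : x = 0 by apply/eqP; rewrite eq_le x0 (itvP x01).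
  by rewrite /Phi !prim0 mul0r addr0 subr0.
have H0 f1 g1 : continuous f1 -> continuous g1 -> Phi x f1 g1 = 0.
  move=> cf1 cg1; have [F1 F2] := cont_LR x0 cf1; have [G1 G2] := cont_LR x0 cg1.
  have := Rintegration_by_parts x0 (continuous_subspaceT cf1) F1 F2 (continuous_subspaceT cg1) G1 G2.
  by rewrite !prim0 mulr0 subr0 /Phi => E; rewrite {1}/prim E subrK subrr.
have I0 (h : R -> R) : 0 <= 3 * I (fun t => `|h t|) by rewrite mulr_ge0// I_ge0.
have H1 f1 g1 : L1 f1 -> continuous g1 -> Phi x f1 g1 = 0.
  move=> L1f1 cg1; have L1g1 : L1 g1 by apply: L1_cont; exact: continuous_subspaceT.
  have TB f2 f3 : L1 f2 -> L1 f3 -> Phi x (fun t => f2 t - f3 t) g1 = Phi x f2 g1 - Phi x f3 g1.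
    by move=> ? ?; exact: PhiB.
  have TK f2 : L1 f2 -> `|Phi x f2 g1| <= 3 * I (fun t => `|g1 t|) * I (fun t => `|f2 t|).
    by move=> ?; exact: PhiK.
  exact: (@dense0 (fun h => Phi x h g1) _ (I0 g1) TB TK (fun f2 cf2 => H0 f2 g1 cf2 cg1) f1 L1f1).
have TB f2 f3 : L1 f2 -> L1 f3 -> Phi x f (fun t => f2 t - f3 t) = Phi x f f2 - Phi x f f3.
  by move=> ? ?; rewrite ![Phi x f _]PhiC; exact: PhiB.
have TK f2 : L1 f2 -> `|Phi x f f2| <= 3 * I (fun t => `|f t|) * I (fun t => `|f2 t|).
  by move=> ?; rewrite PhiC; exact: PhiK.
exact: (@dense0 (Phi x f) _ (I0 f) TB TK (fun f2 cf2 => H1 f f2 L1f cf2) g L1g).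
Qed.

(* c is absolutely continuous on [0, 1] with derivative d. *)
Definition AC c d := L1 d /\ {in `[0, 1], forall x, c x = c 0 + prim d x}.

Lemma AC_continuous c d : AC c d -> {within `[0, 1], continuous c}.
Proof.
move=> [L1d cE].
have : {within `[0, 1], continuous (fun x => c 0 + prim d x)}.
  move=> x; apply: continuousD; first exact: cvg_cst.
  exact: prim_continuous.
apply: subspace_eq_continuous => x; rewrite inE /= => x01.
by rewrite [RHS]cE.
Qed.

Lemma AC_L1 c d : AC c d -> L1 c. Proof. by move=> /AC_continuous/L1_cont. Qed.

Let in0 : (0 : R) \in `[0, 1]. Proof. by rewrite in_itv/= lexx ler01. Qed.
Let in1 : (1 : R) \in `[0, 1]. Proof. by rewrite in_itv/= lexx ler01. Qed.

Lemma L1_eq f g : {in `[0, 1], f =1 g} -> L1 f -> L1 g.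
Proof.
move=> fg; apply: eq_integrable => // x; rewrite inE/= => x01.
by rewrite /= fg.
Qed.

Lemma AC_eq c d c' d' : {in `[0, 1], c =1 c'} -> {in `[0, 1], d =1 d'} ->
  AC c d -> AC c' d'.
Proof.
move=> cc dd [L1d cE]; split; first exact: L1_eq L1d.
by move=> x x01; rewrite -!cc// cE// (eq_prim x01 dd).
Qed.

Lemma AC_cst a : AC (fun=> a) (fun=> 0).
Proof.
split; first exact: L1_cst.
by move=> x x01; rewrite /prim Rintegral_cst// mul0r addr0.
Qed.

Lemma AC_prim f : L1 f -> AC (prim f) f.
Proof. by move=> L1f; split => // x x01; rewrite prim0 add0r. Qed.

Lemma ACD c d c' d' : AC c d -> AC c' d' -> AC (fun x => c x + c' x) (fun x => d x + d' x).
Proof.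
move=> [L1d cE] [L1d' c'E]; split; first exact: L1D.
by move=> x x01; rewrite cE// c'E// primD//; ring.
Qed.

Lemma ACZ a c d : AC c d -> AC (fun x => a * c x) (fun x => a * d x).
Proof.
move=> [L1d cE]; split; first exact: L1Z.
by move=> x x01; rewrite cE// primZ//; ring.
Qed.

Lemma ACB c d c' d' : AC c d -> AC c' d' -> AC (fun x => c x - c' x) (fun x => d x - d' x).
Proof.
move=> [L1d cE] [L1d' c'E]; split; first exact: L1B.
by move=> x x01; rewrite cE// c'E// primB//; ring.
Qed.

Lemma ACM c d c' d' : AC c d -> AC c' d' ->
  AC (fun x => c x * c' x) (fun x => d x * c' x + c x * d' x).
Proof.
move=> AC1 AC2; have cc := AC_continuous AC1; have cc' := AC_continuous AC2.
case: AC1 AC2 => [L1d cE] [L1d' c'E].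
split; first by apply: L1D; [exact: L1Mr|exact: L1M].
move=> x x01.
have cp := prim_continuous L1d; have cp' := prim_continuous L1d'.
rewrite (@eq_prim _ (fun t => (c' 0 * d t + c 0 * d' t) + (prim d t * d' t + d t * prim d' t)))//; last first.
  by move=> t t01; rewrite cE// c'E//; ring.
rewrite primD//; last 2 first.
- by apply: L1D; exact: L1Z.
- by apply: L1D; [exact: L1M|exact: L1Mr].
rewrite prim_mul// primD ?primZ//; [|exact: L1Z..].
by rewrite cE// c'E//; ring.
Qed.

Lemma AC_I c d : AC c d -> I d = c 1 - c 0.
Proof. by move=> [L1d cE]; rewrite (cE 1)// prim1; ring. Qed.

Lemma AC_C1 (F f : R -> R) : {within `[0, 1], continuous F} -> {within `[0, 1], continuous f} ->
  (forall x : R, x \in `]0, 1[ -> is_derive x 1 F (f x)) -> AC F f.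
Proof.
move=> cF cf Ff; split; first exact: L1_cont.
move=> x x01; have [x0|x0] := ltP 0 x; last first.
  have -> : x = 0 by apply/eqP; rewrite eq_le x0 (itvP x01).
  by rewrite prim0 addr0.
have sub : (`[0, x] : set R) `<=` `[0, 1] by exact: (sub01 x01).
have cF' := continuous_subspaceW sub cF.
have cf' := continuous_subspaceW sub cf.
have /(continuous_within_itvP _ x0)[_ F0 Fx] := cF'.
have in01 t : t \in `]0, x[ -> t \in `]0, 1[.
  move=> t0x; rewrite in_itv/= (itvP t0x)/=.
  by rewrite (lt_le_trans (_ : t < x)) ?(itvP t0x) ?(itvP x01).
rewrite /prim /Rintegral (@continuous_FTC2 R f F 0 x)//.
- by rewrite /=; ring.
- by split => // t /in01/Ff[].
- by move=> t /in01/Ff H; rewrite derive1E; case: H.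
Qed.

End AbsolutelyContinuous.

(** * Weak derivatives and absolutely continuous representatives *)

Section WeakDerivative.
Context (R : realType).
Notation mu := (@lebesgue_measure R).
Notation muI := (muI R).
#[local] Existing Instance ae_mu_filter.
#[local] Existing Instance ae_muI_filter.
Implicit Types (f g c d : R -> R).

Let mI : measurable (`[0, 1] : set (measurableTypeR R)).
Proof. exact: measurable_itv. Qed.

Lemma ae_not1 (a : R) : {ae mu, forall x, x != a}.
Proof.
exists [set a]; split => //.
- exact: lebesgue_measure_set1.
- by move=> x /= /negP; rewrite negbK => /eqP.
Qed.

Let supp_itv (psi : R -> R) (a b : R) :=
  [/\ 0 < a, a <= b, b < 1 & forall x, psi x != 0 -> a <= x <= b].

(** Integrating from $-\infty$ gives 0 to the left of the support; to the right of it the result is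
    the total integral, which vanishes too. *)
Let antiderivative_test (psi : R -> R) a b : continuous psi -> supp_itv psi a b -> I psi = 0 ->
  exists2 phi, test_fun phi & derive1 phi = psi.
Proof.
move=> cpsi [a0 ab b1 psi0] Ipsi.
have psi_out x : ~~ (a <= x <= b) -> psi x = 0.
  by apply: contraNeq => /psi0.
have psi_restr : psi = psi \_ (`[0, 1] : set R).
  apply/funext => x; rewrite patchE; case: ifPn => //.
  rewrite notin_setE/= in_itv/= => /negP h; apply: psi_out; apply: contra h => /andP[h1 h2].
  by rewrite (le_trans _ h1) ?(ltW a0)// (le_trans h2) ?ltW.
have iT : mu.-integrable [set: measurableTypeR R] (EFin \o psi).
  have L : L1 psi by apply: L1_cont; exact: continuous_subspaceT.
  by move: L; rewrite /L1 integrable_mkcond//= restrict_EFin -psi_restr.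
pose phi x := \int[mu]_(t in `]-oo, x]) psi t.
have D x : derivable phi x 1 /\ derive1 phi x = psi x.
  apply: (@continuous_FTC1 R psi -oo%O x (x + 1)); rewrite ?ltrDl//.
  - by apply: integrableS iT.
  - by rewrite ltNyr.
  - exact: cpsi.
have phi' : derive1 phi = psi by apply/funext => x; have [] := D x.
exists phi => //; split.
- by move=> x; have [] := D x.
- by rewrite phi'.
- exists a, b; split => // x; apply: contraNT; rewrite negb_and -!ltNge => /orP[xa|bx].
    apply/eqP; rewrite /phi (@eq_Rintegral _ _ _ mu _ (fun=> 0)) ?Rintegral_cst ?mul0r//.
    move=> t; rewrite inE/= in_itv/= => tx; apply: psi_out.
    by rewrite negb_and -!ltNge (le_lt_trans tx).
  apply/eqP; rewrite /phi -[RHS]Ipsi /I [RHS]Rintegral_mkcond [LHS]Rintegral_mkcond.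
  apply: eq_Rintegral => t _; rewrite -psi_restr patchE; case: ifPn => //.
  rewrite notin_setE/= in_itv/= => /negP; rewrite -ltNge => xt.
  by apply/esym/psi_out; rewrite negb_and -!ltNge (lt_trans bx) ?orbT.
Qed.

(** Since test functions are only $C^1$, a difference of two normalised tents may be the derivative
    of one. *)
Let tent (a e t : R) := Num.max 0 (e - `|t - a|).

Let tent_continuous a e : continuous (tent a e).
Proof.
move=> t; apply: (@continuous_max R R (cst 0) (fun t => e - `|t - a|)).
  exact: cvg_cst.
apply: continuousB; first exact: cvg_cst.
by apply: cvg_norm; apply: cvgB; [exact: cvg_id|exact: cvg_cst].
Qed.

Let tent_ge0 a e t : 0 <= tent a e t. Proof. by rewrite le_max lexx. Qed.

Let tent_le a e t : 0 <= e -> tent a e t <= e.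
Proof. by move=> e0; rewrite ge_max e0 gerBl normr_ge0. Qed.

Let tent_out a e t : e <= `|t - a| -> tent a e t = 0.
Proof. by move=> et; rewrite /tent max_l// subr_le0. Qed.

Let L1_tent a e : L1 (tent a e).
Proof. by apply: L1_cont; exact: continuous_subspaceT. Qed.

Let I_tent_ge a e : 0 < e -> e < a -> a + e < 1 -> e ^+ 2 / 2 <= I (tent a e).
Proof.
move=> e0 ea ae1; set A := `[a - e / 2, a + e / 2].
have AI : [set` A] `<=` (`[0, 1] : set R).
  by apply: subset_itv; rewrite bnd_simp; lra.
have iA : mu.-integrable [set` A] (EFin \o tent a e).
  by apply: integrableS (L1_tent a e).
apply: (@le_trans _ _ (\int[mu]_(t in [set` A]) tent a e t)); last first.
  apply: fine_le.
  - exact: integrable_fin_num.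
  - by apply: integrable_fin_num => //; exact: L1_tent.
  - apply: ge0_subset_integral => //.
      by apply/measurable_EFinP; apply: L1_measurable; exact: L1_tent.
    by move=> t _; rewrite lee_fin.
have -> : e ^+ 2 / 2 = \int[mu]_(t in [set` A]) (e / 2).
  rewrite Rintegral_cst//= lebesgue_measure_itv/= lte_fin ifT; last lra.
  by rewrite -EFinB/=; field.
apply: le_Rintegral => //.
  apply: continuous_compact_integrable; first exact: segment_compact.
  by apply: continuous_subspaceT => x; exact: cvg_cst.
move=> t /=; rewrite in_itv/= => /andP[h1 h2]; rewrite le_max; apply/orP; right.
have : `|t - a| <= e / 2 by rewrite ler_norml; lra.
lra.
Qed.

(* Tents of height and half-width e around a Lebesgue point a. *)
Let I_tent_near (u : R -> R) (a e eta : R) : L1 u -> 0 < e -> e < a -> a + e < 1 ->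
  (davg (u \_ (`[0%R, 1%R]%classic : set R)) a e <= eta%:E)%E ->
  `|I (fun t => u t * tent a e t) - u a * I (tent a e)| <= 2 * eta * e ^+ 2.
Proof.
move=> L1u e0 ea ae1 davg_le.
have ct : {within `[0, 1], continuous (tent a e)} by exact: continuous_subspaceT.
have L1ut : L1 (fun t => tent a e t * u t) by exact: L1M.
have L1t := L1_tent a e.
have -> : (fun t => u t * tent a e t) = (fun t => tent a e t * u t).
  by apply/funext => t; rewrite mulrC.
rewrite -IZ// -IB//; last exact: L1Z.
have L1d : L1 (fun t => tent a e t * u t - u a * tent a e t) by apply: L1B => //; exact: L1Z.
apply: le_trans (norm_I L1d) _.
have a01 : a \in `[0, 1] by rewrite in_itv/=; apply/andP; split; lra.
have aI : a \in (`[0, 1]%classic : set R) by rewrite inE.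
have bI : (ball a e : set R) `<=` `[0, 1].
  move=> t; rewrite ball_itv/= !in_itv/= => /andP[h1 h2]; apply/andP; split; lra.
rewrite -lee_fin /I fineK; last first.
  by apply: integrable_fin_num => //; exact: L1_abs L1d.
pose f := u \_ (`[0, 1] : set R).
have mf : measurable_fun [set: measurableTypeR R] f.
  by apply/(measurable_restrictT _ _).1 => //; exact: L1_measurable.
have mb : measurable (ball a e : set (measurableTypeR R)) by exact: measurable_ball.
apply: (@le_trans _ _ (\int[mu]_(t in `[0%R, 1%R]) ((fun t => (e%:E * `|(f t - f a)%:E|)%E) \_ (ball a e : set R)) t)%E).
  apply: ge0_le_integral => //.
  - by apply/measurable_EFinP; apply: L1_measurable; exact: L1_abs L1d.
  - apply: measurable_funTS; apply/(measurable_restrictT _ _).1 => //.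
    apply: measurable_funTS; apply/measurable_EFinP.
    apply: measurable_funM => //; apply: measurableT_comp => //.
    exact: measurable_funB.
  - move=> t t01; rewrite patchE /f !patchE (mem_set t01) aI.
    rewrite -[u a * _]mulrC -mulrBr.
    case: ifPn => [_|]; first by rewrite lee_fin normrM ger0_norm// ler_wpM2r// tent_le// ltW.
    rewrite notin_setE/= -ball_normE/= => /negP; rewrite -leNgt distrC => /tent_out ->.
    by rewrite mul0r normr0.
rewrite -integral_mkcondr setIidr// ge0_integralZl//; last 2 first.
- apply: measurable_funTS; apply/measurable_EFinP; apply: measurableT_comp => //.
  exact: measurable_funB.
- by rewrite lee_fin ltW.
move: davg_le; rewrite /davg /iavg -/f (lebesgue_measure_ball _ (ltW e0)).
rewrite inver gt_eqF ?mulrn_wgt0// => H.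
have {}H : (\int[mu]_(t in ball a e) `|(f t - f a)%:E| <= (e *+ 2 * eta)%:E)%E.
  by rewrite EFinM -lee_pdivrMl ?mulrn_wgt0.
apply: le_trans (lee_wpmul2l _ H) _; first by rewrite lee_fin ltW.
by rewrite -EFinM lee_fin le_eqVlt; apply/orP; left; apply/eqP; ring.
Qed.

(** All normalised tents average [u] to the same [k], as differences of such tents are derivatives
    of test functions. At a Lebesgue point these averages tend to the value of [u]. *)
Lemma du_bois_reymond (u : R -> R) : L1 u ->
  (forall phi, test_fun phi -> I (fun t => u t * derive1 phi t) = 0) ->
  exists k, {ae mu, forall x, x \in `[0, 1] -> u x = k}.
Proof.
move=> L1u uphi.
pose T0 := I (tent (1/2) (1/4)); pose k := I (fun t => u t * tent (1/2) (1/4) t) / T0.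
have L1ut a e : L1 (fun t => u t * tent a e t).
  have ct : {within `[0, 1], continuous (tent a e)} by exact: continuous_subspaceT.
  have := L1M ct L1u; rewrite (_ : (fun _ => _) = (fun t => u t * tent a e t))//.
  by apply/funext => t; rewrite mulrC.
have T0_gt0 : 0 < T0.
  by apply: lt_le_trans (@I_tent_ge (1/2) (1/4) _ _ _); lra.
have key a e : 0 < e -> e < a -> a + e < 1 -> I (fun t => u t * tent a e t) = k * I (tent a e).
  move=> e0 ea ae1.
  have T_gt0 : 0 < I (tent a e).
    by apply: lt_le_trans (@I_tent_ge a e _ _ _) => //; rewrite divr_gt0 ?exprn_gt0.
  pose psi t := (I (tent a e))^-1 * tent a e t - T0^-1 * tent (1/2) (1/4) t.
  have cpsi : continuous psi.
    by move=> t; apply: cvgB; apply: cvgM; (try exact: cvg_cst); exact: tent_continuous.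
  have Ipsi : I psi = 0.
    rewrite IB; [|exact/L1Z/L1_tent..].
    by rewrite !IZ ?mulVf ?subrr ?gt_eqF//; exact: L1_tent.
  have sp : supp_itv psi (Num.min (a - e) (1/4)) (Num.max (a + e) (3/4)).
    split; rewrite ?lt_min ?gt_max ?le_max ?ge_min; try (apply/andP; split; lra).
      by apply/orP; left; apply/orP; left; lra.
    move=> t; apply: contraNT; rewrite negb_and -!ltNge lt_min gt_max => H.
    rewrite /psi !tent_out ?mulr0 ?subrr//.
      by case/orP: H => /andP[h1 h2]; [rewrite ler0_norm|rewrite ger0_norm]; lra.
    by case/orP: H => /andP[h1 h2]; [rewrite ler0_norm|rewrite ger0_norm]; lra.
  have [phi tphi phiE] := antiderivative_test cpsi sp Ipsi.
  have := uphi _ tphi; rewrite phiE.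
  have -> : (fun t => u t * psi t) =
    (fun t => (I (tent a e))^-1 * (u t * tent a e t) - T0^-1 * (u t * tent (1/2) (1/4) t)).
    by apply/funext => t; rewrite /psi; ring.
  rewrite IB ?IZ//; [|exact: L1Z..].
  move=> /eqP; rewrite subr_eq0 => /eqP E.
  have Tn0 : I (tent a e) != 0 by rewrite gt_eqF.
  by rewrite /k -[LHS](mulVKf Tn0) E; ring.
exists k.
have iT := integrable_locally mI L1u.
have leb := lebesgue_differentiation iT.
have n0 := ae_not1 0; have n1 := ae_not1 1.
have : {ae mu, forall x, [/\ lebesgue_pt (u \_ (`[0,1] : set R)) x, x != 0 & x != 1]}.
  by apply: filterS3 leb n0 n1 => x.
apply: filterS => a [la a0 a1]; rewrite in_itv/= => /andP[a_ge0 a_le1].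
have {a0 a_ge0} a0 : 0 < a by rewrite lt_neqAle eq_sym a0.
have {a1 a_le1} a1 : a < 1 by rewrite lt_neqAle a1.
apply/eqP; rewrite -subr_eq0 -normr_le0; apply/ler_addgt0Pr => eta eta0; rewrite add0r.
(* [I_tent_near] then gives $\eta e^2/2$, which the lower bound $e^2/2$ of [I_tent_ge] turns into
   $\eta$. *)
have eta4 : 0 < eta / 4 by rewrite divr_gt0.
have lae : \forall e \near (0 : R)^'+,
    (davg (u \_ (`[0%R, 1%R]%classic : set R)) a e < (eta / 4)%:E)%E.
  have := la [set y | (y < (eta / 4)%:E)%E]; apply.
  apply: open_nbhs_nbhs; split; first exact: open_ereal_lt_ereal.
  by rewrite /= lte_fin.
have [e [e0 ea ae1 de]] : exists e, [/\ 0 < e, e < a, a + e < 1 &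
    (davg (u \_ (`[0%R, 1%R]%classic : set R)) a e <= (eta / 4)%:E)%E].
  have : \forall e \near (0 : R)^'+, [/\ 0 < e, e < a, a + e < 1 &
    (davg (u \_ (`[0%R, 1%R]%classic : set R)) a e <= (eta / 4)%:E)%E].
    near=> e; split.
    + by near: e; exact: nbhs_right_gt.
    + by near: e; exact: nbhs_right_lt.
    + by rewrite -ltrBrDl; near: e; apply: nbhs_right_lt; rewrite subr_gt0.
    + by apply: ltW; near: e; exact: lae.
  by move=> /filter_ex.
have := I_tent_near L1u e0 ea ae1 de; rewrite key// -mulrBl normrM.
have := I_tent_ge e0 ea ae1; set T := I _ => T_ge.
have e20 : 0 < e ^+ 2 by rewrite exprn_gt0.
have T_ge0 : 0 <= T by apply: le_trans T_ge; rewrite divr_ge0// ltW.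
rewrite (ger0_norm T_ge0) distrC => H.
have : `|u a - k| * (e ^+ 2 / 2) <= eta / 2 * e ^+ 2.
  by apply: le_trans (ler_wpM2l (normr_ge0 _) T_ge) (le_trans H _); lra.
rewrite mulrA ler_pdivrMr//; have -> : eta / 2 * e ^+ 2 * 2 = eta * e ^+ 2 by field.
by rewrite ler_pM2r.
Unshelve. all: by end_near. Qed.

Let in0 : (0 : R) \in `[0, 1]. Proof. by rewrite in_itv/= lexx ler01. Qed.
Let in1 : (1 : R) \in `[0, 1]. Proof. by rewrite in_itv/= lexx ler01. Qed.

Lemma continuous_ae_eq f g : {within `[0, 1], continuous f} -> {within `[0, 1], continuous g} ->
  {ae mu, forall x, x \in `[0, 1] -> f x = g x} -> {in `[0, 1], f =1 g}.
Proof.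
move=> cf cg fg x x01; apply/eqP/negPn/negP => fgx.
have cd : {within `[0, 1], continuous (fun t => f t - g t)}.
  by move=> t; apply: cvgB; [exact: cf|exact: cg].
have [e e0 He] : exists2 e, 0 < e & forall t, t \in `[0, 1] -> `|x - t| < e -> f t != g t.
  have := (@subspace_continuousP _ (`[0, 1] : set R) _ (fun t => f t - g t)).1 cd x x01.
  move=> /cvgrPdist_lt /(_ `|f x - g x|); rewrite normr_gt0 subr_eq0 => /(_ fgx).
  rewrite nearE /within/= => /nbhs_ballP[e /= e0 He]; exists e => // t t01 xt.
  have xet : ball x e t by rewrite -ball_normE.
  by have := He _ xet t01; apply: contraTneq => ->; rewrite subrr subr0 ltxx.
case: fg => N [mN N0 fgN].
(* Clipped to the unit interval, the neighbourhood of [x] keeps positive length even when [x] is an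
   end point. *)
pose a := Num.max 0 (x - e / 2); pose b := Num.min 1 (x + e / 2).
have ab : a < b.
  have x0 : 0 <= x by rewrite (itvP x01).
  have x1 : x <= 1 by rewrite (itvP x01).
  by rewrite gt_max !lt_min; apply/andP; split; apply/andP; split; lra.
have abN : [set` `[a, b]] `<=` N.
  move=> t /=; rewrite in_itv/= ge_max le_min => /andP[/andP[h1 h2] /andP[h3 h4]].
  apply: fgN => /=; apply/not_implyP; split; first by rewrite in_itv/= h1.
  by apply/eqP/He; rewrite ?in_itv/= ?h1// ltr_norml; lra.
have : (mu [set` `[a, b]] <= 0)%E by rewrite -N0; apply: le_measure => //; rewrite inE.
by rewrite lebesgue_measure_itv/= lte_fin ab -EFinB lee_fin leNgt subr_gt0 ab.
Qed.

Local Notation Lsp := (LspaceType1 muI).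

Let Lspace1_meas (u : Lsp) : measurable_fun [set: measurableTypeR R] (u : R -> R).
Proof. exact: Lspace1_measurable. Qed.

Let weak_integral (u : Lsp) (phi : R -> R) : continuous phi ->
  \int[muI]_x (u x * phi x) = I (fun x => u x * phi x).
Proof.
move=> cphi; apply: Rintegral_muI; apply: measurable_funM => //.
exact: continuous_measurable_fun.
Qed.

Let L1uM (f phi : R -> R) : L1 f -> continuous phi -> L1 (fun t => f t * phi t).
Proof.
move=> L1f cphi; have := L1M (continuous_subspaceT cphi) L1f.
by rewrite (_ : (fun _ => _) = (fun t => f t * phi t))//; apply/funext => t; rewrite mulrC.
Qed.

Let test_cont (phi : R -> R) : test_fun phi -> continuous phi.
Proof. by move=> [D _ _] x; apply/differentiable_continuous/derivable1_diffP. Qed.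

Let test_AC (phi : R -> R) : test_fun phi -> [/\ AC phi (derive1 phi), phi 0 = 0 & phi 1 = 0].
Proof.
move=> tphi; have cphi := test_cont tphi.
case: tphi => D c' [a [b [a0 b1 ab]]].
split.
- apply: AC_C1; [exact: continuous_subspaceT|exact: continuous_subspaceT|].
  by move=> x _; rewrite derive1E; exact: DeriveDef.
- by apply/eqP/negPn/negP => /ab; rewrite leNgt a0.
- by apply/eqP/negPn/negP => /ab; rewrite andbC leNgt b1.
Qed.

(** By parts, [u] minus the primitive of [v] is orthogonal to all derivatives of test functions,
    hence constant; the converse is integration by parts again. *)
Lemma weak_derivativeP (u v : Lsp) :
  weak_derivative u v <->
  exists2 c, AC c v & {ae mu, forall x, x \in `[0, 1] -> u x = c x}.
Proof.
have L1u := Lspace1_L1 u; have L1v := Lspace1_L1 v.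
split => [wd|[c ACc uc] phi tphi]; last first.
  have cphi := test_cont tphi; have [ACphi p0 p1] := test_AC tphi.
  have c'phi : continuous (derive1 phi) by case: tphi.
  rewrite !weak_integral//.
  have := AC_I (ACM ACc ACphi); rewrite p0 p1 !mulr0 subr0 ID; last 2 first.
  - exact: L1uM.
  - exact: L1uM (AC_L1 ACc) _.
  move=> /eqP; rewrite addrC addr_eq0 => /eqP <-; apply: ae_eq_I.
  - exact: L1uM.
  - exact: L1uM (AC_L1 ACc) _.
  - by apply: filterS uc => x H x01; rewrite H.
have L1p := L1_prim L1v.
have [phi tphi|k Hk] := @du_bois_reymond (fun t => u t - prim v t) (L1B L1u L1p).
  have cphi := test_cont tphi; have [ACphi p0 p1] := test_AC tphi.
  have c'phi : continuous (derive1 phi) by case: tphi.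
  have := wd phi tphi; rewrite !weak_integral// => E.
  have := AC_I (ACM (AC_prim L1v) ACphi); rewrite p0 p1 !mulr0 subr0 ID; last 2 first.
  - exact: L1uM.
  - exact: L1uM.
  move=> /eqP; rewrite addr_eq0 => /eqP E2.
  have -> : (fun t => (u t - prim v t) * derive1 phi t) =
     (fun t => u t * derive1 phi t - prim v t * derive1 phi t).
    by apply/funext => t; rewrite mulrBl.
  by rewrite IB; [rewrite E E2 opprK subrr|exact: L1uM..].
exists (fun x => k + prim v x); last first.
  by apply: filterS Hk => x H x01; rewrite -(H x01) subrK.
by split => // x x01; rewrite prim0; ring.
Qed.

(** The primitive of $d-d'$ vanishes identically, and by Lebesgue it has derivative $d-d'$ almost
    everywhere. *)
Lemma AC_uniq c d d' : AC c d -> AC c d' -> {ae mu, forall x, x \in `[0, 1] -> d x = d' x}.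
Proof.
move=> [L1d cd] [L1d' cd'].
have L1h := L1B L1d L1d'; set h := fun x => _ in L1h.
have h0 x : x \in `[0, 1] -> prim h x = 0.
  move=> x01; rewrite primB//; apply/eqP; rewrite subr_eq0; apply/eqP.
  by apply: (addrI (c 0)); rewrite -cd// cd'.
pose f := h \_ (`[0, 1] : set R).
have iT : mu.-integrable [set: measurableTypeR R] (EFin \o f).
  by move: L1h; rewrite /L1 integrable_mkcond//= restrict_EFin.
have fi y : mu.-integrable [set` Interval (BLeft 0) (BRight y)] (EFin \o f).
  exact: integrableS iT.
have := FTC1 fi (integrable_locally mI L1h) => /= F'.
have n0 := ae_not1 0; have n1 := ae_not1 1.
apply: filterS3 F' n0 n1 => x F' x0 x1 x01.
have {x0} x0 : 0 < x by rewrite lt_neqAle eq_sym x0 (itvP x01).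
have {x1} x1 : x < 1 by rewrite lt_neqAle x1 (itvP x01).
have [] := F'; first exact: x0.
move=> _; rewrite {2}/f patchE mem_set// /h => E; apply/eqP; rewrite -subr_eq0 -E.
have near0 : {near x, (fun y => \int[mu]_(t in `[0, y]) f t) =1 cst 0}.
  near=> y.
  have y0 : 0 < y by near: y; exact: lt_nbhsr.
  have y1 : y < 1 by near: y; exact: lt_nbhsl.
  have y01 : y \in `[0, 1] by rewrite in_itv/= !ltW.
  rewrite /= -[RHS](h0 y y01); apply: eq_prim => // t t01.
  by rewrite /f patchE mem_set.
by apply/eqP; rewrite derive1E (near_eq_derive _ near0) derive_cst.
Unshelve. all: by end_near. Qed.

End WeakDerivative.

(** * Dissipativity and resolvent of the operator *)

Section NormalForm.
Context (R : realType).
Notation mu := (@lebesgue_measure R).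
Notation muI := (muI R).
#[local] Existing Instance ae_mu_filter.
#[local] Existing Instance ae_muI_filter.
Local Notation Lsp := (LspaceType1 muI).

Lemma eq_prim_ae (f g : R -> R) x : L1 f -> L1 g -> x \in `[0, 1] ->
  {ae mu, forall x, x \in `[0, 1] -> f x = g x} -> prim f x = prim g x.
Proof.
move=> L1f L1g x01 fg.
have sub : (`[0, x]%classic : set (measurableTypeR R)) `<=` `[0, 1].
  by apply: subset_itvl; rewrite bnd_simp (itvP x01).
congr fine; apply: ae_eq_integral => //.
- by apply/measurable_EFinP; apply: measurable_funS (L1_measurable L1f).
- by apply/measurable_EFinP; apply: measurable_funS (L1_measurable L1g).
- by apply: filterS fg => t H t0x; rewrite H//; exact: (sub t).
Qed.

Lemma AC_ae (c d d' : R -> R) : AC c d -> L1 d' ->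
  {ae mu, forall x, x \in `[0, 1] -> d x = d' x} -> AC c d'.
Proof.
move=> [L1d cE] L1d' dd'; split => // x x01.
by rewrite [LHS]cE// (eq_prim_ae L1d L1d').
Qed.

Context (m : nat) (sigma : 'I_m -> R) (K00 K01 K10 K11 : 'M[R]_m).
Hypothesis sigma_gt0 : forall i, 0 < sigma i.
Local Notation V := (mfold m (L1I R)).

Definition boundary (c d : 'I_m -> R -> R) : Prop := forall i,
  d i 0 = \sum_j K00 i j * c j 0 + \sum_j K01 i j * c j 1 /\
  d i 1 = \sum_j K10 i j * c j 0 + \sum_j K11 i j * c j 1.

(** The boundary condition and the action of the operator each come with a first derivative.
    [AC_uniq] identifies the two almost everywhere, and [continuous_ae_eq] makes their continuous
    representatives agree, so that one pair serves for both. *)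
Lemma A_PhiP (u f : V) : A_Phi sigma K00 K01 K10 K11 u f <->
  exists c d, [/\ forall i, AC (c i) (d i),
    forall i, AC (d i) (fun x => (sigma i)^-1 * (f i : Lsp) x),
    forall i, {ae mu, forall x, x \in `[0, 1] -> (u i : Lsp) x = c i x}
    & boundary c d].
Proof.
split=> [[_ [du [c [dc [udu uc dudc bc0 bc1]]]] [du2 [ddu [udu2 dudu2 fE]]]]|].
  exists (fun i x => c x i 0), (fun i x => dc x i 0).
  have AC1 i : AC (fun x => c x i 0) (du i : Lsp) /\ AC (fun x => c x i 0) (du2 i : Lsp).
    have /weak_derivativeP[c1 A1 u1] := udu i.
    have /weak_derivativeP[c2 A2 u2] := udu2 i.
    have [cc /ae_muI uci] := uc i.
    have E c3 d3 : AC c3 d3 -> {ae mu, forall x, x \in `[0, 1] -> (u i : Lsp) x = c3 x} ->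
        AC (fun x => c x i 0) d3.
      move=> A3 u3; apply: (AC_eq _ _ A3) => //; apply: continuous_ae_eq => //.
        exact: AC_continuous A3.
      by apply: filterS2 u3 uci => x H1 H2 x01; rewrite -H1// H2.
    by split; [exact: E A1 u1|exact: E A2 u2].
  have dcE i : {ae mu, forall x, x \in `[0, 1] -> (du i : Lsp) x = dc x i 0}.
    have [cc /ae_muI H] := dudc i.
    by apply: filterS H => x H x01; rewrite H.
  split.
  - move=> i; have [A1 _] := AC1 i; apply: AC_ae A1 _ (dcE i).
    by apply: L1_cont; have [] := dudc i.
  - move=> i; have [A1 A2] := AC1 i.
    have /weak_derivativeP[e Ae ue] := dudu2 i.
    have Ee := AC_uniq A1 A2.
    have edc : {in `[0, 1], e =1 (fun x => dc x i 0)}.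
      apply: continuous_ae_eq; [exact: AC_continuous Ae|by have [] := dudc i|].
      have H1 := dcE i; apply: filterS3 H1 ue Ee => x H1 H2 H3 x01.
      by rewrite -H1// H3// H2.
    have A3 : AC (fun x => dc x i 0) (ddu i : Lsp) by apply: AC_eq Ae.
    apply: AC_ae A3 _ _; first by apply: L1Z; exact: Lspace1_L1.
    have H := Lspace1Z_ae (sigma i) (ddu i : Lsp); rewrite fE.
    by apply: filterS H => x H x01; rewrite H// mulKf// gt_eqF.
  - move=> i; have [_ /ae_muI uci] := uc i.
    by apply: filterS uci => x H x01; rewrite H.
  - by move=> i; rewrite bc0 bc1 !mxE; split; congr (_ + _); apply: eq_bigr.
move=> [c [d [ACc ACd uc bc]]].
pose du : V := [ffun i => cls (d i) : L1I R].
pose ddu : V := [ffun i => (sigma i)^-1 *: f i].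
have duE i : {ae mu, forall x, x \in `[0, 1] -> (du i : Lsp) x = d i x}.
  by rewrite /mfold_app ffunE; apply: clsE; have [] := ACc i.
have dduE i : {ae mu, forall x, x \in `[0, 1] -> (ddu i : Lsp) x = (sigma i)^-1 * (f i : Lsp) x}.
  have -> : ddu i = (sigma i)^-1 *: f i by rewrite /mfold_app ffunE.
  exact: Lspace1Z_ae.
have udu : weak_derivativev u du.
  move=> i; apply/weak_derivativeP; exists (c i) => //.
  apply: AC_ae (ACc i) (Lspace1_L1 _) _.
  by have H := duE i; apply: filterS H => x H x01; rewrite H.
have dudu : weak_derivativev du ddu.
  move=> i; apply/weak_derivativeP; exists (d i) => //.
  apply: AC_ae (ACd i) (Lspace1_L1 _) _.
  by have H := dduE i; apply: filterS H => x H x01; rewrite H.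
split.
- by exists du, ddu.
- exists du, (fun x => \col_i c i x), (fun x => \col_i d i x); split => //.
  + move=> i; split.
      rewrite (_ : (fun _ => _) = c i); first exact: AC_continuous (ACc i).
      by apply/funext => x; rewrite mxE.
    apply/ae_muI; have H := uc i; apply: filterS H => x H x01; rewrite mxE.
    by rewrite H.
  + move=> i; split.
      rewrite (_ : (fun _ => _) = d i); first exact: AC_continuous (ACd i).
      by apply/funext => x; rewrite mxE.
    apply/ae_muI; have H := duE i; apply: filterS H => x H x01; rewrite mxE.
    by rewrite H.
  + apply/colP => i; rewrite !mxE; have [-> _] := bc i.
    by congr (_ + _); apply: eq_bigr => j _; rewrite mxE.
  + apply/colP => i; rewrite !mxE; have [_ ->] := bc i.
    by congr (_ + _); apply: eq_bigr => j _; rewrite mxE.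
- exists du, ddu; split => // i; rewrite {1}/ddu /mfold_app ffunE scalerA mulfV ?scale1r//.
  by rewrite gt_eqF.
Qed.

End NormalForm.

(** * Composition with a smooth approximation of the positive part *)

Section SmoothPositivePart.
Context (R : realType).
Implicit Types (c d : R -> R).

Lemma derive_continuous (F f : R -> R) : (forall x : R, is_derive x 1 F (f x)) -> continuous F.
Proof.
move=> D x; apply/differentiable_continuous/derivable1_diffP.
by have [] := D x.
Qed.

Lemma within_comp (phi c : R -> R) : continuous phi -> {within `[0, 1], continuous c} ->
  {within `[0, 1], continuous (fun x => phi (c x))}.
Proof. by move=> cphi cc x; apply: continuous_comp; [exact: cc|exact: cphi]. Qed.

Lemma withinM c d : {within `[0, 1], continuous c} -> {within `[0, 1], continuous d} ->
  {within `[0, 1], continuous (fun x => c x * d x)}.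
Proof. by move=> cc cd x; apply: cvgM; [exact: cc|exact: cd]. Qed.

Lemma AC_is_derive c d : AC c d -> {within `[0, 1], continuous d} ->
  forall x : R, x \in `]0, 1[ -> is_derive x 1 c (d x).
Proof.
move=> [L1d cE] cd x x01.
have x0 : 0 < x by rewrite (itvP x01).
have x1 : x < 1 by rewrite (itvP x01).
have cdx : {for x, continuous d}.
  have /(continuous_within_itvP _ ltr01)[H _ _] := cd; exact: H.
have [D DE] := @continuous_FTC1_closed R d 0 x 1 x1 L1d x0 cdx.
have near_c : {near x, (fun y => c 0 + prim d y) =1 c}.
  near=> y; rewrite [RHS]cE// in_itv/=; apply/andP; split; apply: ltW; near: y.
    exact: lt_nbhsr.
  exact: lt_nbhsl.
apply: near_eq_is_derive near_c _.
have H : is_derive x 1 (prim d) (d x) by apply: DeriveDef => //; rewrite -derive1E.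
have := is_deriveD (is_derive_cst (c 0) x 1) H; rewrite add0r; exact.
Unshelve. all: by end_near. Qed.

Lemma AC_comp (phi phi' c d : R -> R) : (forall s : R, is_derive s 1 phi (phi' s)) ->
  continuous phi' -> AC c d -> {within `[0, 1], continuous d} ->
  AC (fun x => phi (c x)) (fun x => phi' (c x) * d x).
Proof.
move=> D cphi' ACc cd; have cc := AC_continuous ACc.
apply: AC_C1.
- by apply: within_comp => //; exact: derive_continuous D.
- by apply: withinM => //; exact: within_comp.
- move=> x x01; have H := AC_is_derive ACc cd x01.
  exact: is_derive1_comp.
Qed.

Variable e : R.
Hypothesis e_gt0 : 0 < e.

(* pos_smooth is a smooth convex approximation of the positive part, with first
   and second derivatives pos_slope and pos_curv. *)
Let r (s : R) := Num.sqrt (s ^+ 2 + e ^+ 2).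
Definition pos_smooth s := (s + r s) / 2.
Definition pos_slope s := (1 + s / r s) / 2.
Definition pos_curv s := e ^+ 2 / 2 * ((r s)^-1 * (r s)^-1 * (r s)^-1).

Let r2 s : (r s) ^+ 2 = s ^+ 2 + e ^+ 2.
Proof. by rewrite sqr_sqrtr// addr_ge0// sqr_ge0. Qed.

Let q_gt0 s : 0 < s ^+ 2 + e ^+ 2.
Proof. by rewrite ltr_wpDl ?sqr_ge0// exprn_gt0. Qed.

Let r_gt0 s : 0 < r s. Proof. by rewrite sqrtr_gt0. Qed.

Let r_neq0 s : r s != 0. Proof. by rewrite gt_eqF. Qed.

Let r_ge s : `|s| <= r s.
Proof. by rewrite -sqrtr_sqr ler_wsqrtr// lerDl sqr_ge0. Qed.

Let r_le s : r s <= `|s| + e.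
Proof.
have h : 0 <= `|s| + e by rewrite addr_ge0// ltW.
have : r s ^+ 2 <= (`|s| + e) ^+ 2.
  rewrite r2 -[s ^+ 2]real_normK ?num_real//.
  have : 0 <= `|s| * e by rewrite mulr_ge0// ltW.
  by rewrite sqrrD; lra.
by rewrite ler_sqr ?nnegrE// ltW.
Qed.

Let Dr (s : R) : is_derive s 1 r (s / r s).
Proof.
have D1 : is_derive s 1 (fun t : R => t ^+ 2 + e ^+ 2) (2 * s).
  have := is_deriveD (is_deriveX 2 (is_derive_id s 1)) (is_derive_cst (e ^+ 2) s 1).
  by rewrite addr0 /GRing.scale/= mulr1 expr1.
have H : is_derive s 1 r _ := @is_derive1_comp _ Num.sqrt (fun t : R => t ^+ 2 + e ^+ 2) s _ _ (is_derive1_sqrt (q_gt0 s)) D1.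
apply: is_derive_eq H _; rewrite -/(r s); field.
exact: r_neq0.
Qed.

Lemma pos_smooth_derive (s : R) : is_derive s 1 pos_smooth (pos_slope s).
Proof.
have := is_deriveZ 2^-1 (is_deriveD (is_derive_id s 1) (Dr s)).
rewrite (_ : (2^-1 \*: _) = pos_smooth); last first.
  by apply/funext => t; rewrite /pos_smooth /GRing.scale/= mulrC.
by move=> H; apply: is_derive_eq H _; rewrite /GRing.scale/= mulrC.
Qed.

Lemma pos_slope_derive (s : R) : is_derive s 1 pos_slope (pos_curv s).
Proof.
have D1 := is_deriveM (is_derive_id s 1) (is_deriveV (r_neq0 s) (Dr s)).
have := is_deriveZ 2^-1 (is_deriveD (is_derive_cst (1 : R) s 1) D1).
rewrite (_ : (2^-1 \*: _) = pos_slope); last first.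
  by apply/funext => t; rewrite /pos_slope [RHS]mulrC.
move=> H; apply: is_derive_eq H _; rewrite /GRing.scale/= /pos_curv.
have := r2 s; have := r_neq0 s; move: (r s) => y y0 yE.
have -> : e ^+ 2 = y ^+ 2 - s ^+ 2 by rewrite yE; ring.
field. exact: y0.
Qed.

Lemma pos_curv_continuous : continuous pos_curv.
Proof.
move=> s; apply: cvgM; first exact: cvg_cst.
have cV : (r t)^-1 @[t --> s] --> (r s)^-1.
  by apply: cvgV; [exact: r_neq0|exact: (derive_continuous Dr)].
by apply: cvgM => //; exact: cvgM.
Qed.

Lemma pos_slope_continuous : continuous pos_slope.
Proof. exact: derive_continuous pos_slope_derive. Qed.

Lemma pos_curv_ge0 s : 0 <= pos_curv s.
Proof. by rewrite !mulr_ge0 ?invr_ge0 ?sqr_ge0// ltW. Qed.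

Definition pospart (s : R) := Num.max s 0.

Let pospartE s : pospart s = (s + `|s|) / 2.
Proof. by rewrite /pospart; case: (leP s 0) => h; [rewrite ler0_norm//|rewrite gtr0_norm//]; field. Qed.

Lemma pos_slope_itv s : 0 <= pos_slope s <= 1.
Proof.
have : `|s / r s| <= 1 by rewrite normrM normfV (gtr0_norm (r_gt0 s)) ler_pdivrMr// mul1r r_ge.
by rewrite ler_norml /pos_slope => /andP[h1 h2]; apply/andP; split; lra.
Qed.

Lemma pos_smooth_itv s : pospart s <= pos_smooth s <= pospart s + e.
Proof.
have := r_ge s; have := r_le s; have := e_gt0; rewrite pospartE /pos_smooth => ? ? ?.
apply/andP; split; lra.
Qed.

(** Stands in for $1_{s>0}\,s=s^+$; it comes from $|s|-e\le s^2/\sqrt{s^2+e^2}\le|s|$. *)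
Lemma pos_slopeM_itv s : pospart s - e <= pos_slope s * s <= pospart s.
Proof.
have -> : pos_slope s * s = (s + s ^+ 2 / r s) / 2 by rewrite /pos_slope; ring.
rewrite pospartE; suff : `|s| - e <= s ^+ 2 / r s <= `|s|.
  by have := e_gt0 => ? /andP[? ?]; apply/andP; split; lra.
rewrite -[s ^+ 2]real_normK ?num_real//.
have := r_ge s; have := r_le s; have := r_gt0 s; have := normr_ge0 s; have := e_gt0.
move: `|s| (r s) => a y e0 a0 y0 ya ay; apply/andP; split; last first.
  by rewrite ler_pdivrMr// expr2 ler_wpM2l.
rewrite ler_pdivlMr//.
have [h|h] := leP a e.
  by apply: (@le_trans _ _ 0); [rewrite mulr_le0_ge0 ?subr_le0// ltW|exact: sqr_ge0].
apply: (@le_trans _ _ ((a - e) * (a + e))); first by rewrite ler_wpM2l// subr_ge0 ltW.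
by rewrite -subr_sqr gerBl sqr_ge0.
Qed.

End SmoothPositivePart.

(** * Kato's inequality with an exponential weight *)

Section Kato.
Context (R : realType).
Implicit Types (c d f g : R -> R).

Lemma expRZ_within a : {within `[0, 1], continuous (fun x : R => expR (a * x))}.
Proof. by apply: continuous_subspaceT; exact: continuous_expRZ. Qed.

Lemma AC_expRZ (a : R) : AC (fun x => expR (a * x)) (fun x => a * expR (a * x)).
Proof.
apply: AC_C1; first exact: expRZ_within.
  by apply: withinM; [move=> x; exact: cvg_cst|exact: expRZ_within].
by move=> x _; exact: is_derive_expRZ.
Qed.

(** Symmetric under $x\mapsto1-x$, with outward slope $C(e^C-1)$ at both ends; every summand is a
    multiple of a function covered by [AC_expRZ]. *)
Definition weight (C x : R) := expR (C * x) + expR C * expR (- C * x).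
Definition dweight (C x : R) := C * expR (C * x) - C * (expR C * expR (- C * x)).

Lemma AC_weight C : AC (weight C) (dweight C).
Proof.
apply: AC_eq (ACD (AC_expRZ C) (ACZ (expR C) (AC_expRZ (- C)))) => // x _.
by rewrite /dweight; ring.
Qed.

Lemma AC_dweight C : AC (dweight C) (fun x => C ^+ 2 * weight C x).
Proof.
apply: AC_eq (ACB (ACZ C (AC_expRZ C)) (ACZ C (ACZ (expR C) (AC_expRZ (- C))))) => // x _.
by rewrite /weight; ring.
Qed.

Lemma weight_gt0 C x : 0 < weight C x.
Proof. by rewrite addr_gt0 ?mulr_gt0 ?expR_gt0. Qed.

Let expC C : expR C * expR (- C) = 1 :> R.
Proof. by rewrite -expRD subrr expR0. Qed.

Lemma weight0 C : weight C 0 = 1 + expR C.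
Proof. by rewrite /weight !mulr0 expR0 mulr1. Qed.

Lemma weight1 C : weight C 1 = 1 + expR C.
Proof. by rewrite /weight !mulr1 expC addrC. Qed.

Lemma dweight0 C : dweight C 0 = - (C * (expR C - 1)).
Proof. by rewrite /dweight !mulr0 expR0; ring. Qed.

Lemma dweight1 C : dweight C 1 = C * (expR C - 1).
Proof. by rewrite /dweight !mulr1 expC; ring. Qed.

Lemma weight_within C : {within `[0, 1], continuous (weight C)}.
Proof. exact: AC_continuous (AC_weight C). Qed.

Lemma L1_pospart f : L1 f -> L1 (fun x => pospart (f x)).
Proof.
move=> L1f; rewrite (_ : (fun _ => _) = (fun x => 2^-1 * (f x + `|f x|))).
  by apply/L1Z/L1D => //; exact: L1_abs.
apply/funext => x; rewrite /pospart.
by case: (leP (f x) 0) => h; [rewrite ler0_norm//|rewrite gtr0_norm//]; field.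
Qed.

Lemma L1_wpos C f : L1 f -> L1 (fun x => weight C x * pospart (f x)).
Proof. by move=> L1f; exact: L1M (@weight_within C) (L1_pospart L1f). Qed.

(* Kato's inequality: pos_slope e (c x) approximates the indicator of c > 0, and
   the term with pos_curv >= 0 is dropped. *)
Lemma kato C e c d f : 0 <= C -> 0 < e -> AC c d -> AC d f ->
  I (fun x => weight C x * pos_slope e (c x) * f x) <=
    (1 + expR C) * (pos_slope e (c 1) * d 1 - pos_slope e (c 0) * d 0)
    - C * (expR C - 1) * (pospart (c 1) + pospart (c 0))
    + C ^+ 2 * (I (fun x => weight C x * pospart (c x)) + e * I (weight C)).
Proof.
move=> C0 e0 ACc ACd; set w := weight C; set w' := dweight C.
have cd := AC_continuous ACd; have cc := AC_continuous ACc.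
have ACeta := AC_comp (pos_slope_derive e0) (pos_curv_continuous e0) ACc cd.
have ACH := AC_comp (pos_smooth_derive e0) (pos_slope_continuous e0) ACc cd.
(* Two integrations by parts, writing $\eta$ for the slope and $H$ for its primitive: of
   $(w\,\eta(c)\,d)'$, and of $(w'H(c))'$, which removes the remaining integral of $w'\eta(c)d$. *)
have A1 := AC_I (ACM (ACM (AC_weight C) ACeta) ACd).
have A2 := AC_I (ACM (AC_dweight C) ACH).
rewrite -/w -/w' in A1 A2.
have cw : {within `[0, 1], continuous w} := @weight_within C.
have cw' : {within `[0, 1], continuous w'} := AC_continuous (AC_dweight C).
have ceta := AC_continuous ACeta; have cH := AC_continuous ACH.
have L1w : L1 w := L1_cont cw.
have ccurv : {within `[0, 1], continuous (fun x => pos_curv e (c x))}.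
  by apply: within_comp => //; exact: pos_curv_continuous.
pose P x := w x * (pos_curv e (c x) * d x) * d x.
pose Q x := w' x * pos_slope e (c x) * d x.
pose S x := w x * pos_slope e (c x) * f x.
pose H x := w x * pos_smooth e (c x).
have L1P : L1 P by apply: L1_cont; apply: withinM => //; apply: withinM => //; exact: withinM.
have L1Q : L1 Q by apply: L1_cont; apply: withinM => //; exact: withinM.
have L1S : L1 S by case: ACd => L1f _; apply: L1M L1f; exact: withinM.
have L1H : L1 H by apply: L1_cont; exact: withinM.
have {}A1 : I Q + I P + I S = w 1 * pos_slope e (c 1) * d 1 - w 0 * pos_slope e (c 0) * d 0.
  rewrite -A1 -ID// -ID//; last exact: L1D.
  by apply: eq_I => x x01; rewrite /P /Q /S; ring.
have {}A2 : C ^+ 2 * I H + I Q = w' 1 * pos_smooth e (c 1) - w' 0 * pos_smooth e (c 0).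
  rewrite -A2 -IZ// -ID//; last exact: L1Z.
  by apply: eq_I => x x01; rewrite /H /Q; ring.
have P0 : 0 <= I P.
  apply: I_ge0 => x x01.
  have -> : P x = w x * pos_curv e (c x) * d x ^+ 2 by rewrite /P; ring.
  by rewrite mulr_ge0 ?sqr_ge0// mulr_ge0 ?pos_curv_ge0// ltW// weight_gt0.
have HE : I H <= I (fun x => w x * pospart (c x)) + e * I w.
  have L1p : L1 (fun x => w x * pospart (c x)) by apply: L1_wpos; exact: L1_cont.
  rewrite -IZ// -ID//; last exact: L1Z.
  apply: le_I => //; first by apply: L1D => //; exact: L1Z.
  move=> x x01; rewrite /H [e * _]mulrC -mulrDr ler_pM2l ?weight_gt0//.
  by have /andP[] := pos_smooth_itv e0 (c x).
have D0 : 0 <= C * (expR C - 1) by rewrite mulr_ge0// subr_ge0 -[leLHS]expR0 ler_expR.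
rewrite -/S (_ : I S = w 1 * pos_slope e (c 1) * d 1 - w 0 * pos_slope e (c 0) * d 0 - I P
   - (w' 1 * pos_smooth e (c 1) - w' 0 * pos_smooth e (c 0)) + C ^+ 2 * I H); last first.
  by rewrite -A1 -A2; ring.
rewrite /w /w' weight0 weight1 dweight0 dweight1.
have /andP[h1 _] := pos_smooth_itv e0 (c 1); have /andP[h0 _] := pos_smooth_itv e0 (c 0).
have := ler_wpM2l (sqr_ge0 C) HE.
have := ler_wpM2l D0 h1; have := ler_wpM2l D0 h0.
rewrite -/w; move: (C * (expR C - 1)) => D.
move: (I (fun x => w x * _)) (I H) (I w) (C ^+ 2) (1 + expR C) => X1 X2 X3 X4 X5.
lra.
Qed.

End Kato.

(** * Weighted estimate for the positive part of a resolvent solution *)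

Section ResolventBound.
Context (R : realType) (m : nat) (sigma : 'I_m -> R) (K00 K01 K10 K11 : 'M[R]_m).
Hypothesis sigma_gt0 : forall i, 0 < sigma i.
Hypothesis K_diag : forall i j : 'I_m, i != j -> 0 <= (- K00) i j /\ 0 <= K11 i j.
Hypothesis K_off : forall i j : 'I_m, 0 <= (- K01) i j /\ 0 <= K10 i j.

Definition Ksum : R := \sum_i \sum_j (`|K00 i j| + `|K01 i j| + `|K10 i j| + `|K11 i j|).

Let le_Ksum i j : `|K00 i j| + `|K01 i j| + `|K10 i j| + `|K11 i j| <= Ksum.
Proof.
apply: (@le_trans _ _ (\sum_j (`|K00 i j| + `|K01 i j| + `|K10 i j| + `|K11 i j|))).
  by rewrite (bigD1 j)//= lerDl sumr_ge0// => k _; rewrite !addr_ge0.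
rewrite /Ksum [leRHS](bigD1 i)//= lerDl sumr_ge0// => k _.
by apply: sumr_ge0 => l _; rewrite !addr_ge0.
Qed.

Let Ksum_ge0 : 0 <= Ksum.
Proof. by apply: sumr_ge0 => *; apply: sumr_ge0 => *; rewrite !addr_ge0. Qed.

(** Makes $2m\,\mathrm{Ksum}$ equal to $(C-2)/2$, so that [C_large] follows from $e^C\ge1+C$. *)
Definition growth_exp : R := 4 * (m%:R * Ksum) + 2.
Local Notation C := growth_exp.
Let C_ge2 : 2 <= C. Proof. by rewrite lerDr !mulr_ge0. Qed.
Let C_ge0 : 0 <= C. Proof. by apply: le_trans C_ge2. Qed.

(** $C^2$ comes from $w''=C^2w$. The sum bounds each $\sigma_i$, which is lost when an integral is
    compared with the norm weighted by $1/\sigma_i$. *)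
Definition growth_bound : R := C ^+ 2 * \sum_i sigma i.

Lemma growth_bound_ge0 : 0 <= growth_bound.
Proof. by rewrite mulr_ge0 ?sqr_ge0// sumr_ge0// => i _; exact: ltW. Qed.

(* Chosen so that the slope of the weight at the end points beats the boundary
   terms. *)
Let C_large : (1 + expR C) * (2 * (m%:R * Ksum)) <= C * (expR C - 1).
Proof.
have : 1 + C <= expR C by exact: expR_ge1Dx.
have := C_ge2; have -> : 2 * (m%:R * Ksum) = (C - 2) / 2 by rewrite /C; field.
move: (expR C) => E C2 CE.
rewrite -subr_ge0.
have -> : C * (E - 1) - (1 + E) * ((C - 2) / 2) = (C * (E - 3) + 2 * (1 + E)) / 2 by field.
rewrite divr_ge0// addr_ge0// mulr_ge0//; lra.
Qed.

Let p_ge0 (x : R) : 0 <= pospart x. Proof. by rewrite le_max lexx orbT. Qed.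

Let p_ge (x : R) : x <= pospart x. Proof. by rewrite le_max lexx. Qed.

(* With P false this covers the diagonal entries, whose sign is free because the
   value y is then taken at the same site as x. *)
Let slopeM_le (e k x y : R) (P : bool) : 0 < e -> (P -> 0 <= k) -> (~~ P -> x = y) ->
  pos_slope e x * (k * y) <= `|k| * (pospart y + e).
Proof.
move=> e0 k0 xy; have /andP[s0 s1] := pos_slope_itv e0 x.
case: P k0 xy => [/(_ isT) k0 _|_ /(_ isT) <-].
  rewrite ger0_norm// mulrCA ler_wpM2l//.
  apply: (@le_trans _ _ (pos_slope e x * pospart y)).
    by rewrite ler_wpM2l// p_ge.
  apply: (@le_trans _ _ (1 * pospart y)); last by rewrite mul1r lerDl ltW.
  by rewrite ler_wpM2r// p_ge0.
rewrite mulrCA; apply: le_trans (ler_norm _) _; rewrite normrM ler_wpM2l//.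
have /andP[h1 h2] := pos_slopeM_itv e0 x.
have : 0 <= pospart x by rewrite p_ge0.
by rewrite ler_norml => ?; apply/andP; split; lra.
Qed.

Variables (h : R) (c d g : 'I_m -> R -> R).
Hypothesis h_gt0 : 0 < h.
Hypothesis ACc : forall i, AC (c i) (d i).
Hypothesis ACd : forall i, AC (d i) (fun x => (h * sigma i)^-1 * (c i x - g i x)).
Hypothesis L1g : forall i, L1 (g i).
Hypothesis cd_boundary : boundary K00 K01 K10 K11 c d.

Let p (x : R) := pospart x.
Let w := weight C.

Let boundary_le (e : R) : 0 < e ->
  \sum_i (pos_slope e (c i 1) * d i 1 - pos_slope e (c i 0) * d i 0) <=
  2 * (m%:R * Ksum) * \sum_i (p (c i 1) + p (c i 0) + 2 * e).
Proof.
move=> e0.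
have := le_Ksum; move: Ksum => k le_k.
have -> : 2 * (m%:R * k) * \sum_i (p (c i 1) + p (c i 0) + 2 * e) =
   \sum_(i < m) (2 * k * \sum_j (p (c j 1) + p (c j 0) + 2 * e)).
  by rewrite sumr_const card_ord -mulr_natl; ring.
apply: ler_sum => i _; have [-> ->] := cd_boundary i.
rewrite !mulrDr !mulr_sumr opprD -!sumrN -!big_split/=; apply: ler_sum => j _.
have H1 := @slopeM_le e (K10 i j) (c i 1) (c j 0) true e0 (fun _ => (K_off i j).2) ltac:(by []).
have H2 := @slopeM_le e (K11 i j) (c i 1) (c j 1) (i != j) e0 (fun ij => (K_diag ij).2)
   ltac:(by move/negPn/eqP => ->).
have H3 : pos_slope e (c i 0) * (- K00 i j * c j 0) <= `|K00 i j| * (p (c j 0) + e).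
  rewrite -[`|K00 _ _|]normrN; apply: (@slopeM_le _ _ _ _ (i != j)) => //.
    by move=> /K_diag []; rewrite mxE.
  by move/negPn/eqP => ->.
have H4 : pos_slope e (c i 0) * (- K01 i j * c j 1) <= `|K01 i j| * (p (c j 1) + e).
  rewrite -[`|K01 _ _|]normrN; apply: (@slopeM_le _ _ _ _ true) => //.
  by have [] := K_off i j; rewrite mxE.
have p1 : 0 <= p (c j 1) + e by rewrite addr_ge0 ?p_ge0 ?ltW.
have p0 : 0 <= p (c j 0) + e by rewrite addr_ge0 ?p_ge0 ?ltW.
have K' := le_k i j.
have := ler_wpM2r p1 K'; have := ler_wpM2r p0 K'; rewrite !mulrDl.
have := mulr_ge0 (normr_ge0 (K00 i j)) p1; have := mulr_ge0 (normr_ge0 (K00 i j)) p0.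
have := mulr_ge0 (normr_ge0 (K01 i j)) p1; have := mulr_ge0 (normr_ge0 (K01 i j)) p0.
have := mulr_ge0 (normr_ge0 (K10 i j)) p1; have := mulr_ge0 (normr_ge0 (K10 i j)) p0.
have := mulr_ge0 (normr_ge0 (K11 i j)) p1; have := mulr_ge0 (normr_ge0 (K11 i j)) p0.
rewrite -?/(p _) in H1 H2 *; lra.
Qed.

(** With $\eta=$ [pos_slope e (c i x)], one has $\eta c\ge c^+-e$, and $\eta g\le g^+$ because
    $0\le\eta\le1$. *)
Let comp_le (e : R) i : 0 < e ->
  (h * sigma i)^-1 * (I (fun x => w x * p (c i x)) - I (fun x => w x * p (g i x)) - e * I w) <=
  I (fun x => w x * pos_slope e (c i x) * ((h * sigma i)^-1 * (c i x - g i x))).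
Proof.
move=> e0; have hs : 0 < (h * sigma i)^-1 by rewrite invr_gt0 mulr_gt0.
have cc := AC_continuous (ACc i); have L1c := AC_L1 (ACc i).
have L1w : L1 w by exact: L1_cont (@weight_within _ C).
have L1p : L1 (fun x => w x * p (c i x)) by exact: L1_wpos.
have L1q : L1 (fun x => w x * p (g i x)) by exact: L1_wpos.
have ws : {within `[0, 1], continuous (fun x => w x * pos_slope e (c i x))}.
  apply: withinM; first exact: weight_within.
  by apply: within_comp => //; exact: pos_slope_continuous.
rewrite -IZ// -IB// -IB//; [|exact: L1B|exact: L1Z].
rewrite -IZ; last by apply: L1B; [exact: L1B|exact: L1Z].
apply: le_I.
- by apply/L1Z/L1B; [exact: L1B|exact: L1Z].
- by apply: L1M => //; apply/L1Z/L1B.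
move=> x x01.
have -> : w x * pos_slope e (c i x) * ((h * sigma i)^-1 * (c i x - g i x)) =
  (h * sigma i)^-1 * (w x * (pos_slope e (c i x) * c i x - pos_slope e (c i x) * g i x)) by ring.
rewrite ler_pM2l//.
have -> : w x * p (c i x) - w x * p (g i x) - e * w x = w x * (p (c i x) - p (g i x) - e) by ring.
rewrite ler_pM2l ?weight_gt0//.
have /andP[h1 h2] := pos_slopeM_itv e0 (c i x); have /andP[s0 s1] := pos_slope_itv e0 (c i x).
have : pos_slope e (c i x) * g i x <= p (g i x).
  apply: (@le_trans _ _ (pos_slope e (c i x) * p (g i x))).
    by rewrite ler_wpM2l// p_ge.
  by rewrite ler_piMl// p_ge0.
rewrite /p in h1 *; lra.
Qed.

Definition wnorm_pos (u : 'I_m -> R -> R) : R :=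
  \sum_i (sigma i)^-1 * I (fun x => weight C x * pospart (u i x)).

Lemma resolvent_bound : (1 - h * growth_bound) * wnorm_pos c <= wnorm_pos g.
Proof.
pose X i := I (fun x => w x * p (c i x)); pose G i := I (fun x => w x * p (g i x)).
have X0 i : 0 <= X i.
  by apply: I_ge0 => x _; rewrite mulr_ge0 ?p_ge0// ltW// weight_gt0.
have Iw0 : 0 <= I w by apply: I_ge0 => x _; rewrite ltW// weight_gt0.
pose S := \sum_i (sigma i)^-1.
have S0 : 0 <= S by apply: sumr_ge0 => i _; rewrite invr_ge0 ltW.
(* Collects the coefficients of all errors of order [e]; then [e] tends to 0. *)
pose K2 := S * I w + h * ((1 + expR C) * (2 * (m%:R * Ksum)) * (m%:R * 2) + C ^+ 2 * (m%:R * I w)).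
have K20 : 0 <= K2.
  apply: addr_ge0; first exact: mulr_ge0.
  apply: mulr_ge0; first exact: ltW.
  have E0 := expR_ge0 C.
  by apply: addr_ge0; apply: mulr_ge0; rewrite ?sqr_ge0 ?mulr_ge0 ?addr_ge0.
suff H (e : R) : 0 < e -> (1 - h * growth_bound) * wnorm_pos c <= wnorm_pos g + e * K2.
  apply/ler_addgt0Pr => e e0; have e1 : 0 < e / (K2 + 1) by rewrite divr_gt0// ltr_wpDl.
  apply: le_trans (H _ e1) _; rewrite lerD2l.
  apply: (@le_trans _ _ (e / (K2 + 1) * (K2 + 1))); first by rewrite ler_wpM2l ?lerDl// ltW.
  by rewrite divfK// gt_eqF// ltr_wpDl.
move=> e0.
have H1 : \sum_i (h * sigma i)^-1 * (X i - G i - e * I w) <=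
   (1 + expR C) * (2 * (m%:R * Ksum) * \sum_i (p (c i 1) + p (c i 0) + 2 * e))
   - C * (expR C - 1) * (\sum_i (p (c i 1) + p (c i 0)))
   + C ^+ 2 * (\sum_i X i + m%:R * (e * I w)).
  apply: (@le_trans _ _ (\sum_i ((1 + expR C) * (pos_slope e (c i 1) * d i 1 - pos_slope e (c i 0) * d i 0)
    - C * (expR C - 1) * (p (c i 1) + p (c i 0)) + C ^+ 2 * (X i + e * I w)))).
    apply: ler_sum => i _; apply: le_trans (comp_le i e0) _.
    exact: kato.
  rewrite big_split/= [X in X + _ <= _]big_split/= sumrN -!mulr_sumr.
  have -> : \sum_i (X i + e * I w) = \sum_i X i + m%:R * (e * I w).
    by rewrite big_split/= sumr_const card_ord mulr_natl.
  by rewrite !lerD2r ler_pM2l ?boundary_le// addr_gt0// expR_gt0.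
rewrite big_split/= sumr_const card_ord -[(2 * e) *+ m]mulr_natl in H1.
set Y := \sum_i (p (c i 1) + p (c i 0)) in H1.
have Y0 : 0 <= Y by apply: sumr_ge0 => i _; rewrite addr_ge0// p_ge0.
have H2 := ler_wpM2r Y0 C_large.
have LE : \sum_i (h * sigma i)^-1 * (X i - G i - e * I w) =
   h^-1 * (wnorm_pos c - wnorm_pos g - S * (e * I w)).
  rewrite /wnorm_pos -!sumrB [S * _]mulr_suml -sumrB mulr_sumr; apply: eq_bigr => i _.
  by rewrite invfM /X /G /p; ring.
have XS : \sum_i X i <= (\sum_i sigma i) * wnorm_pos c.
  rewrite /wnorm_pos mulr_sumr; apply: ler_sum => i _.
  rewrite mulrA ler_peMl ?X0// ler_pdivlMr// mul1r (bigD1 i)//= lerDl sumr_ge0// => j _.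
  exact: ltW.
rewrite LE in H1; have := ler_wpM2l (sqr_ge0 C) XS => H3.
have {}H1 : wnorm_pos c - wnorm_pos g - S * (e * I w) <=
   h * ((1 + expR C) * (2 * (m%:R * Ksum)) * (m%:R * (2 * e)) + C ^+ 2 * ((\sum_i sigma i) * wnorm_pos c)
   + C ^+ 2 * (m%:R * (e * I w))).
  rewrite -ler_pdivrMl//; apply: le_trans H1 _.
  rewrite !mulrDr; rewrite !mulrA in H2 H3 *; lra.
rewrite /growth_bound -subr_ge0; rewrite -subr_ge0 in H1.
apply: le_trans H1 _; rewrite le_eqVlt; apply/orP; left; apply/eqP; rewrite /K2; ring.
Qed.
End ResolventBound.

Lemma linear_inj_surj (F : fieldType) n (f : 'rV[F]_n -> 'rV[F]_n) : linear f ->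
  (forall v, f v = 0 -> v = 0) -> forall y, exists v, f v = y.
Proof.
move=> lf inj y.
pose L : {linear 'rV[F]_n -> 'rV[F]_n} := HB.pack f (GRing.isLinear.Build _ _ _ _ _ lf).
have LE v : v *m lin1_mx L = f v by rewrite mul_rV_lin1.
have U : lin1_mx L \in unitmx.
  by rewrite -row_free_unit; apply: inj_row_free => v; rewrite LE; exact: inj.
by exists (y *m invmx (lin1_mx L)); rewrite -LE mulmxKV.
Qed.

(** * Sign and existence of solutions of the resolvent equation *)

Section Resolvent.
#[local] Existing Instance ae_mu_filter.
Context (R : realType).
Implicit Types (f : R -> R).

(** Variation of constants: $p(x)=-q^{-1}\int_0^x\sinh(q(x-t))f(t)\,dt$, with the hyperbolic sine
    split into exponentials so that [ACM] applies. *)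
Lemma ode_particular (q : R) f : 0 < q -> L1 f ->
  exists p p1, AC p p1 /\ AC p1 (fun x => q ^+ 2 * p x - f x).
Proof.
move=> q0 L1f.
have AE := AC_expRZ q; have AE' := AC_expRZ (- q).
have L1a : L1 (fun x => expR (- q * x) * f x) by apply: L1M => //; exact: expRZ_within.
have L1b : L1 (fun x => expR (q * x) * f x) by apply: L1M => //; exact: expRZ_within.
have A1 := ACM AE (AC_prim L1a); have A2 := ACM AE' (AC_prim L1b).
exists (fun x => - (2 * q)^-1 * (expR (q * x) * prim (fun x => expR (- q * x) * f x) x
    - expR (- q * x) * prim (fun x => expR (q * x) * f x) x)).
exists (fun x => - 2^-1 * (expR (q * x) * prim (fun x => expR (- q * x) * f x) x
    + expR (- q * x) * prim (fun x => expR (q * x) * f x) x)).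
have q_neq0 : q != 0 by rewrite gt_eqF.
have EE x : expR (q * x) * expR (- q * x) = 1.
  by rewrite -expRD mulNr subrr expR0.
split.
  apply: AC_eq (ACZ (- (2 * q)^-1) (ACB A1 A2)) => // x _.
  rewrite !mulrA [expR (- q * x) * expR (q * x)]mulrC EE.
  by field.
apply: AC_eq (ACZ (- 2^-1) (ACD A1 A2)) => // x _.
rewrite !mulrA [expR (- q * x) * expR (q * x)]mulrC EE.
by field.
Qed.

Context (m : nat) (sigma : 'I_m -> R) (K00 K01 K10 K11 : 'M[R]_m).
Hypothesis sigma_gt0 : forall i, 0 < sigma i.
Hypothesis K_diag : forall i j : 'I_m, i != j -> 0 <= (- K00) i j /\ 0 <= K11 i j.
Hypothesis K_off : forall i j : 'I_m, 0 <= (- K01) i j /\ 0 <= K10 i j.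
Local Notation w := (growth_bound sigma K00 K01 K10 K11).
Local Notation C := (growth_exp K00 K01 K10 K11).
Local Notation wnp := (wnorm_pos sigma K00 K01 K10 K11).
Variable h : R.
Hypothesis h_gt0 : 0 < h.
Hypothesis h_small : h * w < 1.

Lemma wnorm_pos_le0 (u : 'I_m -> R -> R) : (forall i, L1 (u i)) -> wnp u <= 0 ->
  forall i, {ae (@lebesgue_measure R), forall x, x \in `[0, 1] -> u i x <= 0}.
Proof.
move=> L1u u0 i.
have ge0 j : 0 <= (sigma j)^-1 * I (fun x => weight C x * pospart (u j x)).
  rewrite mulr_ge0 ?invr_ge0 ?(ltW (sigma_gt0 j))// I_ge0// => x _.
  by rewrite mulr_ge0 ?(ltW (weight_gt0 _ _))// le_max lexx orbT.
have /eqP : wnp u = 0 by apply/eqP; rewrite eq_le u0 sumr_ge0.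
rewrite psumr_eq0// => /allP/(_ i (mem_index_enum _))/eqP/eqP.
rewrite mulf_eq0 invr_eq0 gt_eqF//= => /eqP Ii.
have L1i := L1_wpos C (L1u i).
have : I (fun x => `|weight C x * pospart (u i x)|) = 0.
  rewrite -[RHS]Ii; apply: eq_I => x _; rewrite ger0_norm// mulr_ge0 ?(ltW (weight_gt0 _ _))//.
  by rewrite le_max lexx orbT.
move/(I_eq0_ae L1i); apply: filterS => x H x01.
move/eqP : (H x01); rewrite mulf_eq0 gt_eqF ?weight_gt0//= => /eqP <-.
by rewrite le_max lexx.
Qed.

Lemma wnorm_pos0 (u : 'I_m -> R -> R) :
  (forall i, {ae (@lebesgue_measure R), forall x, x \in `[0, 1] -> u i x <= 0}) ->
  (forall i, L1 (u i)) -> wnp u = 0.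
Proof.
move=> u0 L1u; rewrite /wnorm_pos big1// => i _.
rewrite (@ae_eq_I _ _ (fun=> 0)) ?I_cst ?mulr0//; [exact: L1_wpos|exact: L1_cst|].
apply: filterS (u0 i) => x H x01; rewrite /pospart max_r ?mulr0//; exact: H.
Qed.

(** With $g^+=0$ the bound leaves $(1-hw)N(c^+)\le0$, and the first factor is positive. *)
Lemma resolvent_le0 (c d g : 'I_m -> R -> R) :
  (forall i, AC (c i) (d i)) ->
  (forall i, AC (d i) (fun x => (h * sigma i)^-1 * (c i x - g i x))) ->
  (forall i, L1 (g i)) -> boundary K00 K01 K10 K11 c d ->
  (forall i, {ae (@lebesgue_measure R), forall x, x \in `[0, 1] -> g i x <= 0}) ->
  (forall i, {ae (@lebesgue_measure R), forall x, x \in `[0, 1] -> c i x <= 0}).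
Proof.
move=> ACc ACd L1g bc g0; apply: wnorm_pos_le0; first by move=> i; exact: AC_L1 (ACc i).
have := resolvent_bound sigma_gt0 K_diag K_off h_gt0 ACc ACd L1g bc.
rewrite (wnorm_pos0 g0 L1g) pmulr_rle0//; by rewrite subr_gt0.
Qed.

Let q i := Num.sqrt (h * sigma i)^-1.
Let q_gt0 i : 0 < q i. Proof. by rewrite sqrtr_gt0 invr_gt0 mulr_gt0. Qed.
Let q2 i : q i ^+ 2 = (h * sigma i)^-1.
Proof. by rewrite sqr_sqrtr// invr_ge0 ltW// mulr_gt0. Qed.

Let hom (z : 'rV[R]_(m + m)) (i : 'I_m) (x : R) : R :=
  z 0 (lshift m i) * expR (q i * x) + z 0 (rshift m i) * expR (- q i * x).
Let dhom (z : 'rV[R]_(m + m)) (i : 'I_m) (x : R) : R :=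
  z 0 (lshift m i) * (q i * expR (q i * x)) + z 0 (rshift m i) * (- q i * expR (- q i * x)).

Let AC_hom z i : AC (hom z i) (dhom z i).
Proof. by apply: ACD; apply: ACZ; exact: AC_expRZ. Qed.

Let AC_dhom z i : AC (dhom z i) (fun x => (q i) ^+ 2 * hom z i x).
Proof.
have A := ACD (ACZ (z 0 (lshift m i) * q i) (AC_expRZ (q i)))
  (ACZ (- z 0 (rshift m i) * q i) (AC_expRZ (- q i))).
by apply: AC_eq A => x _; rewrite ?/dhom ?/hom; ring.
Qed.

(* The defect in the boundary condition. *)
Let res (c d : 'I_m -> R -> R) : 'rV[R]_(m + m) := row_mx
  (\row_i (d i 0 - (\sum_j K00 i j * c j 0 + \sum_j K01 i j * c j 1)))
  (\row_i (d i 1 - (\sum_j K10 i j * c j 0 + \sum_j K11 i j * c j 1))).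

Let resP c d : res c d = 0 <-> boundary K00 K01 K10 K11 c d.
Proof.
split=> [/eqP|bc]; last first.
  apply/eqP; rewrite row_mx_eq0; apply/andP; split; apply/eqP/rowP => i; rewrite !mxE;
  by have [h1 h2] := bc i; rewrite ?h1 ?h2 subrr.
rewrite row_mx_eq0 => /andP[/eqP/rowP h1 /eqP/rowP h2] i.
by have := h1 i; have := h2 i; rewrite !mxE => /eqP; rewrite subr_eq0 => /eqP -> /eqP;
  rewrite subr_eq0 => /eqP ->.
Qed.

Let res_lin a c d c' d' :
  res (fun i x => a * c i x + c' i x) (fun i x => a * d i x + d' i x) = a *: res c d + res c' d'.
Proof.
have sumE (K : 'M[R]_m) i x : \sum_j K i j * (a * c j x + c' j x) =
    a * \sum_j K i j * c j x + \sum_j K i j * c' j x.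
  by rewrite mulr_sumr -big_split; apply: eq_bigr => j _ /=; ring.
rewrite /res scale_row_mx add_row_mx; congr row_mx; apply/rowP => i; rewrite !mxE !sumE; ring.
Qed.

Let homE a z z' : hom (a *: z + z') = (fun i x => a * hom z i x + hom z' i x).
Proof. by apply/funext => i; apply/funext => x; rewrite /hom !mxE; ring. Qed.

Let dhomE a z z' : dhom (a *: z + z') = (fun i x => a * dhom z i x + dhom z' i x).
Proof. by apply/funext => i; apply/funext => x; rewrite /dhom !mxE; ring. Qed.

Let in0 : (0 : R) \in `[0, 1]. Proof. by rewrite in_itv/= lexx ler01. Qed.
Let in1 : (1 : R) \in `[0, 1]. Proof. by rewrite in_itv/= lexx ler01. Qed.

Let hom_le0 z : res (hom z) (dhom z) = 0 ->
  forall i, {ae (@lebesgue_measure R), forall x, x \in `[0, 1] -> hom z i x <= 0}.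
Proof.
move=> /resP bc; apply: (@resolvent_le0 (hom z) (dhom z) (fun _ _ => 0)) => //.
- move=> i; apply: AC_eq (AC_dhom z i) => // x _; by rewrite q2 subr0.
- by move=> i; exact: L1_cst.
- by move=> i; exact: aeW.
Qed.

Let hom_inj z : res (hom z) (dhom z) = 0 -> z = 0.
Proof.
move=> z0; have h1 := hom_le0 z0.
have h2 : forall i, {ae (@lebesgue_measure R), forall x, x \in `[0, 1] -> hom (- z) i x <= 0}.
  apply: hom_le0; rewrite -[- z]addr0 -scaleN1r homE dhomE res_lin z0 scaler0 add0r.
  apply/resP => i; rewrite /hom /dhom !mxE.
  by split; rewrite !mul0r addr0 !big1 ?addr0// => j _; rewrite !mxE !mul0r addr0 mulr0.
have hom0 i : {in `[0, 1], hom z i =1 (fun=> 0)}.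
  apply: continuous_ae_eq.
  - exact: AC_continuous (AC_hom z i).
  - by move=> x; exact: cvg_cst.
  - have {}h1 := h1 i; have {}h2 := h2 i; apply: filterS2 h1 h2 => x h1 h2 x01.
    apply/eqP; rewrite eq_le h1//=; have := h2 x01.
    by rewrite /hom !mxE !mulNr -opprD oppr_le0.
(* The values at 0 and 1 determine both coefficients, because $e^q\ne e^{-q}$ for $q>0$. *)
have ab i : z 0 (lshift m i) = 0 /\ z 0 (rshift m i) = 0.
  have := hom0 i 0 in0; rewrite /hom !mulr0 expR0 !mulr1 => /eqP; rewrite addr_eq0 => /eqP za.
  have := hom0 i 1 in1; rewrite /hom za !mulr1 mulNr addrC -mulrBr => /eqP.
  rewrite mulf_eq0 subr_eq0 => /orP[/eqP zb|/eqP/expR_inj E].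
    by rewrite zb oppr0.
  by exfalso; have := q_gt0 i; lra.
apply/rowP => k; rewrite mxE; case: (split_ordP k) => j ->; by have [] := ab j.
Qed.

Lemma resolvent_exists (g : 'I_m -> R -> R) : (forall i, L1 (g i)) ->
  exists c d, [/\ forall i, AC (c i) (d i),
    forall i, AC (d i) (fun x => (h * sigma i)^-1 * (c i x - g i x)) &
    boundary K00 K01 K10 K11 c d].
Proof.
move=> L1g.
have /choice[p /choice[p1 pP]] : forall i, exists p, exists p1 : R -> R,
    AC p p1 /\ AC p1 (fun x => (q i) ^+ 2 * p x - (h * sigma i)^-1 * g i x).
  by move=> i; apply: ode_particular => //; exact: L1Z.
have F_lin : linear (fun z => res (hom z) (dhom z)).
  by move=> a z z'; rewrite homE dhomE res_lin.
have [z zE] := linear_inj_surj F_lin hom_inj (- res p p1).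
exists (fun i x => 1 * hom z i x + p i x), (fun i x => 1 * dhom z i x + p1 i x); split.
- by move=> i; apply: ACD; [apply: ACZ; exact: AC_hom|have [] := pP i].
- move=> i; apply: AC_eq (ACD (ACZ 1 (AC_dhom z i)) (pP i).2) => // x _.
  by rewrite -q2; ring.
- by apply/resP; rewrite res_lin scale1r zE addNr.
Qed.

End Resolvent.

(** * Density of functions with vanishing boundary data *)

Section Density.
Context (R : realType).
Notation mu := (@lebesgue_measure R).
#[local] Existing Instance ae_mu_filter.
Implicit Types (f g c d : R -> R).

Let mI : measurable (`[0, 1] : set (measurableTypeR R)).
Proof. exact: measurable_itv. Qed.

Lemma AC_exp n c d : AC c d -> AC (fun x => c x ^+ n.+1) (fun x => n.+1%:R * c x ^+ n * d x).
Proof.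
move=> ACc; elim: n => [|n IH].
  by apply: (AC_eq _ _ ACc) => x _ /=; rewrite ?expr1 ?expr0 ?mulr1 ?mul1r.
apply: (AC_eq _ _ (ACM ACc IH)) => x _ /=; first by rewrite -exprS.
by rewrite -[n.+2%:R]natr1 [c x ^+ n.+1]exprS; ring.
Qed.

Lemma AC_id : AC (fun x : R => x) (fun=> 1).
Proof.
apply: AC_C1.
- by apply: continuous_subspaceT => x; exact: cvg_id.
- by apply: continuous_subspaceT => x; exact: cvg_cst.
Qed.

(** Averages of [g] over $[x,x+h]$ are differentiable and, by the mean value theorem, are values of
    [g] near [x]. This gives pointwise convergence and a common bound. *)
Lemma steklov_approximation g (e : R) : continuous g -> 0 < e ->
  exists c d, [/\ AC c d, continuous d & I (fun x => `|g x - c x|) <= e].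
Proof.
move=> cg e0.
(* The base point -1 makes [G] differentiable at 0 as well. *)
pose G x := \int[mu]_(t in `[-1, x]) g t.
have DG (x : R) : -1 < x -> is_derive x 1 G (g x).
  move=> x1; have ig : mu.-integrable `[-1, x + 1] (EFin \o g).
    apply: continuous_compact_integrable; first exact: segment_compact.
    exact: continuous_subspaceT.
  have [D E] := @continuous_FTC1_closed R g (-1) x (x + 1) ltac:(by rewrite ltrDl) ig x1 (cg x).
  by apply: DeriveDef => //; rewrite -derive1E.
have cG (x : R) : -1 < x -> {for x, continuous G}.
  move=> x1; apply/differentiable_continuous/derivable1_diffP.
  by have [] := DG x x1.
have DGh (h x : R) : 0 < h -> -1 < x -> is_derive x 1 (fun y => G (y + h)) (g (x + h)).
  move=> h0 x1.
  have D1 : is_derive x 1 (fun y : R => y + h) 1.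
    by have := is_deriveD (is_derive_id x 1) (is_derive_cst h x 1); rewrite addr0.
  have := @is_derive1_comp _ G (fun y => y + h) x _ _ (DG (x + h) _) D1.
  by rewrite mulr1; apply; rewrite ltr_wpDr// ltW.
pose h n : R := n.+1%:R^-1.
have h_gt0 n : 0 < h n by rewrite invr_gt0.
have h_le1 n : h n <= 1 by rewrite invf_le1// ler1n.
pose c n x := (h n)^-1 * (G (x + h n) - G x).
pose d n x := (h n)^-1 * (g (x + h n) - g x).
have cshift (k : R) : continuous (fun x : R => g (x + k)).
  move=> x; apply: continuous_comp; last exact: cg.
  by apply: cvgD; [exact: cvg_id|exact: cvg_cst].
have cd n : continuous (d n).
  by move=> x; apply: cvgM; [exact: cvg_cst|apply: cvgB; [exact: cshift|exact: cg]].
have Dc n (x : R) : -1 < x -> is_derive x 1 (c n) (d n x).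
  move=> x1; have := is_deriveZ (h n)^-1 (is_deriveB (DGh _ _ (h_gt0 n) x1) (DG _ x1)).
  exact.
have gt_m1 x : x \in `[0, 1] -> -1 < x :> R.
  by move=> x01; rewrite (lt_le_trans (_ : -1 < 0)) ?(itvP x01)// ltrN10.
have ccn n : {within `[0, 1], continuous (c n)}.
  apply: continuous_in_subspaceT => x; rewrite inE/= => x01.
  apply/differentiable_continuous/derivable1_diffP.
  by have [] := Dc n x (gt_m1 _ x01).
have ACc n : AC (c n) (d n).
  have cdn : {within `[0, 1], continuous (d n)} by apply: continuous_subspaceT; exact: cd.
  apply: (AC_C1 (@ccn n) cdn) => x x01; apply: Dc; apply: gt_m1.
  exact: subset_itv_oo_cc.
have mvt n x : x \in `[0, 1] -> exists2 y, x <= y <= x + h n & c n x = g y.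
  move=> x01; have xh : x < x + h n by rewrite ltrDl.
  have x_gt := gt_m1 _ x01.
  have D (t : R) : t \in `]x, x + h n[ -> is_derive t 1 G (g t).
    by rewrite in_itv/= => /andP[xt _]; apply: DG; exact: lt_trans xt.
  have cGx : {within `[x, x + h n], continuous G}.
    apply: continuous_in_subspaceT => t; rewrite inE/= in_itv/= => /andP[xt _].
    by apply: cG; exact: lt_le_trans xt.
  have [y] := MVT xh D cGx.
  rewrite in_itv/= => /andP[h1 h2] E; exists y; first by rewrite !ltW.
  by rewrite /c E addrAC subrr add0r mulrC mulfK// gt_eqF.
(* The mean value points lie in $[x,x+h]$ with $h\le1$, hence in $[0,2]$. *)
have [M M0 HM] : exists2 M, 0 < M & forall x, x \in `[0, 2] -> `|g x| <= M.
  have cI : compact (`[0, 2] : set R) by exact: segment_compact.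
  have /compact_bounded[M [_ HM]] := continuous_compact (continuous_subspaceT cg) cI.
  exists (`|M| + 1); first by rewrite ltr_wpDl.
  by move=> x x02; apply: HM; [rewrite ltr_pwDr// ler_norm|exists x].
have mc n : measurable_fun (`[0%R, 1%R]%classic : set (measurableTypeR R)) (EFin \o c n).
  by apply/measurable_EFinP; apply: L1_measurable; exact: AC_L1 (ACc n).
have mg : measurable_fun (`[0%R, 1%R]%classic : set (measurableTypeR R)) (EFin \o g).
  by apply/measurable_EFinP; apply: L1_measurable; apply: L1_cont; exact: continuous_subspaceT.
have cvg_c : {ae mu, forall x, (`[0%R, 1%R]%classic : set (measurableTypeR R)) x ->
    ((EFin \o c n) x @[n --> \oo] --> (EFin \o g) x)%E}.
  apply: aeW => x x01; apply: cvg_EFin; first exact: nearW.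
  apply/cvgrPdist_le => eta eta0.
  have /cvgrPdist_le/(_ eta eta0) := cg x; move=> /nbhs_ballP[del /= del0 Hdel].
  near=> n; rewrite /=; have [y /andP[y1 y2] ->] := mvt n x x01.
  apply: Hdel; rewrite -ball_normE/= distrC ger0_norm ?subr_ge0//.
  rewrite ltrBlDl (le_lt_trans y2)// ltrD2l.
  near: n.
  have : (fun n => h n) n @[n --> \oo] --> (0 : R) by exact: cvg_harmonic.
  move=> /cvgrPdist_lt/(_ _ del0); apply: filterS => n.
  by rewrite sub0r normrN gtr0_norm.
have iM : mu.-integrable (`[0%R, 1%R]%classic : set (measurableTypeR R)) (EFin \o cst M).
  exact: L1_cst.
have dom : {ae mu, forall x, forall n, (`[0%R, 1%R]%classic : set (measurableTypeR R)) x ->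
    (`|(EFin \o c n) x| <= (EFin \o cst M) x)%E}.
  apply: aeW => x n x01; rewrite /= lee_fin; have [y /andP[y1 y2] ->] := mvt n x x01.
  apply: HM; have := h_le1 n; move: x01; rewrite /= !in_itv/= => /andP[a1 a2] a3.
  by apply/andP; split; lra.
have [_ cvg0 _] := dominated_convergence mI mc mg cvg_c iM dom.
have /cvgrPdist_le /(_ _ e0)[n _ /(_ n (leqnn _))] := fine_cvg (FF := eventually_filter) cvg0.
rewrite sub0r normrN => H; exists (c n), (d n); split => //.
apply: le_trans (le_trans (ler_norm _) H).
rewrite le_eqVlt; apply/orP; left; apply/eqP; rewrite /I /Rintegral/=; congr fine.
by apply: eq_integral => x _; rewrite distrC.
Unshelve. all: by end_near. Qed.

Let in0 : (0 : R) \in `[0, 1]. Proof. by rewrite in_itv/= lexx ler01. Qed.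
Let in1 : (1 : R) \in `[0, 1]. Proof. by rewrite in_itv/= lexx ler01. Qed.

Let I_triangle f g k : L1 f -> L1 g -> L1 k ->
  I (fun x => `|f x - k x|) <= I (fun x => `|f x - g x|) + I (fun x => `|g x - k x|).
Proof.
move=> L1f L1g L1k; rewrite -ID; [|exact/L1_abs/L1B..].
apply: le_I; [exact/L1_abs/L1B|by apply: L1D; exact/L1_abs/L1B|].
by move=> x _; rewrite -[f x - k x](subrKA (g x)) ler_normD.
Qed.

(** The derivative of a first approximation is itself approximated and integrated back: on the unit
    interval a primitive is bounded by the $L_1$ norm of its density. *)
Lemma L1_approx_C1 f (e : R) : L1 f -> 0 < e ->
  exists c d k, [/\ AC c d, AC d k & I (fun x => `|f x - c x|) <= e].
Proof.
move=> L1f e0; have e3 : 0 < e / 3 by rewrite divr_gt0.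
have [g cg fg] := L1_approx L1f e3.
have [c1 [d1 [AC1 cd1 gc1]]] := steklov_approximation cg e3.
have [k1 [k2 [ACk ck2 dk]]] := steklov_approximation cd1 e3.
have L1d1 : L1 d1 by case: AC1.
have L1k1 := AC_L1 ACk; have L1g : L1 g by apply: L1_cont; exact: continuous_subspaceT.
pose c2 x := c1 0 + prim k1 x.
have AC2 : AC c2 k1 by split => // x _; rewrite /c2 prim0; ring.
exists c2, k1, k2; split => //.
have c12 : I (fun x => `|c1 x - c2 x|) <= e / 3.
  rewrite -[leRHS]I_cst; apply: le_I; [|exact: L1_cst|].
    by apply/L1_abs/L1B; [exact: AC_L1 AC1|exact: AC_L1 AC2].
  move=> x x01; rewrite AC1.2// /c2 opprD addrACA subrr add0r -primB//.
  by apply: le_trans dk; apply: norm_prim => //; exact: L1B.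
have := I_triangle L1f L1g (AC_L1 AC1).
have := I_triangle L1f (AC_L1 AC1) (AC_L1 AC2).
lra.
Qed.

(* A cut-off vanishing at both end points. *)
Let cut n x : R := 1 - (1 - 2 * x) ^+ (n.+1 + n.+1).
Let dcut n x : R := 2 * (n.+1 + n.+1)%:R * (1 - 2 * x) ^+ (n.+1 + n).

Let AC_aff : AC (fun x : R => 1 - 2 * x) (fun=> -2).
Proof.
by apply: AC_eq (ACB (AC_cst 1) (ACZ 2 AC_id)) => // x _; rewrite mulr1 sub0r.
Qed.

Let AC_cut n : AC (cut n) (dcut n).
Proof.
have := ACB (AC_cst 1) (AC_exp (n.+1 + n) AC_aff); apply: AC_eq => x _.
  by rewrite /cut addnS.
by rewrite /dcut addnS; ring.
Qed.

Let AC_dcut n : exists k, AC (dcut n) k.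
Proof.
eexists; exact: (ACZ (2 * (n.+1 + n.+1)%:R) (AC_exp (n + n) AC_aff)).
Qed.

Let I_cut n : I (fun x => 1 - cut n x) = (n.+1 + n.+1).+1%:R^-1.
Proof.
set N := (n.+1 + n.+1)%N.
have A := ACZ (- (2 * N.+1%:R)^-1) (AC_exp N AC_aff).
have := AC_I A; rewrite mulr0 subr0 mulr1 expr1n.
have -> : (1 - 2 : R) = -1 by lra.
rewrite exprS exprD -expr2 sqrr_sign mulr1 => E.
have N0 : N.+1%:R != 0 :> R by rewrite pnatr_eq0.
move: (N.+1%:R : R) N0 E => K K0 E.
have -> : K^-1 = - (2 * K)^-1 * (-1 * 1) - - (2 * K)^-1 by field.
by rewrite -E; apply: eq_I => x _; rewrite /cut -/N; field.
Qed.

Let cut_itv n x : x \in `[0, 1] -> 0 <= cut n x <= 1.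
Proof.
rewrite in_itv/= => /andP[x0 x1]; rewrite /cut addnn -mul2n exprM.
have h1 : 0 <= (1 - 2 * x) ^+ 2 by exact: sqr_ge0.
have h2 : (1 - 2 * x) ^+ 2 <= 1.
  have : 0 <= x * (1 - x) by rewrite mulr_ge0// subr_ge0.
  move=> H; rewrite -subr_ge0.
  have -> : 1 - (1 - 2 * x) ^+ 2 = 4 * (x * (1 - x)) by ring.
  exact: mulr_ge0.
by rewrite subr_ge0 exprn_ile1//= gerBl exprn_ge0.
Qed.

Let cut0 n : cut n 0 = 0. Proof. by rewrite /cut mulr0 subr0 expr1n subrr. Qed.
Let cut1 n : cut n 1 = 0.
Proof.
rewrite /cut mulr1; have -> : (1 - 2 : R) = -1 by lra.
by rewrite exprD -expr2 sqrr_sign subrr.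
Qed.

(** Multiplication by the square of the cut-off kills value and derivative at both ends, so the
    boundary conditions hold for any matrices. *)
Lemma L1_approx_C2_0 f (e : R) : L1 f -> 0 < e ->
  exists c d k, [/\ AC c d, AC d k,
    [/\ c 0 = 0, c 1 = 0, d 0 = 0 & d 1 = 0] & I (fun x => `|f x - c x|) <= e].
Proof.
move=> L1f e0; have e2 : 0 < e / 2 by rewrite divr_gt0.
have [c [d [k [ACc ACd fc]]]] := L1_approx_C1 L1f e2.
have [M M0 HM] := within_bounded (AC_continuous ACc).
(* $|c-c\,\mathrm{cut}^2|\le2M(1-\mathrm{cut})$, whose integral is $2M/(2n+3)$ by [I_cut]. *)
have [n Hn] : exists n, 2 * M * (n.+1 + n.+1).+1%:R^-1 <= e / 2.
  exists (Num.truncn (2 * M / (e / 2))).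
  rewrite ler_pdivrMr// [leRHS]mulrC -ler_pdivrMr//.
  apply: le_trans (ltW (truncnS_gt _)) _.
  by rewrite ler_nat; apply: leqW; exact: leq_addr.
have [k' ACdc] := AC_dcut n.
have A2 := ACM (AC_cut n) (AC_cut n).
have A3 := ACM ACc A2.
have A2' := ACD (ACM (AC_cut n) ACdc) (ACM (AC_cut n) ACdc).
have A2d : AC (fun x => dcut n x * cut n x + cut n x * dcut n x) (fun x => (dcut n x * dcut n x + cut n x * k' x) + (dcut n x * dcut n x + cut n x * k' x)).
  by apply: AC_eq A2' => x _; ring.
have A3d := ACD (ACM ACd A2) (ACM ACc A2d).
eexists _, _, _; split; [exact: A3|exact: A3d| |].
  by split; rewrite /= ?cut0 ?cut1; ring.
apply: le_trans (I_triangle L1f (AC_L1 ACc) (AC_L1 A3)) _; rewrite [leRHS]splitr lerD//.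
apply: le_trans Hn; rewrite -I_cut -IZ; last first.
  by apply: L1B; [exact: L1_cst|exact: AC_L1 (AC_cut n)].
apply: le_I.
- by apply/L1_abs/L1B; [exact: AC_L1 ACc|exact: AC_L1 A3].
- by apply/L1Z/L1B; [exact: L1_cst|exact: AC_L1 (AC_cut n)].
move=> x x01; have /andP[h0 h1] := cut_itv n x01.
have -> : c x - c x * (cut n x * cut n x) = c x * ((1 - cut n x) * (1 + cut n x)) by ring.
have p0 : 0 <= (1 - cut n x) * (1 + cut n x) by rewrite mulr_ge0 ?subr_ge0// addr_ge0.
have p2 : (1 - cut n x) * (1 + cut n x) <= 2 * (1 - cut n x).
  by rewrite mulrC ler_wpM2r ?subr_ge0//; lra.
rewrite normrM (ger0_norm p0).
have -> : 2 * M * (1 - cut n x) = M * (2 * (1 - cut n x)) by ring.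
by rewrite ler_pM// HM.
Qed.
End Density.

(** * Vector functions: completeness and the positive cone *)

Section VectorL1.
Context (R : realType) (m : nat).
Notation mu := (@lebesgue_measure R).
#[local] Existing Instance ae_mu_filter.
Local Notation Lsp := (LspaceType1 (muI R)).
Local Notation V := (mfold m (L1I R)).
Implicit Types u v : V.

Lemma mfoldD u v i : mfold_app (u + v) i = u i + v i. Proof. by rewrite /mfold_app ffunE. Qed.
Lemma mfoldZ a u i : mfold_app (a *: u) i = a *: u i. Proof. by rewrite /mfold_app ffunE. Qed.
Lemma mfoldB u v i : mfold_app (u - v) i = u i - v i.
Proof. by rewrite /mfold_app !ffunE. Qed.

Definition clsv (c : 'I_m -> R -> R) : V := [ffun i => cls (c i) : L1I R].

Lemma clsvE c i : clsv c i = cls (c i). Proof. by rewrite /mfold_app ffunE. Qed.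

Lemma mfold_normI u : `|u| = \sum_i I (fun x => `|(u i : Lsp) x|).
Proof. by rewrite mfold_normE; apply: eq_bigr => i _; rewrite Lspace1_normI. Qed.

Lemma mfold_app_le u i : `|u i| <= `|u|.
Proof. by rewrite mfold_normE (bigD1 i)//= lerDl sumr_ge0. Qed.

Lemma mfold_complete (x : nat -> V) :
  (forall e : R, 0 < e -> exists K, forall j k, (K <= j)%N -> (K <= k)%N ->
     `|x j - x k| <= e) ->
  exists l : V, x n @[n --> \oo] --> l.
Proof.
move=> xC.
have /choice[l Hl] : forall i, exists l : Lsp, (x n i : Lsp) @[n --> \oo] --> l.
  move=> i; apply: Lspace1_complete => e e0; have [K HK] := xC e e0; exists K => j k Kj Kk.
  by rewrite -mfoldB; apply: le_trans (mfold_app_le _ i) (HK _ _ Kj Kk).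
pose L : V := [ffun i => l i : L1I R].
have LE i : L i = l i by rewrite /mfold_app ffunE.
exists L; apply/cvgrPdist_le => e e0.
have em : 0 < e / (m%:R + 1) by rewrite divr_gt0// ltr_wpDl.
have : \forall n \near \oo, forall i, `|l i - (x n i : Lsp)| <= e / (m%:R + 1).
  apply: filter_forall => i; have /cvgrPdist_le := Hl i; exact.
apply: filterS => n Hn; rewrite mfold_normE.
apply: (@le_trans _ _ (\sum_(i < m) (e / (m%:R + 1)))).
  apply: ler_sum => i _; have := Hn i; rewrite -LE -mfoldB; exact.
rewrite sumr_const card_ord -[leLHS]mulr_natl mulrA ler_pdivrMr ?ltr_wpDl// mulrC.
by rewrite ler_pM2l// lerDl.
Qed.

Lemma nonnegP u : nonneg u <->
  forall i, {ae mu, forall x, x \in `[0, 1] -> 0 <= (u i : Lsp) x}.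
Proof. by split=> H i; have := H i; rewrite ae_muI. Qed.

Lemma I_pospart_ae f : L1 f -> I (fun x => pospart (f x)) <= 0 ->
  {ae mu, forall x, x \in `[0, 1] -> f x <= 0 :> R}.
Proof.
move=> L1f f0; have p0 x : 0 <= pospart (f x) by rewrite le_max lexx orbT.
have : I (fun x => `|pospart (f x)|) = 0.
  rewrite (@eq_I _ _ (fun x => pospart (f x))) => [|x _]; last by rewrite ger0_norm.
  by apply/eqP; rewrite eq_le f0 I_ge0.
move/(I_eq0_ae (L1_pospart L1f)); apply: filterS => x H x01.
by rewrite -(H x01) le_max lexx.
Qed.

(** For every nonnegative [v] the negative part of [u] is at most $|u-v|$, so its integral is
    arbitrarily small. *)
Lemma nonneg_closed : closed (@nonneg R m : set V).
Proof.
move=> u clu; apply/nonnegP => i.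
have L1u := Lspace1_L1 (u i : Lsp).
suff : {ae mu, forall x, x \in `[0, 1] -> - (u i : Lsp) x <= 0}.
  by apply: filterS => x H x01; rewrite -oppr_le0 H.
apply: I_pospart_ae; first exact: L1N.
apply/ler_addgt0Pr => e e0; rewrite add0r.
have [v [v0 uv]] := clu _ (nbhsx_ballx u e e0).
apply: le_trans (ltW (_ : `|u - v| < e)); last by rewrite -ball_normE in uv.
have := mfold_app_le (u - v) i; rewrite mfoldB Lspace1_normI => H; apply: le_trans H.
have H1 := Lspace1B_ae (u i : Lsp) (v i); have H2 := (nonnegP v).1 v0 i.
apply: le_I_ae; [exact/L1_pospart/L1N|exact/L1_abs/Lspace1_L1|].
apply: filterS2 H1 H2 => x H1 H2 x01; rewrite H1// ge_max normr_ge0 andbT distrC.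
by apply: le_trans (ler_norm _); rewrite lerDr H2.
Qed.

Lemma nonnegZ a u : 0 <= a -> nonneg u -> nonneg (a *: u).
Proof.
move=> a0 /nonnegP u0; apply/nonnegP => i; rewrite mfoldZ.
have H1 := u0 i; have H2 := Lspace1Z_ae a (u i : Lsp).
by apply: filterS2 H1 H2 => x H1 H2 x01; rewrite H2// mulr_ge0// H1.
Qed.
End VectorL1.

(** * The sign conditions imply generation *)

Section Sufficiency.
Context (R : realType) (m : nat) (sigma : 'I_m -> R) (K00 K01 K10 K11 : 'M[R]_m).
#[local] Existing Instance ae_mu_filter.
Hypothesis sigma_gt0 : forall i, 0 < sigma i.
Notation mu := (@lebesgue_measure R).
Local Notation Lsp := (LspaceType1 (muI R)).
Local Notation V := (mfold m (L1I R)).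
Local Notation A := (A_Phi sigma K00 K01 K10 K11).

Lemma A_Phi_lin (a : R) (u f v g : V) : A u f -> A v g -> A (a *: u + v) (a *: f + g).
Proof.
move=> /(A_PhiP _ _ _ _ sigma_gt0)[c [d [ACc ACd uc bc]]].
move=> /(A_PhiP _ _ _ _ sigma_gt0)[c' [d' [ACc' ACd' uc' bc']]].
apply/(A_PhiP _ _ _ _ sigma_gt0).
exists (fun i x => a * c i x + c' i x), (fun i x => a * d i x + d' i x); split.
- by move=> i; apply: ACD => //; exact: ACZ.
- move=> i; have H := ACD (ACZ a (ACd i)) (ACd' i).
  apply: AC_ae H _ _; first exact/L1Z/Lspace1_L1.
  rewrite mfoldD mfoldZ.
  have H1 := Lspace1D_ae (a *: (f i : Lsp)) (g i); have H2 := Lspace1Z_ae a (f i : Lsp).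
  apply: filterS2 H1 H2 => x H1 H2 x01; rewrite H1// H2//; ring.
- move=> i; rewrite mfoldD mfoldZ.
  have H1 := Lspace1D_ae (a *: (u i : Lsp)) (v i); have H2 := Lspace1Z_ae a (u i : Lsp).
  have H3 := uc i; have H4 := uc' i.
  have {}H2 : {ae mu, forall x, x \in `[0, 1] -> (a *: (u i : Lsp)) x = a * c i x}.
    by apply: filterS2 H2 H3 => x H2 H3 x01; rewrite H2// H3.
  by apply: filterS3 H1 H2 H4 => x H1 H2 H4 x01; rewrite H1// H2// H4.
- move=> i; have [-> ->] := bc i; have [-> ->] := bc' i.
  have sumE (K : 'M[R]_m) y : \sum_j K i j * (a * c j y + c' j y) =
      a * \sum_j K i j * c j y + \sum_j K i j * c' j y.
    by rewrite mulr_sumr -big_split; apply: eq_bigr => j _ /=; ring.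
  by rewrite !sumE; split; ring.
Qed.

Definition wnorm (u : V) : R := \sum_i (sigma i)^-1 *
  I (fun x => weight (growth_exp K00 K01 K10 K11) x * `|(u i : Lsp) x|).
Local Notation C := (growth_exp K00 K01 K10 K11).
Local Notation wnp := (wnorm_pos sigma K00 K01 K10 K11).

Let L1w (f : R -> R) : L1 f -> L1 (fun x => weight C x * f x).
Proof. by move=> L1f; exact: L1M (@weight_within R C) L1f. Qed.

Let si_ge0 i : 0 <= (sigma i)^-1. Proof. by rewrite invr_ge0 ltW. Qed.

Lemma wnormD u v : wnorm (u + v) <= wnorm u + wnorm v.
Proof.
rewrite /wnorm -big_split/=; apply: ler_sum => i _; rewrite -mulrDr ler_wpM2l//.
have L1u := Lspace1_L1 (u i : Lsp); have L1v := Lspace1_L1 (v i : Lsp).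
rewrite -ID; [|exact/L1w/L1_abs..].
apply: le_I_ae; [exact/L1w/L1_abs/Lspace1_L1|by apply: L1D; exact/L1w/L1_abs|].
rewrite mfoldD; have H := Lspace1D_ae (u i : Lsp) (v i).
by apply: filterS H => x H x01; rewrite H// -mulrDr ler_wpM2l ?ler_normD// ltW// weight_gt0.
Qed.

Lemma wnormZ a u : wnorm (a *: u) = `|a| * wnorm u.
Proof.
rewrite /wnorm mulr_sumr; apply: eq_bigr => i _; rewrite mulrCA; congr (_ * _).
have L1u := Lspace1_L1 (u i : Lsp).
rewrite -IZ; last exact/L1w/L1_abs.
apply: ae_eq_I; [exact/L1w/L1_abs/Lspace1_L1|exact/L1Z/L1w/L1_abs|].
rewrite mfoldZ; have H := Lspace1Z_ae a (u i : Lsp).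
by apply: filterS H => x H x01; rewrite H// normrM mulrCA.
Qed.

Let C_ge0 : 0 <= C.
Proof.
have K0 : 0 <= Ksum K00 K01 K10 K11.
  by apply: sumr_ge0 => i _; apply: sumr_ge0 => j _; rewrite !addr_ge0.
by rewrite /growth_exp addr_ge0// !mulr_ge0.
Qed.

(** The weight is at least 1 on the interval and $\sigma_i\le1+\sum_j\sigma_j$; the summand 1 keeps
    the constant positive even for $m=0$. *)
Lemma wnorm_ge u : (1 + \sum_i sigma i)^-1 * `|u| <= wnorm u.
Proof.
rewrite mfold_normI mulr_sumr; apply: ler_sum => i _.
have L1u := Lspace1_L1 (u i : Lsp).
apply: ler_pM.
- by rewrite invr_ge0 addr_ge0// sumr_ge0// => j _; exact: ltW.
- exact: I_ge0.
- rewrite lef_pV2 ?posrE//; last by rewrite ltr_pwDl// sumr_ge0// => j _; exact: ltW.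
  rewrite (bigD1 i)//= addrCA lerDl addr_ge0// sumr_ge0// => j _; exact: ltW.
- apply: le_I; [exact: L1_abs|exact/L1w/L1_abs|] => x; rewrite in_itv/= => /andP[x0 _].
  rewrite ler_peMl//; apply: (@le_trans _ _ (expR (C * x))).
    by rewrite -[leLHS]expR0 ler_expR mulr_ge0.
  by rewrite lerDl mulr_ge0// expR_ge0.
Qed.

Lemma wnorm_le : exists2 M, 0 <= M & forall u, wnorm u <= M * `|u|.
Proof.
have [M M0 HM] := within_bounded (@weight_within R C).
exists (M * \sum_i (sigma i)^-1); first by apply: mulr_ge0; [exact: ltW|exact: sumr_ge0].
move=> u; rewrite [M * _]mulrC -mulrA mulr_suml; apply: ler_sum => i _.
rewrite ler_wpM2l//.
have L1u := Lspace1_L1 (u i : Lsp).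
apply: (@le_trans _ _ (M * I (fun x => `|(u i : Lsp) x|))).
  rewrite -IZ; last exact: L1_abs.
  apply: le_I; [exact/L1w/L1_abs|exact/L1Z/L1_abs|] => x x01.
  by rewrite ler_wpM2r// (le_trans (ler_norm _)) ?HM.
have H : I (fun x => `|(u i : Lsp) x|) <= `|u|.
  by rewrite -Lspace1_normI; exact: mfold_app_le.
by rewrite ler_wpM2l// ltW.
Qed.

Lemma wnormE (c : 'I_m -> R -> R) (u : V) : (forall i, L1 (c i)) ->
  (forall i, {ae mu, forall x, x \in `[0, 1] -> (u i : Lsp) x = c i x}) ->
  wnorm u = wnp c + wnp (fun i x => - c i x).
Proof.
move=> L1c uc; rewrite /wnorm /wnorm_pos -big_split/=; apply: eq_bigr => i _.
rewrite -mulrDr -ID; [|exact: L1_wpos|exact/L1_wpos/L1N]; congr (_ * _).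
apply: ae_eq_I; first exact/L1w/L1_abs/Lspace1_L1.
  by apply: L1D; [exact: L1_wpos|exact/L1_wpos/L1N].
have H := uc i; apply: filterS H => x H x01; rewrite H// -mulrDr; congr (_ * _).
rewrite /pospart; case: (leP (c i x) 0) => h.
  by rewrite ler0_norm// add0r max_l// oppr_ge0.
by rewrite gtr0_norm// max_r ?addr0// oppr_le0 ltW.
Qed.

Hypothesis K_diag : forall i j : 'I_m, i != j -> 0 <= (- K00) i j /\ 0 <= K11 i j.
Hypothesis K_off : forall i j : 'I_m, 0 <= (- K01) i j /\ 0 <= K10 i j.
Local Notation w := (growth_bound sigma K00 K01 K10 K11).

Let resolvent_data (h : R) (u f : V) : 0 < h -> A u f ->
  exists c d g, [/\ forall i, AC (c i) (d i),
    forall i, AC (d i) (fun x => (h * sigma i)^-1 * (c i x - g i x)),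
    forall i, L1 (g i), boundary K00 K01 K10 K11 c d &
    (forall i, {ae mu, forall x, x \in `[0, 1] -> (u i : Lsp) x = c i x}) /\
    (forall i, {ae mu, forall x, x \in `[0, 1] -> (mfold_app (u - h *: f) i : Lsp) x = g i x})].
Proof.
move=> h0 /(A_PhiP _ _ _ _ sigma_gt0)[c [d [ACc ACd uc bc]]].
exists c, d, (fun i x => c i x - h * (f i : Lsp) x); split => //.
- move=> i; apply: (AC_eq _ _ (ACd i)) => x _ //.
  by field; rewrite !gt_eqF.
- by move=> i; apply: L1B; [exact: AC_L1 (ACc i)|exact/L1Z/Lspace1_L1].
- split=> // i; rewrite mfoldB mfoldZ.
  have H1 := Lspace1B_ae (u i : Lsp) (h *: (f i : Lsp)); have H2 := Lspace1Z_ae h (f i : Lsp).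
  have H3 := uc i.
  by apply: filterS3 H1 H2 H3 => x H1 H2 H3 x01; rewrite H1// H2// H3.
Qed.

Let AC_neg (h : R) (c d g : 'I_m -> R -> R) :
  (forall i, AC (c i) (d i)) ->
  (forall i, AC (d i) (fun x => (h * sigma i)^-1 * (c i x - g i x))) ->
  boundary K00 K01 K10 K11 c d ->
  [/\ forall i, AC (fun x => - c i x) (fun x => - d i x),
   forall i, AC (fun x => - d i x) (fun x => (h * sigma i)^-1 * (- c i x - - g i x)) &
   boundary K00 K01 K10 K11 (fun i x => - c i x) (fun i x => - d i x)].
Proof.
move=> ACc ACd bc; split.
- by move=> i; apply: (AC_eq _ _ (ACZ (-1) (ACc i))) => x _; rewrite /= mulN1r.
- by move=> i; apply: (AC_eq _ _ (ACZ (-1) (ACd i))) => x _ /=; ring.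
- move=> i; have [-> ->] := bc i; rewrite !opprD -!sumrN.
  by split; congr (_ + _); apply: eq_bigr => j _; rewrite mulrN.
Qed.

Theorem sufficiency : generates_positive_semigroup A.
Proof.
have w0 : 0 <= w by exact: growth_bound_ge0.
(* Ensures [h * w < 1] for all admissible steps, so that [1 - h * w] stays positive. *)
pose h0 := (2 * (w + 1))^-1.
have h0_gt0 : 0 < h0 by rewrite invr_gt0 mulr_gt0// ltr_wpDl.
have hw h : 0 < h <= h0 -> h * w < 1.
  move=> /andP[h1 h2]; apply: (@le_lt_trans _ _ (h0 * w)); first exact: ler_wpM2r.
  by rewrite mulrC ltr_pdivrMr ?mulr_gt0 ?ltr_wpDl// mul1r; lra.
have [M M0 HM] := wnorm_le.
have c0 : 0 < (1 + \sum_i sigma i)^-1.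
  by rewrite invr_gt0 ltr_pwDl// sumr_ge0// => i _; exact: ltW.
have diss (h : R) u f : 0 < h <= h0 -> A u f -> (1 - h * w) * wnorm u <= wnorm (u - h *: f).
  move=> hh Auf; have h_gt0 := (andP hh).1.
  have [c [d [g [ACc ACd L1g bc [uc ug]]]]] := resolvent_data h_gt0 Auf.
  have [ACc' ACd' bc'] := AC_neg ACc ACd bc.
  rewrite (wnormE (fun i => AC_L1 (ACc i)) uc) (wnormE L1g ug) mulrDr lerD//.
    exact: resolvent_bound h_gt0 ACc ACd L1g bc.
  exact: resolvent_bound h_gt0 ACc' ACd' (fun i => L1N (L1g i)) bc'.
have range (h : R) g : 0 < h <= h0 -> exists u, A u (h^-1 *: (u - g)).
  move=> hh; have h_gt0 := (andP hh).1.
  have [c [d [ACc ACd bc]]] := resolvent_exists sigma_gt0 K_diag K_off h_gt0 (hw _ hh)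
    (fun i => Lspace1_L1 (g i : Lsp)).
  have cE i : {ae mu, forall x, x \in `[0, 1] -> (clsv c i : Lsp) x = c i x}.
    by rewrite clsvE; apply: clsE; exact: AC_L1 (ACc i).
  exists (clsv c); apply/(A_PhiP _ _ _ _ sigma_gt0); exists c, d; split => // i.
  apply: AC_ae (ACd i) _ _; first exact/L1Z/Lspace1_L1.
  rewrite mfoldZ mfoldB; have H1 := Lspace1Z_ae h^-1 ((clsv c i : Lsp) - (g i : Lsp)).
  have H2 := Lspace1B_ae (clsv c i : Lsp) (g i : Lsp); have H3 := cE i.
  apply: filterS3 H1 H2 H3 => x H1 H2 H3 x01; rewrite H1// H2// H3//.
  by rewrite mulrA -invfM [sigma i * h]mulrC.
have dense u (e : R) : 0 < e -> exists v f, A v f /\ wnorm (u - v) <= e.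
  move=> e0; have em : 0 < e / (M * m%:R + 1) by rewrite divr_gt0// ltr_wpDl// mulr_ge0.
  have /choice[c /choice[d /choice[k H]]] : forall i, exists c, exists d : R -> R, exists k : R -> R,
      [/\ AC c d, AC d k,
      [/\ c 0 = 0, c 1 = 0, d 0 = 0 & d 1 = 0] &
      I (fun x => `|(u i : Lsp) x - c x|) <= e / (M * m%:R + 1)].
    by move=> i; apply: L1_approx_C2_0 => //; exact: Lspace1_L1.
  have cE i : {ae mu, forall x, x \in `[0, 1] -> (clsv c i : Lsp) x = c i x}.
    by rewrite clsvE; apply: clsE; have [A1 _ _ _] := H i; exact: AC_L1 A1.
  have kL i : L1 (k i) by have [_ [? _] _ _] := H i.
  exists (clsv c), (clsv (fun i x => sigma i * k i x)); split.
    apply/(A_PhiP _ _ _ _ sigma_gt0); exists c, d; split => //.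
    - by move=> i; have [] := H i.
    - move=> i; have [_ A2 _ _] := H i; apply: AC_ae A2 _ _; first exact/L1Z/Lspace1_L1.
      rewrite clsvE; have E := clsE (L1Z (sigma i) (kL i)).
      by apply: filterS E => x E x01; rewrite E// mulKf// gt_eqF.
    - move=> i; have [_ _ [_ _ -> ->] _] := H i.
      by rewrite !big1 ?addr0// => j _; have [_ _ [z0 z1 _ _] _] := H j; rewrite ?z0 ?z1 mulr0.
  apply: le_trans (HM _) _; rewrite mfold_normI.
  apply: (@le_trans _ _ (M * \sum_(i < m) (e / (M * m%:R + 1)))).
    rewrite ler_wpM2l//; apply: ler_sum => i _; have [A1 _ _] := H i; apply: le_trans.
    have L1u := Lspace1_L1 (u i : Lsp).
    apply: le_I_ae; [exact/L1_abs/Lspace1_L1|by apply/L1_abs/L1B => //; exact: AC_L1 A1|].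
    rewrite mfoldB; have H1 := Lspace1B_ae (u i : Lsp) (clsv c i); have H2 := cE i.
    by apply: filterS2 H1 H2 => x H1 H2 x01; rewrite H1// H2.
  rewrite sumr_const card_ord -[(e / _) *+ m]mulr_natl !mulrA.
  by rewrite ler_pdivrMr ?ltr_wpDl ?mulr_ge0// [leLHS]mulrC ler_pM2l// lerDl.
have pos (h : R) u f : 0 < h <= h0 -> A u f -> nonneg (u - h *: f) -> nonneg u.
  move=> hh Auf /nonnegP g0; have h_gt0 := (andP hh).1.
  have [c [d [g [ACc ACd L1g bc [uc ug]]]]] := resolvent_data h_gt0 Auf.
  have [ACc' ACd' bc'] := AC_neg ACc ACd bc.
  have gle i : {ae mu, forall x, x \in `[0, 1] -> - g i x <= 0}.
    have H1 := g0 i; have H2 := ug i.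
    by apply: filterS2 H1 H2 => x H1 H2 x01; rewrite oppr_le0 -H2// H1.
  have cle := resolvent_le0 sigma_gt0 K_diag K_off h_gt0 (hw _ hh) ACc' ACd'
    (fun i => L1N (L1g i)) bc' gle.
  apply/nonnegP => i; have H1 := cle i; have H2 := uc i.
  by apply: filterS2 H1 H2 => x H1 H2 x01; rewrite H2// -oppr_le0 H1.
have [T [T1 T2 T3]] := quasi_contraction_generation c0 M0 wnormD wnormZ wnorm_ge HM
  A_Phi_lin w0 h0_gt0 diss range dense (@mfold_complete R m) (@nonneg_closed R m)
  (@nonnegZ R m) pos.
by exists T.
Qed.
End Sufficiency.

(** * Necessity of the sign conditions *)

Section LocalBound.
Context (R : realType) (V : normedModType R).
Hypothesis complete : forall x : nat -> V,
  (forall e : R, 0 < e -> exists K, forall j k, (K <= j)%N -> (K <= k)%N ->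
     `|x j - x k| <= e) -> exists l : V, x n @[n --> \oo] --> l.

(** Balls of radius $1/(n+1)$ in the filter have centres that form a Cauchy sequence. This turns
    sequential completeness into the filter form that [completeNormedModType] asks for. *)
Lemma cauchy_filter_cvg (F : set_system V) : ProperFilter F -> cauchy F -> cvg F.
Proof.
move=> FF /cauchyP Fc.
have /choice[x Hx] (n : nat) : exists x : V, F (ball x (n.+1%:R^-1 : R)).
  by apply: Fc; rewrite invr_gt0.
have xd j k : `|x j - x k| < j.+1%:R^-1 + k.+1%:R^-1.
  have [y []] := filter_ex (filterI (Hx j) (Hx k)).
  rewrite -ball_normE/= => h1 h2.
  rewrite -[x j](subrK y) -addrA (le_lt_trans (ler_normD _ _))// ltrD//.
  by rewrite distrC.
have small (e : R) : 0 < e -> exists K, forall j, (K <= j)%N -> j.+1%:R^-1 <= e :> R.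
  move=> e0; have [K _ HK] := near_infty_natSinv_lt (PosNum e0).
  by exists K => j Kj; apply/ltW/HK.
have [l xl] : exists l : V, x n @[n --> \oo] --> l.
  apply: complete => e e0; have [K HK] := small _ (divr_gt0 e0 (ltr0n R 2)).
  exists K => j k Kj Kk; apply/ltW/(lt_le_trans (xd _ _)).
  by rewrite [leRHS]splitr lerD// HK.
apply/cvg_ex; exists l; apply/cvgrPdist_lt => e e0.
have [K HK] := small _ (divr_gt0 e0 (ltr0n R 2)).
have /cvgrPdist_lt/(_ _ (divr_gt0 e0 (ltr0n R 2))) [K' _ HK'] := xl.
apply: filterS (Hx (maxn K K')) => y; rewrite -ball_normE/= => xy.
rewrite -[l](subrK (x (maxn K K'))) -addrA (le_lt_trans (ler_normD _ _))//.
rewrite [ltRHS]splitr ltrD//; first by apply: HK'; rewrite /= leq_maxr.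
by apply: lt_le_trans xy (HK _ _); rewrite leq_maxl.
Qed.

Lemma linear_bounded_ball (f : V -> V) : linear f -> continuous f ->
  exists2 M, 0 <= M & forall u, `|f u| <= M * `|u|.
Proof.
move=> lf cf.
have f0 : f 0 = 0 by have := lf (-1) 0 0; rewrite scaler0 addr0 scaleN1r addNr.
have fZ a u : f (a *: u) = a *: f u by rewrite -[a *: u]addr0 lf f0 addr0.
have C : f x @[x --> 0] --> f 0 := cf 0.
move/cvgrPdist_le : C => /(_ 1 ltr01); rewrite f0 => /nbhs_ballP[d /= d0 Hd].
exists (2 / d); first by rewrite divr_ge0// ltW.
move=> u; have [->|u0] := eqVneq u 0; first by rewrite f0 !normr0 mulr0.
have un : 0 < `|u| by rewrite normr_gt0.
have [a a0 aE] : exists2 a, 0 < a & a * `|u| = d / 2.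
  by exists (d / 2 / `|u|); [rewrite !divr_gt0|rewrite divfK ?gt_eqF].
have := Hd (a *: u); rewrite -ball_normE/= !sub0r !normrN fZ !normrZ (gtr0_norm a0) aE.
move=> H; have : a * `|f u| <= 1 by apply: H; move: d0; lra.
have -> : 2 / d = (a * `|u|)^-1 by rewrite aE invfM invrK mulrC.
by rewrite invfM -mulrA mulVf ?gt_eqF// mulr1 => ?; rewrite -(ler_pM2l a0) mulfV ?gt_eqF.
Qed.

(** Otherwise there are times $t_n\to0$ such that [T (t n)] has operator norm above $n$. Strong
    continuity at 0 bounds them at each vector, which contradicts Banach-Steinhaus. *)
Theorem semigroup_locally_bounded (T : R -> V -> V) : C0_semigroup T ->
  exists d M : R, [/\ 0 < d, 0 <= M & forall t, 0 <= t <= d -> forall u, `|T t u| <= M * `|u|].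
Proof.
move=> [Tlin Tcont T0 TD TC].
pose V' : completeNormedModType R := HB.pack V (Uniform_isComplete.Build V (@cauchy_filter_cvg)).
apply: contrapT => nb.
have /choice[t Ht] (n : nat) : exists t : R, 0 <= t <= n.+1%:R^-1 /\
    exists u, `|T t u| > n%:R * `|u|.
  apply: contrapT => H; apply: nb; exists n.+1%:R^-1, n%:R; split => //.
  move=> t t0 u; rewrite leNgt; apply/negP => H'; apply: H; exists t; split => //.
  by exists u.
have tge n : 0 <= t n by have [/andP[]] := Ht n.
have bF (f : V' -> V) : (exists n, f = T (t n)) -> bounded_fun_norm f /\ linear f.
  move=> [n ->]; split; last exact: Tlin.
  have [M M0 HM] := linear_bounded_ball (Tlin _ (tge n)) (Tcont _ (tge n)).
  by move=> r; exists (M * r) => x xr; apply: le_trans (HM x) _; rewrite ler_wpM2l.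
have pF : pointwise_bounded [set f : V' -> V | exists n, f = T (t n)].
  move=> u.
  have Tu : T (t n) u @[n --> \oo] --> u.
    apply/cvgrPdist_le => e e0; have /cvgrPdist_le/(_ e e0) := TC u.
    move=> [d /= d0 Hd].
    have [K _ HK] := near_infty_natSinv_lt (PosNum d0).
    exists K => // n Kn /=; have [/andP[tn0 tn1] _] := Ht n.
    (* Continuity is assumed along times [t > 0], so a time equal to 0 is treated apart. *)
    have [->|tn] := eqVneq (t n) 0; first by rewrite T0 subrr normr0 ltW.
    apply: Hd; last by rewrite lt_neqAle eq_sym tn.
    by rewrite /ball/= sub0r normrN ger0_norm//; apply: le_lt_trans tn1 (HK _ Kn).
  have [M [Mr HM]] := cvg_seq_bounded (cvgP _ Tu).
  exists (M + 1) => f [n ->]; by apply: HM => //; rewrite ltrDl.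
have [M HM] := @Banach_Steinhauss _ V' V [set f | exists n, f = T (t n)] bF pF 1.
have [n Mn] : exists n : nat, M <= n%:R.
  by exists (Num.bound `|M|); exact: le_trans (ler_norm M) (ltW (archi_boundP (normr_ge0 M))).
have [_ [u Hu]] := Ht n.
have u0 : 0 < `|u|.
  rewrite normr_gt0; apply/eqP => u0; move: Hu; rewrite u0 normr0 mulr0.
  have := (Tlin _ (tge n)) (-1) 0 0; rewrite scaler0 addr0 scaleN1r addNr => ->.
  by rewrite normr0 ltxx.
have := HM (T (t n)) (ex_intro _ n erefl) (`|u|^-1 *: u).
rewrite normrZ normfV normr_id mulVf ?gt_eqF// lexx => /(_ isT).
have -> : T (t n) (`|u|^-1 *: u) = `|u|^-1 *: T (t n) u.
  have Z := Tlin _ (tge n).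
  have f0 : T (t n) 0 = 0 by have := Z (-1) 0 0; rewrite scaler0 addr0 scaleN1r addNr.
  by rewrite -[_ *: u]addr0 Z f0 addr0.
rewrite normrZ normfV normr_id ler_pdivrMl// => H.
by have := lt_le_trans Hu H; rewrite mulrC ltr_pM2l// ltNge Mn.
Qed.
End LocalBound.

(** * A comparison principle for semigroups preserving a closed cone *)

Section InvariantCone.
Context (R : realType) (V : normedModType R).
Variables (T : R -> V -> V) (A : V -> V -> Prop) (P : set V) (d M : R).
Hypotheses (T_C0 : C0_semigroup T) (T_gen : is_generator T A).
Hypotheses (P_closed : closed P) (P0 : P 0) (PD : forall u v, P u -> P v -> P (u + v))
  (PZ : forall a u, 0 <= a -> P u -> P (a *: u))
  (T_P : forall t u, 0 <= t -> P u -> P (T t u)).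
Hypotheses (d_gt0 : 0 < d) (M_ge0 : 0 <= M)
  (T_bound : forall t, 0 <= t <= d -> forall u, `|T t u| <= M * `|u|).

(* Telescoping: u - exp (- lam d) T(d) u is the sum over k < n of
   exp (- lam k h) T(k h) (u - exp (- lam h) T(h) u) with h = d / n, and
   u - exp (- lam h) T(h) u = h (lam u - A u) + o(h). *)
Lemma cone_discounted_decrease (lam : R) u f : A u f -> 0 <= lam -> P (lam *: u - f) ->
  P (u - expR (- (lam * d)) *: T d u).
Proof.
have [Tlin _ T0 TD _] := T_C0; move=> Auf lam0 Pg; set g := lam *: u - f in Pg.
have TB t x y : 0 <= t -> T t (x - y) = T t x - T t y.
  by move=> t0; rewrite addrC -scaleN1r (Tlin _ t0) scaleN1r addrC.
have Tz t : 0 <= t -> T t 0 = 0 by move=> t0; have := TB t 0 0 t0; rewrite !subrr.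
have TZ t a x : 0 <= t -> T t (a *: x) = a *: T t x.
  by move=> t0; rewrite -[a *: x]addr0 (Tlin _ t0) Tz// addr0.
have slope : h^-1 *: (u - expR (- lam * h) *: T h u) @[h --> 0^'+] --> g.
  have -> : g = - (f + (- lam) *: u) by rewrite scaleNr opprD opprK addrC.
  have -> : (fun h => h^-1 *: (u - expR (- lam * h) *: T h u)) =
      (fun h => - (h^-1 *: (expR (- lam * h) *: T h u - u))).
    by apply/funext => h; rewrite -[RHS]scalerN opprB.
  by apply: cvgN; apply: cvg_expR_twist; exact: (T_gen u f).1.
clearbody g; rewrite (_ : P = closure P); last by apply/seteqP; split; [exact: subset_closure|exact: P_closed].
move=> B /nbhs_ballP[e /= e0 HB].
pose e' := e / (d * M + 1); have e'0 : 0 < e' by rewrite divr_gt0// ltr_wpDl// mulr_ge0// ltW.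
move/cvgrPdist_le : slope => /(_ e' e'0)[r /= r0 Hr].
have [n nE] : exists n : nat, d * n.+1%:R^-1 < r.
  have [n _ Hn] := near_infty_natSinv_lt (PosNum (divr_gt0 r0 d_gt0)).
  by exists n; have := Hn n (leqnn n); rewrite /= ltr_pdivlMr// mulrC.
pose h := d * n.+1%:R^-1; have h0 : 0 < h by rewrite mulr_gt0// invr_gt0.
have hr : `|(u - expR (- lam * h) *: T h u) - h *: g| <= e' * h.
  have := Hr h; rewrite /ball/= sub0r normrN gtr0_norm// => /(_ nE h0) H.
  have -> : (u - expR (- lam * h) *: T h u) - h *: g =
      - (h *: (g - h^-1 *: (u - expR (- lam * h) *: T h u))).
    by rewrite scalerBr scalerA mulfV ?gt_eqF// scale1r opprB.
  by rewrite normrN normrZ gtr0_norm// mulrC ler_pM2r.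
pose S k := u - expR (- lam * (k%:R * h)) *: T (k%:R * h) u.
(* [p] adds up the main terms $E\,T(kh)(hg)$, which lie in the cone. Each step adds an error of at
   most $Me'h$, in total $dMe'<e$. *)
have step k : (k <= n.+1)%N -> exists2 p, P p & `|S k - p| <= k%:R * (M * (e' * h)).
  elim: k => [_|k IH kn].
    by exists 0 => //; rewrite /S !mul0r mulr0 expR0 T0 scale1r subrr subr0 normr0.
  have [p Pp Hp] := IH (ltnW kn).
  have kh0 : 0 <= k%:R * h by rewrite mulr_ge0// ltW.
  have khd : 0 <= k%:R * h <= d.
    rewrite kh0 /h mulrCA ler_piMr ?(ltW d_gt0)// ler_pdivrMr// mul1r ler_nat; exact: ltnW.
  pose E := expR (- lam * (k%:R * h)).
  have E0 : 0 <= E by exact: expR_ge0.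
  have E1 : E <= 1 by rewrite -expR0 ler_expR mulNr oppr_le0 mulr_ge0.
  exists (p + E *: T (k%:R * h) (h *: g)).
    by apply: PD => //; apply: PZ => //; apply: T_P => //; apply: PZ => //; exact: ltW.
  have -> : S k.+1 - (p + E *: T (k%:R * h) (h *: g)) =
     (S k - p) + E *: T (k%:R * h) ((u - expR (- lam * h) *: T h u) - h *: g).
    rewrite !TB// [T _ (expR _ *: _)]TZ//.
    have -> : S k.+1 = u - (E * expR (- lam * h)) *: T (k%:R * h) (T h u).
      rewrite -TD ?(ltW h0)// /S /E -expRD -mulrDr.
      by have -> : k.+1%:R * h = k%:R * h + h by rewrite -natr1 mulrDl mul1r.
    by rewrite /S -/E; move: E (expR (- lam * h)) {E0 E1} => E F; module_eq R V; ring.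
  apply: le_trans (ler_normD _ _) _; rewrite -natr1 mulrDl mul1r lerD//.
  rewrite normrZ ger0_norm//; apply: le_trans (ler_piMl (normr_ge0 _) E1) _.
  by apply: le_trans (T_bound khd _) _; rewrite ler_wpM2l.
have [p Pp Hp] := step n.+1 (leqnn _).
have nh : n.+1%:R * h = d by rewrite /h mulrCA mulfV ?mulr1 ?pnatr_eq0.
exists p; split => //; apply: HB; rewrite -ball_normE/=.
move: Hp; rewrite /S nh mulNr => Hp; apply: le_lt_trans Hp _.
have -> : n.+1%:R * (M * (e' * h)) = (d * M) * e' by rewrite -nh; ring.
have dM : 0 < d * M + 1 by rewrite ltr_wpDl// mulr_ge0// ltW.
by rewrite -[ltRHS](divfK (lt0r_neq0 dM)) mulrC ltr_pM2l// ltrDl.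
Qed.
End InvariantCone.

(** * Polynomials with prescribed values and derivatives at the end points *)

Section Polynomials.
Context (R : realType).
Implicit Types (p q : {poly R}).

Lemma AC_poly p : AC (fun x => p.[x]) (fun x => p^`().[x]).
Proof.
elim/poly_ind: p => [|p c IH].
  by apply: (AC_eq _ _ (AC_cst 0)) => x _; rewrite ?deriv0 horner0.
apply: (AC_eq _ _ (ACD (ACM IH (@AC_id R)) (AC_cst c))) => x _.
  by rewrite hornerD hornerC hornerMX.
by rewrite derivMXaddC hornerD hornerMX mulr1 addr0 addrC.
Qed.

Lemma poly_bounded p : exists2 C, 0 <= C & forall x, 0 <= x <= 1 -> `|p.[x]| <= C.
Proof.
elim/poly_ind: p => [|p c [C C0 HC]].
  by exists 0 => // x _; rewrite horner0 normr0.
exists (C + `|c|); first by rewrite addr_ge0.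
move=> x /[dup] x01 /andP[x0 x1]; rewrite hornerD hornerC hornerMX.
apply: le_trans (ler_normD _ _) _; rewrite lerD2r normrM (ger0_norm x0).
by rewrite -[leRHS]mulr1 ler_pM// HC.
Qed.

Lemma poly_root0_bounded p : p.[0] = 0 ->
  exists2 C, 0 <= C & forall x, 0 <= x <= 1 -> `|p.[x]| <= C * x.
Proof.
move=> /rootP/factor_theorem[q ->]; have [C C0 HC] := poly_bounded q.
exists C => // x /[dup] x01 /andP[x0 _].
by rewrite subr0 hornerMX normrM (ger0_norm x0) ler_wpM2r// HC.
Qed.

Section Hermite.
Variable n : nat.

(** [H] rises from 0 to 1 with flat ends. [Bl] has derivative 1 at 0 and [Br] derivative -1 at 1;
    their other end values and end derivatives vanish. *)
Let H : {poly R} := 3 *: 'X^2 - 2 *: 'X^3.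
Let Bl : {poly R} := 'X * (1 - 'X) ^+ n.+2.
Let Br : {poly R} := (1 - 'X) * 'X^(n.+2).

(* Values s0, s1 and outward derivatives d0, d1 at the end points; for n large
   the derivatives are corrected at the cost of a small change of the values. *)
Definition herm (s0 s1 d0 d1 : R) : {poly R} :=
  s0%:P + (s1 - s0) *: H - d0 *: Bl - d1 *: Br.

Let hE := (hornerMn, hornerXn, horner_exp, hornerC, hornerX, hornerD, hornerN, hornerZ, hornerM).

Let derivH x : H^`().[x] = 6 * (x - x ^+ 2).
Proof. by rewrite /H derivB !derivZ !derivXn /= !hE; ring. Qed.

Let derivBl x : Bl^`().[x] = (1 - x) ^+ n.+2 - n.+2%:R * (x * (1 - x) ^+ n.+1).
Proof.
rewrite /Bl derivM derivX mul1r deriv_exp derivB derivC derivX sub0r !hE.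
by rewrite -[_ *+ n.+2]mulr_natl; ring.
Qed.

Let derivBr x : Br^`().[x] = n.+2%:R * ((1 - x) * x ^+ n.+1) - x ^+ n.+2.
Proof.
rewrite /Br derivM derivXn derivB derivC derivX sub0r !hE.
by rewrite -[_ *+ n.+2]mulr_natl; ring.
Qed.

Let hermE s0 s1 d0 d1 x : (herm s0 s1 d0 d1).[x] =
  s0 + (s1 - s0) * H.[x] - d0 * Bl.[x] - d1 * Br.[x].
Proof. by rewrite /herm; move: H Bl Br => P Q S; rewrite !hE. Qed.

Let dherm s0 s1 d0 d1 x : (herm s0 s1 d0 d1)^`().[x] =
  (s1 - s0) * H^`().[x] - d0 * Bl^`().[x] - d1 * Br^`().[x].
Proof.
by rewrite /herm; move: H Bl Br => P Q S; rewrite !(derivD, derivN, derivZ, derivC, add0r) !hE.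
Qed.

Let ddherm s0 s1 d0 d1 x : (herm s0 s1 d0 d1)^`()^`().[x] =
  (s1 - s0) * H^`()^`().[x] - d0 * Bl^`()^`().[x] - d1 * Br^`()^`().[x].
Proof.
by rewrite /herm; move: H Bl Br => P Q S; rewrite !(derivD, derivN, derivZ, derivC, add0r) !hE.
Qed.

Lemma herm_0 s0 s1 d0 d1 : (herm s0 s1 d0 d1).[0] = s0.
Proof. by rewrite hermE /H /Bl /Br !hE !exprS; ring. Qed.

Lemma herm_1 s0 s1 d0 d1 : (herm s0 s1 d0 d1).[1] = s1.
Proof. by rewrite hermE /H /Bl /Br !hE subrr !exprS !expr1n; ring. Qed.

Lemma dherm_0 s0 s1 d0 d1 : (herm s0 s1 d0 d1)^`().[0] = - d0.
Proof. by rewrite dherm derivH derivBl derivBr subr0 !expr1n !exprS; ring. Qed.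

Lemma dherm_1 s0 s1 d0 d1 : (herm s0 s1 d0 d1)^`().[1] = d1.
Proof. by rewrite dherm derivH derivBl derivBr subrr !expr1n !exprS; ring. Qed.

(** By Bernoulli in the form $(1-x)^k(1+kx)\le1$. *)
Let bump (x : R) : 0 <= x <= 1 -> 0 <= x * (1 - x) ^+ n.+2 <= n.+2%:R^-1.
Proof.
move=> /andP[x0 x1]; have y0 : 0 <= 1 - x by rewrite subr_ge0.
rewrite mulr_ge0 ?exprn_ge0//=.
have bern k : (1 - x) ^+ k * (1 + k%:R * x) <= 1.
  elim: k => [|k IH]; first by rewrite expr0 mul0r addr0 mulr1.
  apply: le_trans IH; rewrite exprSr -mulrA ler_wpM2l ?exprn_ge0// -natr1.
  have := mulr_ge0 (ler0n R k) (mulr_ge0 x0 x0); have := mulr_ge0 x0 x0.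
  by rewrite !mulrA; nra.
rewrite -[leRHS]mul1r ler_pdivlMr//; apply: le_trans (bern n.+2).
have -> : x * (1 - x) ^+ n.+2 * n.+2%:R = (1 - x) ^+ n.+2 * (n.+2%:R * x).
  by rewrite mulrAC mulrC [x * _]mulrC.
by rewrite ler_wpM2l ?exprn_ge0// lerDr.
Qed.

(** Without the corrections the value is a convex combination of [s0] and [s1], since
    $0\le3x^2-2x^3\le1$; the corrections are controlled by [bump]. *)
Lemma herm_ge (c s0 s1 d0 d1 x : R) : c <= s0 -> c <= s1 -> 0 <= x <= 1 ->
  c - (`|d0| + `|d1|) / n.+2%:R <= (herm s0 s1 d0 d1).[x].
Proof.
move=> cs0 cs1 /[dup] x01 /andP[x0 x1].
have y01 : 0 <= 1 - x <= 1 by rewrite subr_ge0 x1 lerBlDl lerDr.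
have /andP[b0 b1] := bump x01; have := bump y01; rewrite subKr => /andP[b0' b1'].
rewrite hermE /H /Bl /Br !hE.
have t0 (d b : R) : 0 <= b <= n.+2%:R^-1 -> d * b <= `|d| / n.+2%:R.
  move=> /andP[h1 h2]; apply: (le_trans (ler_wpM2r h1 (ler_norm d))).
  exact: ler_wpM2l.
have t1 := t0 d0 _ (bump x01); have t2 := t0 d1 ((1 - x) * x ^+ n.+2).
rewrite b0' b1' in t2; have {}t2 := t2 isT.
have h0 : 0 <= 3 * x ^+ 2 - 2 * x ^+ 3.
  have -> : 3 * x ^+ 2 - 2 * x ^+ 3 = x ^+ 2 * (3 - 2 * x) by ring.
  by rewrite mulr_ge0 ?sqr_ge0//; lra.
have h1 : 3 * x ^+ 2 - 2 * x ^+ 3 <= 1.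
  rewrite -subr_ge0; have -> : 1 - (3 * x ^+ 2 - 2 * x ^+ 3) = (1 - x) ^+ 2 * (1 + 2 * x) by ring.
  by rewrite mulr_ge0 ?sqr_ge0//; lra.
have -> : (`|d0| + `|d1|) / n.+2%:R = `|d0| / n.+2%:R + `|d1| / n.+2%:R by rewrite mulrDl.
move: t1 t2 h0 h1; set h := 3 * _ - _; set T1 := d0 * _; set T2 := d1 * _.
set A := `|d0| / _; set B := `|d1| / _; clearbody h T1 T2 A B => t1 t2 h0 h1.
suff : c <= s0 + (s1 - s0) * h by lra.
have -> : s0 + (s1 - s0) * h = (1 - h) * s0 + h * s1 by ring.
have h1' : 0 <= 1 - h by rewrite subr_ge0.
have := ler_wpM2l h0 cs1; have := ler_wpM2l h1' cs0; rewrite mulrBl mul1r; lra.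
Qed.

(** The last clause supplies the factor $x$ used by [spike_supersolution], where the positive term
    $xQ$ is itself only of order $x$ near 0. *)
Lemma herm_bounded (D : R) : exists2 C, 0 <= C & forall s0 s1 d0 d1 x : R,
  [/\ `|s0| <= D, `|s1| <= D, `|d0| <= D & `|d1| <= D] -> 0 <= x <= 1 ->
  [/\ `|(herm s0 s1 d0 d1).[x]| <= C, `|(herm s0 s1 d0 d1)^`()^`().[x]| <= C
    & d0 = 0 -> `|(herm s0 s1 d0 d1)^`().[x]| <= C * x].
Proof.
have [C1 C10 H1] := poly_bounded H; have [C2 C20 H2] := poly_bounded Bl.
have [C3 C30 H3] := poly_bounded Br.
have [C4 C40 H4] := poly_bounded H^`()^`(); have [C5 C50 H5] := poly_bounded Bl^`()^`().
have [C6 C60 H6] := poly_bounded Br^`()^`().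
have [C7 C70 H7] : exists2 C, 0 <= C & forall x, 0 <= x <= 1 -> `|H^`().[x]| <= C * x.
  by apply: poly_root0_bounded; rewrite derivH expr0n/= subrr mulr0.
have [C8 C80 H8] : exists2 C, 0 <= C & forall x, 0 <= x <= 1 -> `|Br^`().[x]| <= C * x.
  by apply: poly_root0_bounded; rewrite derivBr !expr0n/= !mulr0 subrr.
pose E := 1 + 2 * C1 + C2 + C3 + (2 * C4 + C5 + C6) + (2 * C7 + C8).
have [D0|D0] := leP 0 D; last first.
  exists 0 => // s0 s1 d0 d1 x [/(le_trans (normr_ge0 _))]; rewrite leNgt D0//.
have E0 : 0 <= E by rewrite /E; lra.
exists (D * E); first exact: mulr_ge0.
move=> s0 s1 d0 d1 x [s0D s1D d0D d1D] x01; have /andP[x0 _] := x01.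
have s10 : `|s1 - s0| <= 2 * D by apply: le_trans (ler_normB _ _) _; lra.
have m (a b u v : R) : `|a| <= u -> `|b| <= v -> `|a * b| <= u * v.
  by move=> *; rewrite normrM ler_pM.
split.
- rewrite hermE; have h1 := m _ _ _ _ s10 (H1 _ x01).
  have h2 := m _ _ _ _ d0D (H2 _ x01); have h3 := m _ _ _ _ d1D (H3 _ x01).
  apply: (@le_trans _ _ (D + 2 * D * C1 + D * C2 + D * C3)).
    do 3 (apply: le_trans (ler_normB _ _) _ || apply: le_trans (ler_normD _ _) _; apply: lerD => //).
  rewrite /E; have := mulr_ge0 D0 C40; have := mulr_ge0 D0 C50; have := mulr_ge0 D0 C60.
  have := mulr_ge0 D0 C70; have := mulr_ge0 D0 C80; lra.
- rewrite ddherm; have h1 := m _ _ _ _ s10 (H4 _ x01).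
  have h2 := m _ _ _ _ d0D (H5 _ x01); have h3 := m _ _ _ _ d1D (H6 _ x01).
  apply: (@le_trans _ _ (2 * D * C4 + D * C5 + D * C6)).
    do 2 (apply: le_trans (ler_normB _ _) _; apply: lerD => //).
  rewrite /E; have := mulr_ge0 D0 C10; have := mulr_ge0 D0 C20; have := mulr_ge0 D0 C30.
  have := mulr_ge0 D0 C70; have := mulr_ge0 D0 C80; lra.
- move=> ->; rewrite dherm mul0r subr0; have h1 := m _ _ _ _ s10 (H7 _ x01).
  have h3 := m _ _ _ _ d1D (H8 _ x01).
  apply: (@le_trans _ _ (2 * D * (C7 * x) + D * (C8 * x))).
    by apply: le_trans (ler_normB _ _) _; apply: lerD.
  rewrite !mulrA -mulrDl ler_wpM2r// /E.
  have := mulr_ge0 D0 C10; have := mulr_ge0 D0 C20; have := mulr_ge0 D0 C30.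
  have := mulr_ge0 D0 C40; have := mulr_ge0 D0 C50; have := mulr_ge0 D0 C60; lra.
Qed.
End Hermite.
End Polynomials.

(** * Polynomials with a thin negative spike at an end point *)

Section Spike.
Context (R : realType).
Implicit Types (Q U : {poly R}) (N : nat).

Let hE := (hornerMn, hornerXn, horner_exp, hornerC, hornerX, hornerD, hornerN, hornerZ, hornerM).

(* The value at 0 is - a, with a steep slope a (N + 2) that lets the derivative
   data at 0 force a to be of order 1 / N. *)
Definition spike N (a : R) Q : {poly R} := 'X * Q - a *: (1 - 'X) ^+ N.+2.

Lemma spikeE N a Q x : (spike N a Q).[x] = x * Q.[x] - a * (1 - x) ^+ N.+2.
Proof. by rewrite /spike !hE. Qed.

Lemma dspikeE N a Q x : (spike N a Q)^`().[x] =
  Q.[x] + x * Q^`().[x] + a * N.+2%:R * (1 - x) ^+ N.+1.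
Proof.
rewrite /spike derivB derivM derivX mul1r derivZ deriv_exp derivB derivC derivX sub0r !hE.
by rewrite -[_ *+ N.+2]mulr_natl; ring.
Qed.

Lemma ddspikeE N a Q x : (spike N a Q)^`()^`().[x] =
  2 * Q^`().[x] + x * Q^`()^`().[x] - a * (N.+2%:R * N.+1%:R) * (1 - x) ^+ N.
Proof.
have -> : (spike N a Q)^`() = Q + 'X * Q^`() + (a * N.+2%:R) *: (1 - 'X) ^+ N.+1.
  rewrite /spike derivB derivM derivX mul1r derivZ deriv_exp derivB derivC derivX sub0r.
  by rewrite mulN1r mulNrn scalerN opprK -scaler_nat scalerA.
rewrite !derivD derivM derivX mul1r derivZ deriv_exp derivB derivC derivX sub0r !hE.
by rewrite -[_ *+ N.+1]mulr_natl; ring.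
Qed.

Lemma bernoulli_le k (x : R) : 0 <= x <= 1 -> 1 - k%:R * x <= (1 - x) ^+ k.
Proof.
move=> /andP[x0 x1]; have y0 : 0 <= 1 - x by rewrite subr_ge0.
elim: k => [|k IH]; first by rewrite mul0r subr0 expr0.
rewrite exprS; apply: le_trans (ler_wpM2l y0 IH); rewrite -natr1.
have := mulr_ge0 (ler0n R k) (mulr_ge0 x0 x0); set A := k%:R => h.
have -> : (1 - x) * (1 - A * x) = 1 - (A + 1) * x + A * (x * x) by ring.
by rewrite lerDl.
Qed.

(* The factor (N+2)(N+1) makes the negative part of the spike a subsolution:
   lam (1 - x)^(N+2) <= s ((1 - x)^(N+2))''. *)
Lemma spike_supersolution N (a s c C : R) Q x : 0 <= a -> 0 < s -> 0 <= x <= 1 ->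
  c <= Q.[x] -> `|Q^`().[x]| <= C * x -> `|Q^`()^`().[x]| <= C ->
  3 * C <= N.+2%:R * N.+1%:R * c ->
  s * (spike N a Q)^`()^`().[x] <= s * (N.+2%:R * N.+1%:R) * (spike N a Q).[x].
Proof.
move=> a0 s0 /andP[x0 x1] cQ Q1 Q2 lamc; rewrite -mulrA ler_pM2l// spikeE ddspikeE.
move: lamc; set L := N.+2%:R * N.+1%:R => lamc.
have L0 : 0 <= L by rewrite mulr_ge0.
have y0 : 0 <= 1 - x by rewrite subr_ge0.
have h1 : 2 * Q^`().[x] + x * Q^`()^`().[x] <= x * (3 * C).
  have := le_trans (ler_norm _) Q1; have := ler_wpM2l x0 (le_trans (ler_norm _) Q2); lra.
have h2 : x * (3 * C) <= L * (x * Q.[x]).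
  rewrite [leRHS]mulrCA ler_wpM2l//; apply: le_trans lamc _; exact: ler_wpM2l.
have h3 : L * (a * (1 - x) ^+ N.+2) <= a * L * (1 - x) ^+ N.
  rewrite mulrA [L * a]mulrC ler_wpM2l ?mulr_ge0// !exprS mulrA.
  rewrite ler_piMl ?exprn_ge0//; have := mulr_ge0 y0 x0; nra.
rewrite mulrBr; apply: lerB h3; exact: le_trans h1 h2.
Qed.

(** Put $K=N+2$. The range of $x$ says $Kx(8C+2b)\le b$, so $Kx\le1/2$ and $8KxC\le b$. By Bernoulli
    the value times $8K$ is then at most $b-4b(1-Kx)\le-b$. *)
Lemma spike_le N (a b C : R) Q x : 0 < b -> 0 <= C -> b <= 2 * N.+2%:R * a ->
  `|Q.[x]| <= C -> 0 <= x <= b / (8 * C + 2 * b) / N.+2%:R ->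
  (spike N a Q).[x] <= - (b / (8 * N.+2%:R)).
Proof.
move=> b0 C0 ba QC /andP[x0 xt].
have K0 : 0 < N.+2%:R :> R by [].
have D0 : 0 < 8 * C + 2 * b by lra.
move: xt; rewrite ler_pdivlMr// ler_pdivlMr// => xt.
set K : R := N.+2%:R in K0 ba xt *.
have K1 : 1 <= K by rewrite ler1n.
have Kx0 : 0 <= x * K by rewrite mulr_ge0// ltW.
have x1 : x <= 1.
  have h : x * K * (2 * b) <= b.
    by apply: le_trans xt; rewrite ler_wpM2l// lerDr mulr_ge0//.
  have : x * K * 2 <= 1 by rewrite -(ler_pM2r b0) mul1r -[_ * b]mulrA.
  have := ler_wpM2l x0 K1; lra.
have a0 : 0 <= a.
  rewrite leNgt; apply/negP => an; have : 2 * K * a < 0 by rewrite pmulr_rlt0// mulr_gt0.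
  lra.
rewrite spikeE; have h1 : x * Q.[x] <= x * C.
  by rewrite ler_wpM2l// (le_trans (ler_norm _)).
have := bernoulli_le N.+2 (x := x); rewrite x0 x1 => /(_ isT)/(ler_wpM2l a0) h2.
rewrite -/K in h2.
apply: (le_trans (lerB h1 h2)).
rewrite -[b / _]/(b * (8 * K)^-1) -(ler_pM2r (_ : 0 < 8 * K)) ?mulr_gt0//.
rewrite mulNr divfK ?gt_eqF ?mulr_gt0//.
have xk : x * K * 2 <= 1.
  have h : x * K * (2 * b) <= b.
    by apply: le_trans xt; rewrite ler_wpM2l// lerDr mulr_ge0//.
  by rewrite -(ler_pM2r b0) mul1r -[_ * b]mulrA.
have xc : 8 * (x * K * C) <= b.
  have : 0 <= x * K * (2 * b) by rewrite !mulr_ge0// ltW.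
  by move: xt; rewrite mulrDr; lra.
have h3 : b * (1 - x * K) <= 2 * K * a * (1 - x * K) by rewrite ler_wpM2r//; lra.
have h4 : b * (x * K * 2) <= b by rewrite ger_pMr.
have -> : (x * C - a * (1 - K * x)) * (8 * K) = 8 * (x * K * C) - 4 * (2 * K * a * (1 - x * K)) by ring.
have : b * (1 - x * K) = b - b * (x * K * 2) / 2 by field.
lra.
Qed.

Lemma spike_bounded N (a C : R) Q x : 0 <= a -> 0 <= x <= 1 -> `|Q.[x]| <= C ->
  `|(spike N a Q).[x]| <= C + a.
Proof.
move=> a0 /andP[x0 x1] QC; rewrite spikeE; apply: le_trans (ler_normB _ _) _.
have y0 : 0 <= 1 - x by rewrite subr_ge0.
apply: lerD.
  by rewrite normrM (ger0_norm x0) (le_trans _ QC)// ler_piMl.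
by rewrite normrM (ger0_norm a0) ger0_norm ?exprn_ge0// ler_piMr// exprn_ile1// lerBlDl lerDr.
Qed.

(** Reflection reduces a site at 1 to a site at 0. *)
Definition flip (b : bool) U : {poly R} := if b then U \Po (1 - 'X) else U.
Definition flip_pt (b : bool) (x : R) : R := if b then 1 - x else x.

Lemma flipE b U x : (flip b U).[x] = U.[flip_pt b x].
Proof. by case: b => //=; rewrite horner_comp !hE. Qed.

Lemma dflipE b U x : (flip b U)^`().[x] = (-1) ^+ b * U^`().[flip_pt b x].
Proof.
case: b => /=; last by rewrite mul1r.
by rewrite deriv_comp hornerM horner_comp derivB derivC derivX sub0r !hE expr1 mulrC.
Qed.

Lemma ddflipE b U x : (flip b U)^`()^`().[x] = U^`()^`().[flip_pt b x].
Proof.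
case: b => //=; rewrite deriv_comp derivB derivC derivX sub0r mulrN1 derivN hornerN.
by rewrite deriv_comp hornerM horner_comp derivB derivC derivX sub0r !hE mulrN1 opprK.
Qed.
End Spike.

(** * Test functions built from a coefficient of the wrong sign *)

Section TestFunction.
Context (R : realType) (m : nat) (sigma : 'I_m -> R) (K00 K01 K10 K11 : 'M[R]_m).
Hypothesis sigma_gt0 : forall i, 0 < sigma i.
Local Notation site := (bool * 'I_m)%type.

(* A site is an end point (false for 0, true for 1) of the interval carrying a
   component; the boundary condition expresses outward derivatives through
   values at the sites. *)
Definition site_coef (p q : site) : R :=
  match p.1, q.1 with
  | false, false => - K00 p.2 q.2
  | false, true => - K01 p.2 q.2
  | true, false => K10 p.2 q.2
  | true, true => K11 p.2 q.2
  end.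
Local Notation K := site_coef.

Definition site_val (c : 'I_m -> R -> R) (q : site) : R := c q.2 q.1%:R.
Definition site_out (d : 'I_m -> R -> R) (q : site) : R :=
  if q.1 then d q.2 1 else - d q.2 0.

Lemma boundary_sites c d :
  (forall p, site_out d p = \sum_q K p q * site_val c q) -> boundary K00 K01 K10 K11 c d.
Proof.
move=> H i; have sumE (p : site) : \sum_q K p q * site_val c q =
    \sum_j K p (true, j) * c j 1 + \sum_j K p (false, j) * c j 0.
  transitivity (\sum_(q : bool * 'I_m) K p (q.1, q.2) * site_val c (q.1, q.2)).
    by apply: eq_bigr => -[].
  rewrite -(pair_bigA _ (fun b j => K p (b, j) * site_val c (b, j)))/=.
  by rewrite big_bool.
have := H (false, i); have := H (true, i); rewrite !sumE /site_out/= => -> H0.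
split; last by rewrite addrC.
rewrite -[LHS]opprK H0 opprD addrC -!sumrN.
by congr (_ + _); apply: eq_bigr => j _; rewrite /site_coef/= mulNr opprK.
Qed.

(* All values at sites other than p are positive, and the wrong sign of the
   coefficient K p q0 makes their contribution kap to the outward derivative at
   p negative; half of it is spent on the positive part of the spike. *)
Lemma test_function (p q0 : site) : p != q0 -> K p q0 < 0 ->
  exists z eta B : R, exists N0 : nat, [/\ 0 < z, 0 < eta & 0 <= B] /\
  forall N, (N0 <= N)%N -> exists W : 'I_m -> {poly R},
  [/\ boundary K00 K01 K10 K11 (fun k x => (W k).[x]) (fun k x => (W k)^`().[x]),
    forall k x, 0 <= x <= 1 -> sigma k * (W k)^`()^`().[x] <=
      sigma p.2 * (N.+2%:R * N.+1%:R) * (W k).[x],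
    forall x, 0 <= x <= eta / N.+2%:R -> x <= 1 ->
      (W p.2).[flip_pt p.1 x] <= - (z / N.+2%:R)
    & forall k x, 0 <= x <= 1 -> `|(W k).[x]| <= B].
Proof.
case: p => b i pq0 Kneg; set p : site := (b, i) in pq0 Kneg *.
pose SK := \sum_q `|K p q|.
have SK0 : 0 <= SK by apply: sumr_ge0.
(* The value at sites other than [p] and [q0], so small that together they offset at most half of
   the negative [K p q0]. *)
pose e : R := - K p q0 / (2 * (SK + 1)).
have e0 : 0 < e by rewrite divr_gt0 ?oppr_gt0// mulr_gt0// ltr_wpDl.
pose s (q : site) : R := if q == q0 then 1 else e.
pose kap := \sum_(q | q != p) K p q * s q.
have kap_neg : kap <= K p q0 / 2.
  rewrite /kap (bigD1 q0) 1?eq_sym//= /s eqxx mulr1.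
  have : \sum_(q | (q != p) && (q != q0)) K p q * (if q == q0 then 1 else e) <= SK * e.
    rewrite mulr_suml [leRHS](bigID (fun q => (q != p) && (q != q0)))/=.
    apply: (@le_trans _ _ (\sum_(q | (q != p) && (q != q0)) `|K p q| * e)).
      apply: ler_sum => q /andP[_ /negPf ->].
      by rewrite ler_wpM2r ?(ltW e0)// ler_norm.
    by rewrite lerDl sumr_ge0// => q _; rewrite mulr_ge0// ltW.
  have : SK * e <= - K p q0 / 2.
    have h : (SK + 1) * e = - K p q0 / 2 by rewrite /e; field; rewrite gt_eqF// ltr_wpDl.
    by rewrite -h ler_wpM2r ?(ltW e0)// lerDl.
  lra.
pose beta := - kap / 2; have beta0 : 0 < beta by rewrite /beta; lra.
pose p' : site := (~~ b, i).
have p'p : p' != p by rewrite /p' /p xpair_eqE; case: (b).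
pose Sm := 1 + e + beta.
have s_gt0 q : 0 < s q by rewrite /s; case: ifP.
have s_le q : s q <= Sm by rewrite /s /Sm; case: ifP; lra.
pose D1 := (\sum_q \sum_q' `|K q q'|) * Sm.
have D10 : 0 <= D1.
  by rewrite mulr_ge0 ?(le_trans (ltW (s_gt0 p)) (s_le p))// sumr_ge0// => q _; exact: sumr_ge0.
pose D := 2 * Sm + D1.
pose c := Num.min (Num.min 1 e) beta.
have c0 : 0 < c by rewrite !lt_min ltr01 e0 beta0.
have cs q : c <= s q.
  by rewrite /c /s; case: ifP => _; rewrite !ge_min lexx ?orbT.
have cb : c <= beta by rewrite ge_min lexx orbT.
(* [n] is fixed before [N], so the bounds taken from [herm_bounded] are uniform in [N]. *)
have [n Hn] : exists n : nat, 2 * D / n.+2%:R <= c / 2.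
  exists (Num.bound `|4 * D / c|).
  have h : 4 * D / c <= (Num.bound `|4 * D / c|).+2%:R.
    apply: le_trans (ler_norm _) _; apply: le_trans (ltW (archi_boundP (normr_ge0 _))) _.
    by rewrite ler_nat; exact: leqW (leqnSn _).
  by rewrite ler_pdivrMr//; rewrite ler_pdivrMr// in h; lra.
have [C C0 HC] := herm_bounded n D.
pose Ssig := \sum_k sigma k.
have Ssig0 : 0 <= Ssig by apply: sumr_ge0 => k _; exact: ltW.
have sSsig k : sigma k <= Ssig.
  by rewrite /Ssig (bigD1 k)//= lerDl sumr_ge0// => j _; exact: ltW.
(* Three thresholds for [N]: the supersolution inequality in the component of the spike, the same in
   the other components, and control of the denominator [N + 2 - K p p]. *)
pose x0 := 3 * C / (c / 2) + Ssig * C / (sigma i * (c / 2)) + 2 * `|K p p|.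
exists (beta / 8), (beta / (8 * C + 2 * beta)), (C + beta), (Num.bound x0); split.
  by split; [lra|rewrite divr_gt0//; lra|lra].
move=> N N0N; set L := N.+2%:R * N.+1%:R.
have c2 : 0 < c / 2 by lra.
have scc : 0 < sigma i * (c / 2) by rewrite mulr_gt0.
have t1 : 0 <= 3 * C / (c / 2) by rewrite divr_ge0 ?mulr_ge0// ltW.
have t2 : 0 <= Ssig * C / (sigma i * (c / 2)) by rewrite divr_ge0 ?mulr_ge0// ltW.
have xN : x0 <= N%:R.
  apply: le_trans (ler_norm _) _; rewrite ger0_norm; last by rewrite /x0 !addr_ge0.
  apply: le_trans (ltW (archi_boundP _)) _; first by rewrite /x0 !addr_ge0.
  by rewrite ler_nat.
have NL : N%:R <= L.
  rewrite /L -natrM ler_nat; apply: leq_trans (leqW (leqnSn N)) _.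
  by rewrite leq_pmulr.
have L1 : 3 * C <= L * (c / 2).
  by rewrite -ler_pdivrMr//; apply: le_trans _ NL; apply: le_trans _ xN; rewrite /x0 -addrA lerDl addr_ge0.
have L2 : Ssig * C <= sigma i * L * (c / 2).
  rewrite mulrAC -ler_pdivrMl// mulrC; apply: le_trans _ NL; apply: le_trans _ xN.
  by rewrite /x0 -addrA addrCA lerDl addr_ge0.
have NK : 2 * `|K p p| <= N%:R by apply: le_trans _ xN; rewrite /x0 lerDr addr_ge0.
have Kpp : K p p <= `|K p p| by exact: ler_norm.
have Kpp' : - K p p <= `|K p p| by rewrite -normrN ler_norm.
have NE : N.+2%:R = N%:R + 2 :> R by rewrite -addn2 natrD.
have den1 : 1 <= N.+2%:R - K p p by rewrite NE; have := ler0n R N; lra.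
have den0 : 0 < N.+2%:R - K p p by lra.
(* Solves the boundary condition at [p] for the value $-a$: the inward slope $\beta+a(N+2)$ of the
   spike must equal $2\beta+aK_{pp}$, where $-2\beta$ is [kap]. *)
pose a := beta / (N.+2%:R - K p p).
have aE : a * (N.+2%:R - K p p) = beta by rewrite /a divfK// gt_eqF.
have a0 : 0 < a by rewrite divr_gt0.
have ab : a <= beta by rewrite -aE ler_peMr// ltW.
have ba : beta <= 2 * N.+2%:R * a.
  rewrite -aE mulrC ler_wpM2r ?(ltW a0)// NE; lra.
pose val q := if q == p then - a else s q.
have val_le q : `|val q| <= Sm.
  rewrite /val; case: ifP => _; last by rewrite ger0_norm ?(ltW (s_gt0 q)).
  by rewrite normrN gtr0_norm// /Sm; lra.
pose dq q := \sum_q' K q q' * val q'.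
have dq_le q : `|dq q| <= D1.
  apply: le_trans (ler_norm_sum _ _ _) _; rewrite /D1 mulr_suml [leRHS](bigD1 q)//=.
  rewrite -[leLHS]addr0 lerD//; last first.
    by apply: sumr_ge0 => r _; rewrite mulr_ge0 ?sumr_ge0// (le_trans (normr_ge0 _) (val_le q)).
  rewrite mulr_suml; apply: ler_sum => r _.
  by rewrite normrM ler_wpM2l.
have dqp : dq p = - (beta + a * N.+2%:R).
  rewrite /dq (bigD1 p)//= {1}/val eqxx.
  have -> : \sum_(q | q != p) K p q * val q = kap.
    by apply: eq_bigr => q /negPf qp; rewrite /val qp.
  have -> : kap = - 2 * beta by rewrite /beta; field.
  have : a * N.+2%:R = beta + a * K p p by rewrite -aE; ring.
  by move=> ->; ring.
have Sm0 : 0 <= Sm by exact: le_trans (ltW (s_gt0 p)) (s_le p).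
have sD q : `|s q| <= D by rewrite ger0_norm ?(ltW (s_gt0 q))// /D; have := s_le q; lra.
have bD : `|beta| <= D by rewrite gtr0_norm// /D /Sm; lra.
have dD q : `|dq q| <= D by apply: le_trans (dq_le q) _; rewrite /D; lra.
have dsD : `|dq p' - s p'| <= D.
  apply: le_trans (ler_normB _ _) _; rewrite (gtr0_norm (s_gt0 p')).
  by have := dq_le p'; have := s_le p'; rewrite /D; lra.
have D0 : 0 <= D by exact: le_trans (normr_ge0 _) bD.
have hge s0 s1 d0 d1 x : c <= s0 -> c <= s1 -> `|d0| <= D -> `|d1| <= D -> 0 <= x <= 1 ->
    c / 2 <= (herm n s0 s1 d0 d1).[x].
  move=> h0 h1 h2 h3 x01; apply: le_trans (herm_ge n d0 d1 h0 h1 x01).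
  suff : (`|d0| + `|d1|) / n.+2%:R <= c / 2 by move: (_ / n.+2%:R) => t; lra.
  by apply: le_trans Hn; rewrite ler_wpM2r//; lra.
(* [Q] at 0 is the slope of $xQ$ there. At 1 the slope of $xQ$ is $Q+Q'$, hence the subtraction of
   [s p']. *)
pose Q := herm n beta (s p') 0 (dq p' - s p').
have HQ x : 0 <= x <= 1 -> [/\ `|Q.[x]| <= C, `|Q^`()^`().[x]| <= C & `|Q^`().[x]| <= C * x].
  move=> x01; have := HC beta (s p') 0 (dq p' - s p') x; rewrite normr0 => H.
  by have [h1 h2 h3] := H (And4 bD (sD p') D0 dsD) x01; split => //; exact: h3.
have Qge x : 0 <= x <= 1 -> c / 2 <= Q.[x] by apply: hge; rewrite ?normr0.
pose W k := if k == i then flip b (spike N a Q) else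
  herm n (s (false, k)) (s (true, k)) (dq (false, k)) (dq (true, k)).
have Wi : W i = flip b (spike N a Q) by rewrite /W eqxx.
have flip01 (x : R) : 0 <= x <= 1 -> 0 <= flip_pt b x <= 1.
  by rewrite /flip_pt => /andP[x_ge0 x_le1]; case: (b); lra.
have flipK (x : R) : flip_pt b (flip_pt b x) = x.
  by rewrite /flip_pt; case: (b); rewrite ?subKr.
exists W; split.
- have u0 : (spike N a Q).[0] = - a by rewrite spikeE mul0r subr0 expr1n mulr1 sub0r.
  have u1 : (spike N a Q).[1] = s p'.
    by rewrite spikeE herm_1 mul1r subrr expr0n mulr0 subr0.
  have v0 : (spike N a Q)^`().[0] = - dq p.
    by rewrite dspikeE dqp opprK herm_0 mul0r addr0 subr0 expr1n mulr1.
  have v1 : (spike N a Q)^`().[1] = dq p'.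
    by rewrite dspikeE herm_1 dherm_1 subrr expr0n mulr0 addr0 mul1r addrC subrK.
  apply: boundary_sites => -[b' k].
  have -> : \sum_q K (b', k) q * site_val (fun k x => (W k).[x]) q = dq (b', k).
    apply: eq_bigr => -[b2 j] _; congr (_ * _); rewrite /site_val/= /W /val /p xpair_eqE.
    have [->|ji] := eqVneq j i; last first.
      by rewrite andbF; case: (b2); rewrite /= ?herm_1 ?herm_0.
    rewrite andbT flipE /flip_pt; move: u0 u1; rewrite /p'.
    by case: (b); case: (b2) => /= u0 u1; rewrite ?subrr ?subr0 ?u0 ?u1.
  rewrite /site_out/= /W; have [->|ki] := eqVneq k i; last first.
    by case: (b'); rewrite ?dherm_1 ?dherm_0 ?opprK.
  rewrite !dflipE /flip_pt; move: v0 v1; rewrite /p /p'.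
  by case: (b); case: (b') => /= v0 v1; rewrite ?subrr ?subr0 ?v0 ?v1 ?expr1 ?expr0 ?mulN1r ?mul1r ?opprK.
- move=> k x x01; rewrite /W; have [->|ki] := eqVneq k i.
    rewrite ddflipE flipE; have f01 := flip01 _ x01; have [h1 h2 h3] := HQ _ f01.
    by apply: (spike_supersolution (C := C)) (Qge _ f01) h3 h2 L1; rewrite ?(ltW a0).
  have [h1 h2 _] := HC _ _ _ _ _ (And4 (sD (false, k)) (sD (true, k)) (dD (false, k)) (dD (true, k))) x01.
  have h4 := hge _ _ _ _ _ (cs (false, k)) (cs (true, k)) (dD (false, k)) (dD (true, k)) x01.
  apply: (@le_trans _ _ (Ssig * C)).
    apply: (@le_trans _ _ (sigma k * C)); last by rewrite ler_wpM2r.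
    by apply: ler_wpM2l; [exact: ltW|exact: le_trans (ler_norm _) h2].
  apply: le_trans L2 _; rewrite ler_wpM2l// mulr_ge0 ?(ltW (sigma_gt0 i))//.
  by apply: le_trans NL.
- move=> x xe x1 /=; rewrite Wi flipE flipK.
  have x01 : 0 <= x <= 1 by move/andP : xe => [-> _].
  have [h1 _ _] := HQ _ x01; have := spike_le beta0 C0 ba h1 xe.
  by rewrite invfM mulrA.
- move=> k x x01; rewrite /W; have [_|ki] := eqVneq k i.
    rewrite flipE; have f01 := flip01 _ x01; have [h1 _ _] := HQ _ f01.
    by apply: le_trans (spike_bounded N (ltW a0) f01 h1) _; rewrite lerD2l.
  have [h1 _ _] := HC _ _ _ _ _ (And4 (sD (false, k)) (sD (true, k)) (dD (false, k)) (dD (true, k))) x01.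
  by apply: le_trans h1 _; rewrite lerDl ltW.
Qed.
End TestFunction.

(** * The quantitative contradiction *)

Section Necessity.
Context (R : realType) (m : nat) (sigma : 'I_m -> R) (K00 K01 K10 K11 : 'M[R]_m).
#[local] Existing Instance ae_mu_filter.
Hypothesis sigma_gt0 : forall i, 0 < sigma i.
Notation mu := (@lebesgue_measure R).
Local Notation Lsp := (LspaceType1 (muI R)).
Local Notation V := (mfold m (L1I R)).
Local Notation A := (A_Phi sigma K00 K01 K10 K11).

Lemma I_ge_itv (f : R -> R) (a b z : R) : L1 f -> (forall x, 0 <= f x) ->
  0 <= a -> a <= b -> b <= 1 ->
  {ae mu, forall x, x \in `[0, 1] -> a <= x <= b -> z <= f x} -> z * (b - a) <= I f.
Proof.
move=> L1f f0 a0 ab b1 zf.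
have mab : measurable (`[a, b] : set (measurableTypeR R)) by exact: measurable_itv.
have sub : (`[a, b]%classic : set (measurableTypeR R)) `<=` `[0, 1].
  by move=> x /=; rewrite !in_itv/= => /andP[h1 h2]; rewrite (le_trans a0 h1) (le_trans h2 b1).
have L1ind : L1 (\1_(`[a, b]%classic) : R -> R).
  by apply: integrableS (integrable_indic_itv a b true false).
have -> : z * (b - a) = I (fun x => z * \1_(`[a, b]%classic) x).
  rewrite IZ//; congr (_ * _).
  rewrite /I /Rintegral integral_indic// setIidl//.
  suff H : mu (`[a, b]%classic : set (measurableTypeR R)) = (b - a)%:E.
    exact/esym/(congr1 fine H).
  rewrite lebesgue_measure_itv/= lte_fin; case: ltP => // h.
  by congr EFin; apply/esym/eqP; rewrite subr_eq0 eq_le h ab.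
apply: le_I_ae => //; first exact: L1Z.
apply: filterS zf => x H x01; rewrite indicE.
have [|_] := boolP (x \in _); last by rewrite mulr0.
by rewrite inE /= in_itv/= mulr1 => /(H x01).
Qed.

(** Quadratic decay is enough: for $x$ of order $N^2$ it gives $N^{-4}$, against a lower bound of
    order $N^{-2}$. *)
Lemma expRN_le_sqr (x : R) : 0 < x -> expR (- x) <= 4 / x ^+ 2.
Proof.
move=> x0; rewrite expRN -[leRHS]invrK lef_pV2 ?posrE ?expR_gt0 ?invr_gt0 ?divr_gt0 ?exprn_gt0//.
rewrite invf_div; have -> : expR x = expR (x / 2) ^+ 2 by rewrite expr2 -expRD -splitr.
have -> : x ^+ 2 / 4 = (x / 2) ^+ 2 by field.
rewrite lerXn2r ?nnegrE ?expR_ge0 ?divr_ge0 ?(ltW x0)//.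
by apply: le_trans (expR_ge1Dx _); rewrite lerDr.
Qed.

Lemma nonneg0 : nonneg (0 : V).
Proof.
apply/nonnegP => i; have -> : mfold_app (0 : V) i = 0 by rewrite /mfold_app ffunE.
have H := Lspace1_0_ae R; by apply: filterS H => x H x01; rewrite H.
Qed.

Lemma nonnegD (u v : V) : nonneg u -> nonneg v -> nonneg (u + v).
Proof.
move=> /nonnegP u0 /nonnegP v0; apply/nonnegP => i; rewrite mfoldD.
have H1 := u0 i; have H2 := v0 i; have H3 := Lspace1D_ae (u i : Lsp) (v i).
by apply: filterS3 H1 H2 H3 => x H1 H2 H3 x01; rewrite H3// addr_ge0 ?H1 ?H2.
Qed.

Theorem site_coef_ge0 (p q : bool * 'I_m) : generates_positive_semigroup A -> p != q ->
  0 <= site_coef K00 K01 K10 K11 p q.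
Proof.
move=> [T [T_C0 T_gen T_pos]] pq; rewrite leNgt; apply/negP => Kneg.
have [d [M [d0 M0 TM]]] := semigroup_locally_bounded (@mfold_complete R m) T_C0.
have [z [eta [B [N0 [[z0 eta0 B0] HW]]]]] := test_function sigma_gt0 pq Kneg.
pose sd := sigma p.2 * d; have sd0 : 0 < sd by rewrite mulr_gt0.
pose E := 16 / sd ^+ 2 * (M * (m%:R * B)).
(* The lower bound $z\eta/K^2$ is compared with the upper bound $E/K^4$, where $K=N+2$; then $K\le
   K^2$ leaves a bound linear in $K$. *)
have key N : (N0 <= N)%N -> eta <= N.+2%:R -> z * eta * N.+2%:R <= E.
  move=> N0N etaN; have [W [bW supW negW bdW]] := HW N N0N.
  set K : R := N.+2%:R in etaN negW *.
  pose lam := sigma p.2 * (K * N.+1%:R).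
  have lam0 : 0 < lam by rewrite !mulr_gt0.
  have L1W k : L1 (fun x => (W k).[x]) by exact: AC_L1 (AC_poly (W k)).
  have L1ddW k : L1 (fun x => sigma k * (W k)^`()^`().[x]).
    by apply: L1Z; have [] := AC_poly (W k)^`().
  pose u : V := clsv (fun k x => (W k).[x]); pose f : V := clsv (fun k x => sigma k * (W k)^`()^`().[x]).
  have uE k : {ae mu, forall x, x \in `[0, 1] -> (u k : Lsp) x = (W k).[x]}.
    by rewrite clsvE; exact: clsE.
  have fE k : {ae mu, forall x, x \in `[0, 1] -> (f k : Lsp) x = sigma k * (W k)^`()^`().[x]}.
    by rewrite clsvE; exact: clsE.
  have Auf : A u f.
    apply/(A_PhiP _ _ _ _ sigma_gt0).
    exists (fun k x => (W k).[x]), (fun k x => (W k)^`().[x]); split => //.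
      by move=> k; exact: AC_poly.
    move=> k; apply: AC_ae (AC_poly _) _ _; first exact/L1Z/Lspace1_L1.
    by have H := fE k; apply: filterS H => x H x01; rewrite H// mulKf// gt_eqF.
  have Pg : nonneg (lam *: u - f).
    apply/nonnegP => k; rewrite mfoldB mfoldZ.
    have H1 := Lspace1B_ae (lam *: (u k : Lsp)) (f k); have H2 := Lspace1Z_ae lam (u k : Lsp).
    have H3 := uE k; have H4 := fE k.
    have {}H2 : {ae mu, forall x, x \in `[0, 1] -> (lam *: (u k : Lsp)) x = lam * (W k).[x]}.
      by apply: filterS2 H2 H3 => x H2 H3 x01; rewrite H2// H3.
    apply: filterS3 H1 H2 H4 => x H1 H2 H4 x01; rewrite H1// H2// H4// subr_ge0.
    by apply: supW; rewrite in_itv/= in x01.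
  have := cone_discounted_decrease T_C0 T_gen (@nonneg_closed R m) nonneg0 nonnegD (@nonnegZ R m)
    (fun t u t0 => T_pos t t0 u) d0 M0 TM Auf (ltW lam0) Pg.
  set w := expR _ *: T d u => /nonnegP/(_ p.2); rewrite mfoldB => uw.
  have K0 : 0 < K by [].
  have [h hE /andP[h_ge0 h_le1]] : exists2 h, h = eta / K & 0 <= h <= 1.
    by exists (eta / K); rewrite // divr_ge0 ?(ltW eta0)//= ler_pdivrMr// mul1r.
  rewrite -hE in negW; pose a0 : R := if p.1 then 1 - h else 0.
  (* On an interval of length [h] next to the site [p], $w\le u\le-z/K$. *)
  have lower : z / K * h <= I (fun x => `|(w p.2 : Lsp) x|).
    have -> : h = (a0 + h) - a0 by ring.
    apply: I_ge_itv => //.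
    - exact/L1_abs/Lspace1_L1.
    - by rewrite /a0; case: ifP => _ //; rewrite subr_ge0.
    - by rewrite lerDl.
    - by rewrite /a0; case: ifP => _; rewrite ?subrK ?add0r.
    have H1 := Lspace1B_ae (u p.2 : Lsp) (w p.2); have H2 := uE p.2; have H3 := uw.
    apply: filterS3 H1 H2 H3 => x H1 H2 H3 x01 xa.
    have := H3 x01; rewrite H1// H2//.
    have xr : 0 <= flip_pt p.1 x <= h.
      by move: xa; rewrite /a0 /flip_pt; case: ifP => _; lra.
    have xr1 : flip_pt p.1 x <= 1 by case/andP : xr => _ /le_trans; exact.
    have := negW _ xr xr1.
    have -> : flip_pt p.1 (flip_pt p.1 x) = x by rewrite /flip_pt; case: (p.1); rewrite ?subKr.
    have := divr_gt0 z0 K0; move: (z / K) (W p.2).[x] ((w p.2 : Lsp) x) => y v y' y0 h1 h2.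
    by rewrite ler0_norm; lra.
  have upper : I (fun x => `|(w p.2 : Lsp) x|) <= expR (- (lam * d)) * (M * (m%:R * B)).
    rewrite -Lspace1_normI; apply: le_trans (mfold_app_le w _) _.
    rewrite /w normrZ ger0_norm ?expR_ge0// ler_wpM2l ?expR_ge0//.
    apply: le_trans (TM _ _ _) _; first by rewrite (ltW d0) lexx.
    rewrite ler_wpM2l// mfold_normI.
    apply: (@le_trans _ _ (\sum_(k < m) B)); last by rewrite sumr_const card_ord mulr_natl.
    apply: ler_sum => k _; rewrite -[leRHS]I_cst.
    apply: le_I_ae; [exact/L1_abs/Lspace1_L1|exact: L1_cst|].
    have H := uE k; apply: filterS H => x H x01; rewrite H//; apply: bdW.
    by rewrite in_itv/= in x01.
  have lamd : sd * K ^+ 2 / 2 <= lam * d.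
    have -> : lam * d = sd * (K * N.+1%:R) by rewrite /lam /sd; ring.
    rewrite -mulrA ler_pM2l// expr2 -mulrA ler_pM2l// ler_pdivrMr//.
    by rewrite -natrM ler_nat muln2 -addnn addSn ltnS leq_addl.
  have sdK : 0 < sd * K ^+ 2 / 2 by rewrite divr_gt0// mulr_gt0// exprn_gt0.
  have ex : expR (- (lam * d)) <= 16 / sd ^+ 2 / K ^+ 4.
    apply: (@le_trans _ _ (expR (- (sd * K ^+ 2 / 2)))); first by rewrite ler_expR lerN2.
    apply: le_trans (expRN_le_sqr sdK) _.
    by rewrite le_eqVlt; apply/orP; left; apply/eqP; field; rewrite !gt_eqF.
  have MB : 0 <= M * (m%:R * B) by rewrite !mulr_ge0.
  have := le_trans lower (le_trans upper (ler_wpM2r MB ex)).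
  rewrite hE; have -> : z / K * (eta / K) = z * eta * K ^+ 2 / K ^+ 4 by field; rewrite gt_eqF.
  rewrite [16 / _ / _ * _]mulrAC -/E ler_pM2r ?invr_gt0 ?exprn_gt0// => /(le_trans _); apply.
  rewrite ler_pM2l ?mulr_gt0// expr2 ler_peMr// ?(ltW K0)//.
  by rewrite ler1n.
pose N := maxn N0 (maxn (Num.bound eta) (Num.bound (E / (z * eta)))).
have nle (x : R) k : (Num.bound x <= k)%N -> 0 <= x -> x < k.+2%:R.
  move=> xk x_ge0; apply: lt_le_trans (archi_boundP x_ge0) _.
  by rewrite ler_nat; exact: leq_trans xk (leqW (leqnSn _)).
have E0 : 0 <= E by rewrite /E !mulr_ge0// ?invr_ge0 ?sqr_ge0.
have N1 : eta < N.+2%:R.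
  by apply: nle (ltW eta0); rewrite leq_max leq_max leqnn orbT.
have N2 : E / (z * eta) < N.+2%:R.
  by apply: nle; [rewrite leq_max leq_max leqnn !orbT|rewrite divr_ge0// mulr_ge0// ltW].
have := key N (leq_maxl _ _) (ltW N1); apply/negP; rewrite -ltNge.
by rewrite ltr_pdivrMr ?mulr_gt0// in N2; rewrite mulrC.
Qed.
End Necessity.

Theorem corollary2p6 (R : realType) (m : nat) (sigma : 'I_m -> R)
    (K00 K01 K10 K11 : 'M[R]_m) (sigma_gt0 : forall i, 0 < sigma i) :
  generates_positive_semigroup (A_Phi sigma K00 K01 K10 K11) <->
  (forall i j : 'I_m, i != j -> 0 <= (- K00) i j /\ 0 <= K11 i j) /\
  (forall i j : 'I_m, 0 <= (- K01) i j /\ 0 <= K10 i j).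
Proof.
split=> [gen|[K_diag K_off]]; last exact: sufficiency.
(* Conditions (i) and (ii) together say exactly that all coefficients between distinct sites are
   nonnegative. *)
have ge0 p q : p != q -> 0 <= site_coef K00 K01 K10 K11 p q.
  exact: site_coef_ge0.
split=> i j; rewrite !mxE.
- move=> ij; split.
  + by apply: (ge0 (false, i) (false, j)); rewrite xpair_eqE.
  + by apply: (ge0 (true, i) (true, j)); rewrite xpair_eqE.
- split; first exact: (ge0 (false, i) (true, j)).
  exact: (ge0 (true, i) (false, j)).
Qed.
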